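(* Let $\mathcal S_0$ be any shape and let $T>0$. If the position of the solid at time $t=0$ is known and the complex potential is measured continuously over the time interval $[0,T]$, then the configuration of the solid at any time $t\in[0,T]$ can be deduced. That is: for $j=1,2$ let $r_j:[0,T]\to\mathbf C$ and $\alpha_j:[0,T]\to\mathbf R$ be continuously differentiable, let $\mathcal S_j(t)=e^{i\alpha_j(t)}\mathcal S_0+r_j(t)$ be the domain occupied by the solid, let $\mathbf v_j(t,z)=i\alpha_j'(t)(z-r_j(t))+r_j'(t)$ be its rigid velocity field, and let $\xi_j(t,\cdot)$ be the corresponding complex potential at time $t$. If $\mathcal S_1(0)=\mathcal S_2(0)$ and if for every $t\in[0,T]$ the functions $\xi_1(t,\cdot)$ and $\xi_2(t,\cdot)$ coincide on a neighbourhood $\{|z|>R(t)\}$ of infinity, then $\mathcal S_1(t)=\mathcal S_2(t)$ and $\mathbf v_1(t,\cdot)=\mathbf v_2(t,\cdot)$ for all $t\in[0,T]$.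
   Context: The plane $\mathbf R^2$ is identified with $\mathbf C$. Shape: a simply connected compact set $\mathcal S_0\subset\mathbf C$ whose exterior $\mathcal F_0=\mathbf C\setminus\mathcal S_0$ is the image of $\Omega=\{|z|>1\}$ under a conformal (holomorphic, injective) map $f(z)=c_1z+\sum_{k\leq -1}c_kz^k$ with $c_1\neq 0$ and $\sum_k|c_k|<\infty$ (the constant term is normalized to $0$ by translation); thus $f$ extends continuously to $\{|z|\ge 1\}$. The position of the solid is the set $\mathcal S$ it occupies (rotations and translations giving the same set are identified); a configuration is a pair (position, rigid velocity field). Complex potential: for a solid occupying $\mathcal S=e^{i\alpha}\mathcal S_0+r$ with rigid velocity field $\mathbf v(z)=i\omega(z-r)+w$ ($\omega\in\mathbf R$, $w\in\mathbf C$), it is the holomorphic function $\xi=\varphi+i\psi$ on $\mathcal F=\mathbf C\setminus\mathcal S$ with $\xi(z)\to 0$ as $|z|\to\infty$ and satisfying the slip condition $\partial_n\varphi=\mathbf v\cdot\mathbf n$ on $\partial\mathcal S$ ($\mathbf n$ the unit normal). The slip condition is understood in integrated form: the function $z\mapsto\xi(e^{i\alpha}f(z)+r)$ extends continuously to $\{|z|\geq 1\}$ and there is a real constant $C$ such that $\operatorname{Im}\xi(x)=\operatorname{Im}(\bar w x)-\frac{\omega}{2}|x-r|^2+C$ for $x=e^{i\alpha}f(z)+r$, $|z|=1$ (boundary values taken through this extension).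
   Formalization: The claim is false for segments and circular arcs (they slide along themselves with zero potential), so shapes lying on a line or circle are excluded; for disks, whose spin is undetectable, only equality of positions is claimed, and equality of velocity fields is claimed for non-disks. *)

(* Defs.v *)
From Stdlib Require Import Reals List.
From Coquelicot Require Import Coquelicot.
Open Scope R_scope.

Definition expi (a : R) : C := (cos a, sin a).

Definition compact_set (S : C -> Prop) : Prop :=
  forall (I : Type) (U : I -> C -> Prop),
    (forall i, open (U i)) ->
    (forall z, S z -> exists i, U i z) ->
    exists l : list I, forall z, S z -> exists i, In i l /\ U i z.

Definition in01 (t : R) : Prop := 0 <= t <= 1.

Definition path_in (S : C -> Prop) (g : R -> C) : Prop :=
  continuous_on in01 g /\ (forall t, in01 t -> S (g t)).

Definition path_connected (S : C -> Prop) : Prop :=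
  (exists z, S z) /\
  forall x y, S x -> S y -> exists g, path_in S g /\ g 0 = x /\ g 1 = y.

(* [H (s, t)]: [t] is the loop parameter and [s] the deformation parameter. *)
Definition null_homotopic (S : C -> Prop) (g : R -> C) : Prop :=
  exists H : R * R -> C,
    continuous_on (fun p => in01 (fst p) /\ in01 (snd p)) H /\
    (forall s t, in01 s -> in01 t -> S (H (s, t))) /\
    (forall t, in01 t -> H (0, t) = g t) /\
    (forall t, in01 t -> H (1, t) = g 0) /\
    (forall s, in01 s -> H (s, 0) = g 0 /\ H (s, 1) = g 0).

Definition simply_connected (S : C -> Prop) : Prop :=
  path_connected S /\
  forall g, path_in S g -> g 0 = g 1 -> null_homotopic S g.

Definition holomorphic_on (D : C -> Prop) (f : C -> C) : Prop :=
  forall z, D z -> @ex_derive C_AbsRing C_NormedModule f z.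

(* [f] stands for the conformal map together with its continuous extension to
   [|z| = 1]: the Laurent expansion is required on [|z| >= 1].  The coefficient
   of [z ^ (-(k+1))] is [c k]; there is no constant term.  The values of [f]
   for [|z| < 1] are irrelevant. *)
Definition is_shape (S0 : C -> Prop) (f : C -> C) : Prop :=
  simply_connected S0 /\ compact_set S0 /\
  holomorphic_on (fun z => 1 < Cmod z) f /\
  (forall z z', 1 < Cmod z -> 1 < Cmod z' -> f z = f z' -> z = z') /\
  (forall x, ~ S0 x <-> exists z, 1 < Cmod z /\ f z = x) /\
  exists (c1 : C) (c : nat -> C),
    c1 <> 0%C /\
    ex_series (fun k => Cmod (c k)) /\
    forall z, 1 <= Cmod z ->
      @is_series C_AbsRing C_NormedModule
        (fun k => (c k / z ^ (k + 1))%C) (f z - c1 * z)%C.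

Definition position (S0 : C -> Prop) (a : R) (r : C) : C -> Prop :=
  fun x => exists y, S0 y /\ x = (expi a * y + r)%C.

Definition velocity (r : C) (w : C) (omega : R) : C -> C :=
  fun z => (Ci * RtoC omega * (z - r) + w)%C.

(* [xi] is a total function; only its values off the solid matter. *)
Definition is_complex_potential (S0 : C -> Prop) (f : C -> C)
    (a : R) (r : C) (w : C) (omega : R) (xi : C -> C) : Prop :=
  holomorphic_on (fun x => ~ position S0 a r x) xi /\
  (forall eps, 0 < eps ->
     exists M, forall z, M < Cmod z -> Cmod (xi z) < eps) /\
  exists (g : C -> C) (K : R),
    continuous_on (fun z => 1 <= Cmod z) g /\
    (forall z, 1 < Cmod z -> g z = xi (expi a * f z + r)%C) /\
    (forall z, Cmod z = 1 ->
       let x := (expi a * f z + r)%C in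
       Im (g z) = Im (Cconj w * x)%C - omega / 2 * (Cmod (x - r)%C) ^ 2 + K).

(* [u] is continuously differentiable on [0, T] with derivative [du]
   (one-sided at the end points). *)
Definition C1_on {V : NormedModule R_AbsRing} (T : R) (u du : R -> V) : Prop :=
  let I := fun t => 0 <= t <= T in
  (forall t, I t ->
     @filterdiff R_AbsRing R_NormedModule V u (within I (locally t))
       (fun h : R => scal h (du t))) /\
  continuous_on I du.

(* A shape lying on a line or on a circle is a segment or a circular arc.  It can
   slide along itself without disturbing the fluid, so that neither its position
   nor its velocity can be recovered. *)
Definition on_line (S : C -> Prop) : Prop :=
  exists (n : C) (k : R), n <> 0%C /\ forall z, S z -> Re (Cconj n * z)%C = k.

Definition on_circle (S : C -> Prop) : Prop :=
  exists (p : C) (rho : R), forall z, S z -> Cmod (z - p)%C = rho.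

(* A disk can spin about its centre without disturbing the fluid, so that its
   angular velocity cannot be recovered. *)
Definition is_disk (S : C -> Prop) : Prop :=
  exists (p : C) (rho : R), forall z, S z <-> Cmod (z - p)%C <= rho.

(* Main.v *)
Require Import Defs.
From Stdlib Require Import Reals Lra Lia List Classical ClassicalEpsilon.
From Coquelicot Require Import Coquelicot.
Open Scope R_scope.

(** In the body frame [y = exp(-ia) (x - r)] a potential [X] is determined by the twist
    [(exp(-ia) r', a')]: it vanishes at infinity and its imaginary part tends, at the points of
    the solid, to an explicit function of the twist plus a constant.  If that function is
    constant, the maximum principle gives [Im X] a sign; as [X] has mean zero on large
    circles, [Im X = 0] there, then [Re X = 0] because [X ^ 2] has mean zero too, and [X = 0]
    everywhere by the identity theorem in the exterior of the unit disk.  Hence [X] depends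
    linearly on the twist.  It vanishes only for the zero twist, since otherwise the boundary
    of the solid lies on a line or on a circle (for a disk, spin is discarded first).  The
    space of twists being finite dimensional, finitely many values of [X] recover the twist.

    Both motions give the same potential in the fixed frame, so the body-frame potential of
    the first motion is that of the second read at points displaced by at most a multiple of
    the distance between the two positions.  The twists therefore differ by at most a
    multiple of this distance, and Gronwall's lemma applies.  An initial rotation or
    translation preserving the solid is absorbed by changing the reference point of the
    second motion.

    Everything needed from complex analysis follows from Goursat's theorem on rectangles in
    logarithmic polar coordinates. *)

(** * Complex differentiability *)


(** The difficulty is uniformity in time: the radius beyond which the two potentials agree may vary
    with [t] without control. The points of measurement are therefore fixed once, outside a disk
    that contains the solid in both body frames at all times, and the identity theorem carries the
    agreement down to that disk; the Gronwall constant then depends only on the shape and on bounds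
    for the motions.

    The hypotheses supply potentials only for the twists of the two motions. The linear map from
    twists to potentials thus lives on the subspace of twists that have a potential, and its
    injectivity is made quantitative by a dual basis of that subspace.

    The conformal map may send several points of the unit circle to one point of the solid, so
    boundary values cannot be carried over by an inverse map. An accumulation argument turns the
    slip condition into a limit at the points of the solid, and the maximum principle is stated with
    such limits. *)

Definition cderiv (f : C -> C) (z l : C) : Prop :=
  forall eps, 0 < eps -> exists delta, 0 < delta /\
    forall y, Cmod (y - z) < delta ->
      Cmod (f y - f z - (y - z) * l) <= eps * Cmod (y - z).

Definition cdiff (f : C -> C) (z : C) : Prop := exists l, cderiv f z l.

Lemma cderiv_is_derive (f : C -> C) (z l : C) :
  cderiv f z l <-> @is_derive C_AbsRing (AbsRing_NormedModule C_AbsRing) f z l.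
Proof.
split.
- intros H; split; [apply (@is_linear_scal_l C_AbsRing (AbsRing_NormedModule C_AbsRing))|].
  intros x Hx.
  apply (@is_filter_lim_locally_unique C_AbsRing (AbsRing_NormedModule C_AbsRing)) in Hx.
  subst x. intros eps.
  destruct (H eps (cond_pos eps)) as [d [Hd Hy]].
  exists (mkposreal d Hd). intros y By. exact (Hy y By).
- intros [_ H] eps Heps.
  destruct (H z (fun P HP => HP) (mkposreal eps Heps)) as [d Hy].
  exists d; split; [apply cond_pos|]. intros y By. exact (Hy y By).
Qed.

(** The target structure [C_NormedModule] differs from the one in [cderiv_is_derive], but its norm
    is also [Cmod], so the approximation clause of [filterdiff] transfers as it is. *)
Lemma ex_derive_cdiff (f : C -> C) (z : C) :
  @ex_derive C_AbsRing C_NormedModule f z -> cdiff f z.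
Proof.
intros [l [_ H]]. exists l. intros eps Heps.
destruct (H z (fun P HP => HP) (mkposreal eps Heps)) as [d Hy].
exists d; split; [apply cond_pos|]. intros y By. exact (Hy y By).
Qed.

Lemma cdiff_ext (f g : C -> C) (z : C) (d : R) :
  0 < d -> (forall y, Cmod (y - z) < d -> f y = g y) -> cdiff f z -> cdiff g z.
Proof.
intros Hd E [l H]. exists l. intros eps Heps.
destruct (H eps Heps) as [e [He Hy]].
exists (Rmin d e); split; [now apply Rmin_glb_lt|]. intros y By.
rewrite <- (E y), <- (E z).
- apply Hy. eapply Rlt_le_trans; [exact By|apply Rmin_r].
- replace (z - z)%C with (RtoC 0) by ring. now rewrite Cmod_0.
- eapply Rlt_le_trans; [exact By|apply Rmin_l].
Qed.

Lemma cdiff_const (c z : C) : cdiff (fun _ => c) z.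
Proof.
exists (RtoC 0). apply cderiv_is_derive.
exact (@is_derive_const C_AbsRing (AbsRing_NormedModule C_AbsRing) c z).
Qed.

Lemma cdiff_id (z : C) : cdiff (fun y => y) z.
Proof. exists (RtoC 1). apply cderiv_is_derive. exact (@is_derive_id C_AbsRing z). Qed.

Lemma cdiff_plus (f g : C -> C) (z : C) :
  cdiff f z -> cdiff g z -> cdiff (fun y => (f y + g y)%C) z.
Proof.
intros [l Hl%cderiv_is_derive] [m Hm%cderiv_is_derive].
exists (l + m)%C. apply cderiv_is_derive.
exact (@is_derive_plus C_AbsRing (AbsRing_NormedModule C_AbsRing) f g z l m Hl Hm).
Qed.

Lemma cdiff_mult (f g : C -> C) (z : C) :
  cdiff f z -> cdiff g z -> cdiff (fun y => (f y * g y)%C) z.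
Proof.
intros [l Hl%cderiv_is_derive] [m Hm%cderiv_is_derive].
exists (l * g z + f z * m)%C. apply cderiv_is_derive.
exact (@is_derive_mult C_AbsRing f g z l m Hl Hm Cmult_comm).
Qed.

Lemma cdiff_comp (f g : C -> C) (z : C) :
  cdiff f (g z) -> cdiff g z -> cdiff (fun y => f (g y)) z.
Proof.
intros [l Hl%cderiv_is_derive] [m Hm%cderiv_is_derive].
exists (m * l)%C. apply cderiv_is_derive.
exact (@is_derive_comp C_AbsRing (AbsRing_NormedModule C_AbsRing) f g z l m Hl Hm).
Qed.

Lemma cdiff_scal (c : C) (f : C -> C) (z : C) :
  cdiff f z -> cdiff (fun y => (c * f y)%C) z.
Proof. intros H. apply cdiff_mult; [apply cdiff_const|exact H]. Qed.

Lemma cdiff_minus (f g : C -> C) (z : C) :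
  cdiff f z -> cdiff g z -> cdiff (fun y => (f y - g y)%C) z.
Proof.
intros Hf Hg.
apply cdiff_ext with (fun y => (f y + RtoC (-1) * g y)%C) 1; [lra| |].
- intros y _. ring.
- apply cdiff_plus; [exact Hf|now apply cdiff_scal].
Qed.

Lemma cdiff_affine (a b z : C) : cdiff (fun y => (a * y + b)%C) z.
Proof. apply cdiff_plus; [apply cdiff_scal, cdiff_id|apply cdiff_const]. Qed.

Lemma cdiff_pow (n : nat) (z : C) : cdiff (fun y => (y ^ n)%C) z.
Proof.
induction n as [|n IH]; [exact (cdiff_const (RtoC 1) z)|].
exact (cdiff_mult _ _ z (cdiff_id z) IH).
Qed.

Lemma cderiv_lip (f : C -> C) (z l : C) : cderiv f z l ->
  exists d, 0 < d /\ forall y, Cmod (y - z) < d ->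
    Cmod (f y - f z) <= (Cmod l + 1) * Cmod (y - z).
Proof.
intros H. destruct (H 1 Rlt_0_1) as [d [Hd Hy]].
exists d; split; [exact Hd|]. intros y By. specialize (Hy y By).
replace (f y - f z)%C with ((f y - f z - (y - z) * l) + (y - z) * l)%C by ring.
eapply Rle_trans; [apply Cmod_triangle|]. rewrite Cmod_mult. lra.
Qed.

Lemma cdiff_lip (f : C -> C) (z : C) : cdiff f z ->
  exists L d, 0 <= L /\ 0 < d /\ forall y, Cmod (y - z) < d ->
    Cmod (f y - f z) <= L * Cmod (y - z).
Proof.
intros [l H]. destruct (cderiv_lip f z l H) as [d [Hd Hy]].
exists (Cmod l + 1), d. split; [generalize (Cmod_ge_0 l); lra|now split].
Qed.

Lemma cdiff_cont (f : C -> C) (z : C) : cdiff f z ->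
  forall eps, 0 < eps -> exists d, 0 < d /\
    forall y, Cmod (y - z) < d -> Cmod (f y - f z) < eps.
Proof.
intros H eps Heps. destruct (cdiff_lip f z H) as [L [d [HL [Hd Hy]]]].
exists (Rmin d (eps / (L + 1))). split.
{ apply Rmin_glb_lt; [exact Hd|apply Rdiv_lt_0_compat; lra]. }
intros y By.
assert (B1 := Rlt_le_trans _ _ _ By (Rmin_l _ _)).
assert (B2 := Rlt_le_trans _ _ _ By (Rmin_r _ _)).
apply Rle_lt_trans with (1 := Hy y B1).
apply Rmult_lt_compat_r with (r := L + 1) in B2; [|lra].
replace (eps / (L + 1) * (L + 1)) with eps in B2 by (field; lra).
generalize (Cmod_ge_0 (y - z)); nra.
Qed.

(** * Inequalities for the modulus *)

Lemma im_le_Cmod (c : C) : Rabs (Im c) <= Cmod c.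
Proof. eapply Rle_trans; [apply Rmax_r|apply (Rmax_Cmod c)]. Qed.

Lemma Cmod_le_abs (c : C) : Cmod c <= Rabs (Re c) + Rabs (Im c).
Proof.
destruct c as [x y].
replace (x, y) with (RtoC x + Ci * RtoC y)%C
  by (unfold RtoC, Ci, Cplus, Cmult; simpl; f_equal; ring).
eapply Rle_trans; [apply Cmod_triangle|].
rewrite Cmod_mult, Cmod_Ci, !Cmod_R. simpl.
replace (x + (0 * y - 1 * 0)) with x by ring.
replace (0 + (0 * 0 + 1 * y)) with y by ring. lra.
Qed.

Lemma Cmod_minus_sym (x y : C) : Cmod (x - y) = Cmod (y - x).
Proof. rewrite <- Cmod_opp. f_equal. ring. Qed.

Lemma Cmod_sub_le (x y : C) : Cmod (x - y) <= Cmod x + Cmod y.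
Proof. unfold Cminus. rewrite <- (Cmod_opp y). apply Cmod_triangle. Qed.

Lemma Cmod_triangle_inv (x y : C) : Cmod x - Cmod y <= Cmod (x - y).
Proof.
generalize (Cmod_triangle (x - y) y).
replace (x - y + y)%C with x by ring. lra.
Qed.

Lemma Cmod_dist_triangle (x y z : C) : Cmod (x - z) <= Cmod (x - y) + Cmod (y - z).
Proof. generalize (Cmod_triangle (x - y) (y - z)). now replace (x - y + (y - z))%C with (x - z)%C by ring. Qed.

Lemma Cmod_le_dist (x y : C) : Cmod x <= Cmod y + Cmod (x - y).
Proof. generalize (Cmod_triangle_inv x y). lra. Qed.

Lemma C_eq (x y : C) : Re x = Re y -> Im x = Im y -> x = y.
Proof. destruct x, y; simpl; congruence. Qed.

(** Trades a modulus for the real part of a unimodular multiple: the maximum principle and the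
    functionals measuring twists both deal with real parts. *)
Lemma Cmod_as_Re (z : C) : exists lam, Cmod lam = 1 /\ Re (lam * z)%C = Cmod z.
Proof.
destruct (classic (z = RtoC 0)) as [->|Hz].
- exists (RtoC 1). split; [apply Cmod_1|]. rewrite Cmod_0. simpl. ring.
- assert (Hm : 0 < Cmod z) by now apply Cmod_gt_0.
  exists (Cconj z / RtoC (Cmod z))%C. split.
  + rewrite Cmod_div, Cmod_conj, Cmod_R, Rabs_pos_eq; [field; lra|lra|].
    intros E. apply (f_equal Re) in E. simpl in E. lra.
  + replace (Cconj z / RtoC (Cmod z) * z)%C with (z * Cconj z / RtoC (Cmod z))%C
      by (unfold Cdiv; ring).
    rewrite <- Cmod2_conj. rewrite <- RtoC_div by lra. simpl. field. lra.
Qed.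


(** * Nested intervals and bisection of rectangles *)

Lemma dependent_choice {A : Type} (Q : A -> Prop) (S : A -> A -> Prop) (x0 : A) :
  Q x0 -> (forall x, Q x -> exists y, Q y /\ S x y) ->
  exists s : nat -> A, s O = x0 /\ forall n, Q (s n) /\ S (s n) (s (Datatypes.S n)).
Proof.
intros H0 Hs.
set (next := fun x => epsilon (inhabits x) (fun y => Q y /\ S x y)).
assert (Hn : forall x, Q x -> Q (next x) /\ S x (next x)).
{ intros x Hx. exact (epsilon_spec (inhabits x) _ (Hs x Hx)). }
set (s := nat_rect (fun _ => A) x0 (fun _ => next)).
assert (HQ : forall n, Q (s n)).
{ induction n as [|n IH]; [exact H0|exact (proj1 (Hn _ IH))]. }
exists s. split; [reflexivity|]. intros n. split; [apply HQ|exact (proj2 (Hn _ (HQ n)))].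
Qed.

Lemma nested_intervals (a b : nat -> R) :
  (forall n, a n <= b n) -> (forall n, a n <= a (S n) /\ b (S n) <= b n) ->
  exists x, forall n, a n <= x <= b n.
Proof.
intros Hab Hs.
assert (Ha : forall n m, a n <= a (n + m)%nat).
{ intros n m. induction m as [|m IH]; [rewrite Nat.add_0_r; lra|].
  rewrite Nat.add_succ_r. destruct (Hs (n + m)%nat); lra. }
assert (Hb : forall n m, b (n + m)%nat <= b n).
{ intros n m. induction m as [|m IH]; [rewrite Nat.add_0_r; lra|].
  rewrite Nat.add_succ_r. destruct (Hs (n + m)%nat); lra. }
assert (Hc : forall n m, a n <= b m).
{ intros n m. specialize (Ha n m). specialize (Hb m n).
  rewrite Nat.add_comm in Hb. specialize (Hab (n + m)%nat). lra. }
destruct (completeness (fun y => exists n, y = a n)) as [x [Hx1 Hx2]].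
- exists (b O). intros y [n ->]. apply Hc.
- now exists (a O), O.
- exists x. intros n. split; [apply Hx1; now exists n|].
  apply Hx2. intros y [m ->]. apply Hc.
Qed.

(** Serves both Goursat's theorem and the compactness arguments. The exact side lengths
    [(b - a) / 2 ^ k] and [(d - c) / 2 ^ k] are recorded because Goursat's argument compares
    areas. *)
Lemma bisection (P : R -> R -> R -> R -> Prop) (a b c d : R) :
  a <= b -> c <= d ->
  (forall a b c d, a <= b -> c <= d -> P a b c d ->
     let m := (a + b) / 2 in let n := (c + d) / 2 in
     P a m c n \/ P m b c n \/ P a m n d \/ P m b n d) ->
  P a b c d ->
  exists x y, a <= x <= b /\ c <= y <= d /\
    forall eps, 0 < eps -> exists a' b' c' d' (k : nat),
      a <= a' <= x /\ x <= b' <= b /\ c <= c' <= y /\ y <= d' <= d /\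
      b' - a' = (b - a) / 2 ^ k /\ d' - c' = (d - c) / 2 ^ k /\
      b' - a' < eps /\ d' - c' < eps /\ P a' b' c' d'.
Proof.
intros Hab Hcd Hstep H0.
set (A := fun q : R * R * (R * R) => fst (fst q)).
set (B := fun q : R * R * (R * R) => snd (fst q)).
set (C' := fun q : R * R * (R * R) => fst (snd q)).
set (D := fun q : R * R * (R * R) => snd (snd q)).
destruct (dependent_choice
  (fun q => A q <= B q /\ C' q <= D q /\ P (A q) (B q) (C' q) (D q))
  (fun q q' => A q <= A q' /\ B q' <= B q /\ C' q <= C' q' /\ D q' <= D q /\
     B q' - A q' = (B q - A q) / 2 /\ D q' - C' q' = (D q - C' q) / 2)
  ((a, b), (c, d))) as [s [s0 Hs]].
- now repeat split.
- intros [[a1 b1] [c1 d1]]. unfold A, B, C', D. simpl. intros [h1 [h2 h3]].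
  destruct (Hstep a1 b1 c1 d1 h1 h2 h3) as [h|[h|[h|h]]];
    [exists ((a1, (a1 + b1) / 2), (c1, (c1 + d1) / 2))
    |exists (((a1 + b1) / 2, b1), (c1, (c1 + d1) / 2))
    |exists ((a1, (a1 + b1) / 2), ((c1 + d1) / 2, d1))
    |exists (((a1 + b1) / 2, b1), ((c1 + d1) / 2, d1))];
    simpl; repeat split; try exact h; lra.
- assert (Hlen : forall n, B (s n) - A (s n) = (b - a) / 2 ^ n /\
                          D (s n) - C' (s n) = (d - c) / 2 ^ n).
  { induction n as [|n [IH1 IH2]].
    - rewrite s0. unfold A, B, C', D. simpl. split; field.
    - destruct (Hs n) as [_ [_ [_ [_ [_ [-> ->]]]]]]. rewrite IH1, IH2. simpl.
      assert (2 ^ n <> 0) by (apply pow_nonzero; lra). split; field; assumption. }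
  destruct (nested_intervals (fun n => A (s n)) (fun n => B (s n))) as [x Hx].
  { intros n. apply (Hs n). }
  { intros n. destruct (Hs n) as [_ H]. tauto. }
  destruct (nested_intervals (fun n => C' (s n)) (fun n => D (s n))) as [y Hy].
  { intros n. apply (Hs n). }
  { intros n. destruct (Hs n) as [_ H]. tauto. }
  assert (Hin : forall n, a <= A (s n) /\ B (s n) <= b /\ c <= C' (s n) /\ D (s n) <= d).
  { induction n as [|n IH].
    - rewrite s0. unfold A, B, C', D. simpl. lra.
    - destruct (Hs n) as [_ H]. lra. }
  exists x, y. split; [|split].
  + generalize (Hx O) (Hin O). lra.
  + generalize (Hy O) (Hin O). lra.
  + intros eps Heps.
    (* One threshold makes both sides shorter than [eps]; the [+ 1] keeps the denominator positive
       for a degenerate rectangle. *)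
    assert (He : 0 < eps / (b - a + (d - c) + 1)) by (apply Rdiv_lt_0_compat; lra).
    destruct (pow_lt_1_zero (1 / 2) ltac:(rewrite Rabs_pos_eq; lra) _ He) as [N HN].
    specialize (HN N (le_n N)). rewrite Rabs_pos_eq in HN by (apply pow_le; lra).
    assert (Hp : 0 < 2 ^ N) by (apply pow_lt; lra).
    assert (E : (1 / 2) ^ N = / 2 ^ N).
    { unfold Rdiv. rewrite Rmult_1_l. now rewrite pow_inv. }
    rewrite E in HN. destruct (Hlen N) as [L1 L2].
    assert (Hip : 0 < / 2 ^ N) by now apply Rinv_0_lt_compat.
    assert (K : / 2 ^ N * (b - a + (d - c) + 1) < eps).
    { apply Rmult_lt_compat_r with (r := b - a + (d - c) + 1) in HN; [|lra].
      replace (eps / (b - a + (d - c) + 1) * (b - a + (d - c) + 1)) with eps in HN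
        by (field; lra). exact HN. }
    unfold Rdiv in L1, L2.
    exists (A (s N)), (B (s N)), (C' (s N)), (D (s N)), N.
    destruct (Hin N) as [i1 [i2 [i3 i4]]].
    generalize (Hx N) (Hy N). intros hx hy.
    repeat split; try tauto; try nra. apply (Hs N).
Qed.

(** * Goursat's theorem *)


Lemma continuous_eps (f : R -> R) (x : R) :
  (forall eps, 0 < eps -> exists d, 0 < d /\
     forall y, Rabs (y - x) < d -> Rabs (f y - f x) < eps) -> continuous f x.
Proof.
intros H. apply (proj2 (filterlim_locally _ _)). intros eps.
destruct (H eps (cond_pos eps)) as [d [Hd Hy]].
exists (mkposreal d Hd). intros y By. exact (Hy y By).
Qed.

(* Of the Cauchy-Riemann equations for [P + i Q] only [dP/dx = dQ/dy] is needed. *)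
Definition half_CR (P Q : R -> R -> R) (x y : R) : Prop :=
  exists p1 p2 q1, forall eps, 0 < eps -> exists d, 0 < d /\
    forall x' y', Rabs (x' - x) < d -> Rabs (y' - y) < d ->
      Rabs (P x' y' - P x y - p1 * (x' - x) - p2 * (y' - y))
        <= eps * (Rabs (x' - x) + Rabs (y' - y)) /\
      Rabs (Q x' y' - Q x y - q1 * (x' - x) - p1 * (y' - y))
        <= eps * (Rabs (x' - x) + Rabs (y' - y)).

Lemma half_CR_cont (P Q : R -> R -> R) (x y : R) : half_CR P Q x y ->
  continuous (fun y' => P x y') y /\ continuous (fun x' => Q x' y) x.
Proof.
intros [p1 [p2 [q1 H]]]. destruct (H 1 Rlt_0_1) as [d [Hd Hy]].
split; apply continuous_eps; intros eps Heps.
- assert (Hq : 0 < eps / (Rabs p2 + 2))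
    by (apply Rdiv_lt_0_compat; generalize (Rabs_pos p2); lra).
  exists (Rmin d (eps / (Rabs p2 + 2))). split; [now apply Rmin_glb_lt|].
  intros y' By.
  assert (B1 := Rlt_le_trans _ _ _ By (Rmin_l _ _)).
  assert (B2 := Rlt_le_trans _ _ _ By (Rmin_r _ _)).
  destruct (Hy x y') as [h _]; [|exact B1|].
  { rewrite Rminus_diag, Rabs_R0; exact Hd. }
  rewrite Rminus_diag, Rabs_R0 in h.
  replace (P x y' - P x y) with
    ((P x y' - P x y - p1 * 0 - p2 * (y' - y)) + p2 * (y' - y)) by ring.
  eapply Rle_lt_trans; [apply Rabs_triang|]. rewrite Rabs_mult.
  apply Rmult_lt_compat_r with (r := Rabs p2 + 2) in B2;
    [|generalize (Rabs_pos p2); lra].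
  replace (eps / (Rabs p2 + 2) * (Rabs p2 + 2)) with eps in B2
    by (field; generalize (Rabs_pos p2); lra).
  generalize (Rabs_pos (y' - y)); lra.
- assert (Hq : 0 < eps / (Rabs q1 + 2))
    by (apply Rdiv_lt_0_compat; generalize (Rabs_pos q1); lra).
  exists (Rmin d (eps / (Rabs q1 + 2))). split; [now apply Rmin_glb_lt|].
  intros x' By.
  assert (B1 := Rlt_le_trans _ _ _ By (Rmin_l _ _)).
  assert (B2 := Rlt_le_trans _ _ _ By (Rmin_r _ _)).
  destruct (Hy x' y) as [_ h]; [exact B1| |].
  { rewrite Rminus_diag, Rabs_R0; exact Hd. }
  rewrite Rminus_diag, Rabs_R0 in h.
  replace (Q x' y - Q x y) with
    ((Q x' y - Q x y - q1 * (x' - x) - p1 * 0) + q1 * (x' - x)) by ring.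
  eapply Rle_lt_trans; [apply Rabs_triang|]. rewrite Rabs_mult.
  apply Rmult_lt_compat_r with (r := Rabs q1 + 2) in B2;
    [|generalize (Rabs_pos q1); lra].
  replace (eps / (Rabs q1 + 2) * (Rabs q1 + 2)) with eps in B2
    by (field; generalize (Rabs_pos q1); lra).
  generalize (Rabs_pos (x' - x)); lra.
Qed.

(** The imaginary part of the counterclockwise contour integral of [P + i Q], that is the integral
    of [Q dx + P dy], with opposite sides paired. *)
Definition bdry_int (P Q : R -> R -> R) (a b c d : R) : R :=
  RInt (fun x => Q x c - Q x d) a b + RInt (fun y => P b y - P a y) c d.

Section Goursat.

Variables (P Q : R -> R -> R) (a b c d : R).
Hypothesis Hcr : forall x y, a <= x <= b -> c <= y <= d -> half_CR P Q x y.

Lemma ex_RInt_horizontal (a' b' y1 y2 : R) :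
  a <= a' -> a' <= b' -> b' <= b -> c <= y1 <= d -> c <= y2 <= d ->
  ex_RInt (fun x => Q x y1 - Q x y2) a' b'.
Proof.
intros h1 h2 h3 h4 h5. apply (@ex_RInt_continuous R_CompleteNormedModule).
rewrite Rmin_left, Rmax_right by exact h2. intros z Hz.
apply (continuous_minus (fun x => Q x y1) (fun x => Q x y2)).
- apply (half_CR_cont P Q z y1). apply Hcr; lra.
- apply (half_CR_cont P Q z y2). apply Hcr; lra.
Qed.

Lemma ex_RInt_vertical (c' d' x1 x2 : R) :
  c <= c' -> c' <= d' -> d' <= d -> a <= x1 <= b -> a <= x2 <= b ->
  ex_RInt (fun y => P x1 y - P x2 y) c' d'.
Proof.
intros h1 h2 h3 h4 h5. apply (@ex_RInt_continuous R_CompleteNormedModule).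
rewrite Rmin_left, Rmax_right by exact h2. intros z Hz.
apply (continuous_minus (fun y => P x1 y) (fun y => P x2 y)).
- apply (half_CR_cont P Q x1 z). apply Hcr; lra.
- apply (half_CR_cont P Q x2 z). apply Hcr; lra.
Qed.

Lemma RInt_cut (f g h : R -> R) (u v : R) :
  ex_RInt f u v -> ex_RInt g u v -> (forall x, h x = f x + g x) ->
  RInt h u v = RInt f u v + RInt g u v.
Proof.
intros Hf Hg E. rewrite (RInt_ext _ (fun x => plus (f x) (g x))).
- exact (RInt_plus f g u v Hf Hg).
- intros x _. apply E.
Qed.

Lemma bdry_int_split_x (a' m b' c' d' : R) :
  a <= a' -> a' <= m -> m <= b' -> b' <= b -> c <= c' -> c' <= d' -> d' <= d ->
  bdry_int P Q a' b' c' d' = bdry_int P Q a' m c' d' + bdry_int P Q m b' c' d'.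
Proof.
intros. unfold bdry_int.
rewrite <- (RInt_Chasles (fun x => Q x c' - Q x d') a' m b')
  by (apply ex_RInt_horizontal; lra).
rewrite (RInt_cut (fun y => P m y - P a' y) (fun y => P b' y - P m y)
  (fun y => P b' y - P a' y)); [|apply ex_RInt_vertical; lra..|intros; ring].
unfold plus; simpl. ring.
Qed.

Lemma bdry_int_split_y (a' b' c' m d' : R) :
  a <= a' -> a' <= b' -> b' <= b -> c <= c' -> c' <= m -> m <= d' -> d' <= d ->
  bdry_int P Q a' b' c' d' = bdry_int P Q a' b' c' m + bdry_int P Q a' b' m d'.
Proof.
intros. unfold bdry_int.
rewrite <- (RInt_Chasles (fun y => P b' y - P a' y) c' m d')
  by (apply ex_RInt_vertical; lra).
rewrite (RInt_cut (fun x => Q x c' - Q x m) (fun x => Q x m - Q x d')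
  (fun x => Q x c' - Q x d')); [|apply ex_RInt_horizontal; lra..|intros; ring].
unfold plus; simpl. ring.
Qed.

Lemma RInt_add_const (f : R -> R) (k u v : R) :
  ex_RInt f u v -> RInt (fun x => f x + k) u v = RInt f u v + (v - u) * k.
Proof.
intros Hf. rewrite (RInt_cut f (fun _ => k)); [|exact Hf|apply ex_RInt_const|reflexivity].
now rewrite RInt_const.
Qed.

Lemma ex_RInt_add_const (f : R -> R) (k u v : R) :
  ex_RInt f u v -> ex_RInt (fun x => f x + k) u v.
Proof. intros Hf. exact (ex_RInt_plus f (fun _ => k) u v Hf (ex_RInt_const _ _ _)). Qed.

(* The linear parts of [P] and [Q] contribute opposite amounts to the two integrals. *)
Lemma bdry_int_local (x y eps : R) :
  a <= x <= b -> c <= y <= d -> 0 < eps -> exists r, 0 < r /\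
  forall a' b' c' d', a <= a' <= x -> x <= b' <= b -> c <= c' <= y -> y <= d' <= d ->
    b' - a' < r -> d' - c' < r ->
    Rabs (bdry_int P Q a' b' c' d') <= 2 * eps * (b' - a' + (d' - c')) ^ 2.
Proof.
intros Hx Hy Heps. destruct (Hcr x y Hx Hy) as [p1 [p2 [q1 H]]].
destruct (H eps Heps) as [r [Hr Hb]]. exists r; split; [exact Hr|].
intros a' b' c' d' ha hb hc hd hab hcd.
assert (E : bdry_int P Q a' b' c' d' =
  RInt (fun x => (Q x c' - Q x d') + p1 * (d' - c')) a' b' +
  RInt (fun y => (P b' y - P a' y) + - p1 * (b' - a')) c' d').
{ unfold bdry_int. rewrite !RInt_add_const; [ring| |];
    [apply ex_RInt_vertical|apply ex_RInt_horizontal]; lra. }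
rewrite E. eapply Rle_trans; [apply Rabs_triang|].
set (L := b' - a' + (d' - c')).
assert (HL : 0 <= L) by (unfold L; lra).
assert (Hn : forall x' y', a' <= x' <= b' -> c' <= y' <= d' ->
  Rabs (x' - x) < r /\ Rabs (y' - y) < r /\ Rabs (x' - x) + Rabs (y' - y) <= L).
{ intros x' y' h1 h2. assert (Rabs (x' - x) <= b' - a') by (apply Rabs_le; lra).
  assert (Rabs (y' - y) <= d' - c') by (apply Rabs_le; lra).
  unfold L. repeat split; lra. }
assert (I1 : Rabs (RInt (fun x => (Q x c' - Q x d') + p1 * (d' - c')) a' b')
  <= (b' - a') * (2 * eps * L)).
{ apply abs_RInt_le_const; [lra|apply ex_RInt_add_const, ex_RInt_horizontal; lra|].
  intros t Ht.
  destruct (Hn t c' Ht ltac:(lra)) as [n1 [n2 n3]].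
  destruct (Hn t d' Ht ltac:(lra)) as [m1 [m2 m3]].
  destruct (Hb t c' n1 n2) as [_ k1]. destruct (Hb t d' m1 m2) as [_ k2].
  replace (Q t c' - Q t d' + p1 * (d' - c')) with
    ((Q t c' - Q x y - q1 * (t - x) - p1 * (c' - y)) -
     (Q t d' - Q x y - q1 * (t - x) - p1 * (d' - y))) by ring.
  eapply Rle_trans; [apply Rabs_triang|]. rewrite Rabs_Ropp. nra. }
assert (I2 : Rabs (RInt (fun y => (P b' y - P a' y) + - p1 * (b' - a')) c' d')
  <= (d' - c') * (2 * eps * L)).
{ apply abs_RInt_le_const; [lra|apply ex_RInt_add_const, ex_RInt_vertical; lra|].
  intros t Ht.
  destruct (Hn b' t ltac:(lra) Ht) as [n1 [n2 n3]].
  destruct (Hn a' t ltac:(lra) Ht) as [m1 [m2 m3]].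
  destruct (Hb b' t n1 n2) as [k1 _]. destruct (Hb a' t m1 m2) as [k2 _].
  replace (P b' t - P a' t + - p1 * (b' - a')) with
    ((P b' t - P x y - p1 * (b' - x) - p2 * (t - y)) -
     (P a' t - P x y - p1 * (a' - x) - p2 * (t - y))) by ring.
  eapply Rle_trans; [apply Rabs_triang|]. rewrite Rabs_Ropp. nra. }
replace (2 * eps * L ^ 2) with ((b' - a') * (2 * eps * L) + (d' - c') * (2 * eps * L))
  by (unfold L; ring).
lra.
Qed.

(** Quartering keeps the ratio of the boundary integral to the area from decreasing, whereas
    differentiability at the limit point makes this ratio arbitrarily small, the aspect ratio of the
    rectangles being fixed. *)
Lemma goursat : a < b -> c < d -> bdry_int P Q a b c d = 0.
Proof.
intros Hab Hcd. apply NNPP. intros Hne. apply Rabs_pos_lt in Hne.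
set (eta := Rabs (bdry_int P Q a b c d)) in *.
set (A := (b - a) * (d - c)).
assert (HA : 0 < A) by (unfold A; nra).
(* The invariant says that the ratio of integral to area is at least [eta / A], its value on the
   whole rectangle; it is stated without division. *)
destruct (bisection (fun a' b' c' d' => (a <= a' /\ b' <= b /\ c <= c' /\ d' <= d) /\
    eta * ((b' - a') * (d' - c')) <= A * Rabs (bdry_int P Q a' b' c' d')) a b c d)
  as [x [y [Hx [Hy Hloc]]]].
- lra.
- lra.
- intros a' b' c' d' h1 h2 [[i1 [i2 [i3 i4]]] hP] m n.
  assert (hm : a' <= m <= b') by (unfold m; lra).
  assert (hn : c' <= n <= d') by (unfold n; lra).
  apply NNPP. intros Hno.
  apply not_or_and in Hno. destruct Hno as [N1 Hno].
  apply not_or_and in Hno. destruct Hno as [N2 Hno].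
  apply not_or_and in Hno. destruct Hno as [N3 N4].
  assert (K : forall u v w z, a <= u /\ v <= b /\ c <= w /\ z <= d ->
    v - u = (b' - a') / 2 -> z - w = (d' - c') / 2 ->
    ~ ((a <= u /\ v <= b /\ c <= w /\ z <= d) /\
       eta * ((v - u) * (z - w)) <= A * Rabs (bdry_int P Q u v w z)) ->
    A * Rabs (bdry_int P Q u v w z) < eta * ((b' - a') * (d' - c')) / 4).
  { intros u v w z hi e1 e2 hno. apply Rnot_le_lt. intros hle. apply hno.
    split; [exact hi|]. rewrite e1, e2. lra. }
  apply K in N1; [|lra|unfold m; lra|unfold n; lra].
  apply K in N2; [|lra|unfold m; lra|unfold n; lra].
  apply K in N3; [|lra|unfold m; lra|unfold n; lra].
  apply K in N4; [|lra|unfold m; lra|unfold n; lra].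
  rewrite (bdry_int_split_y a' b' c' n d') in hP by lra.
  rewrite (bdry_int_split_x a' m b' c' n), (bdry_int_split_x a' m b' n d') in hP by lra.
  assert (T := Rabs_triang (bdry_int P Q a' m c' n + bdry_int P Q m b' c' n)
    (bdry_int P Q a' m n d' + bdry_int P Q m b' n d')).
  assert (T1 := Rabs_triang (bdry_int P Q a' m c' n) (bdry_int P Q m b' c' n)).
  assert (T2 := Rabs_triang (bdry_int P Q a' m n d') (bdry_int P Q m b' n d')).
  nra.
- split; [lra|]. fold eta A. lra.
- set (L := b - a + (d - c)).
  assert (HL : 0 < L) by (unfold L; lra).
  (* After [k] halvings the invariant forces an integral of at least [eta * q ^ 2] with
     [q = / 2 ^ k]; this choice bounds it by half of that. *)
  assert (He : 0 < eta / (4 * L ^ 2)) by (apply Rdiv_lt_0_compat; nra).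
  destruct (bdry_int_local x y _ Hx Hy He) as [r [Hr Hb]].
  destruct (Hloc r Hr) as [a' [b' [c' [d' [k [h1 [h2 [h3 [h4 [h5 [h6 [h7 [h8 [_ h9]]]]]]]]]]]]]].
  specialize (Hb a' b' c' d' h1 h2 h3 h4 h7 h8).
  rewrite h5, h6 in h9, Hb.
  assert (Hk : 0 < / 2 ^ k) by (apply Rinv_0_lt_compat, pow_lt; lra).
  set (q := / 2 ^ k) in *. unfold Rdiv in h9, Hb. fold q in h9, Hb.
  replace ((b - a) * q + (d - c) * q) with (L * q) in Hb by (unfold L; ring).
  replace (2 * (eta * / (4 * L ^ 2)) * (L * q) ^ 2) with (eta * q ^ 2 / 2) in Hb
    by (field; lra).
  replace ((b - a) * q * ((d - c) * q)) with (A * q ^ 2) in h9 by (unfold A; ring).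
  assert (0 < q ^ 2) by nra.
  assert (A * Rabs (bdry_int P Q a' b' c' d') <= A * (eta * q ^ 2 / 2)) by nra.
  assert (0 < A * (eta * q ^ 2)) by (apply Rmult_lt_0_compat; nra).
  nra.
Qed.

End Goursat.


(** * The complex exponential, polar form and integrals over circles *)

Lemma derivable_pt_lim_small (f : R -> R) (x l : R) : derivable_pt_lim f x l ->
  forall eps, 0 < eps -> exists d, 0 < d /\ forall h, Rabs h < d ->
    Rabs (f (x + h) - f x - l * h) <= eps * Rabs h.
Proof.
intros H eps Heps. destruct (H eps Heps) as [d Hd].
exists d; split; [apply cond_pos|]. intros h Bh.
destruct (Req_dec h 0) as [->|Hh].
- rewrite Rplus_0_r, Rmult_0_r, Rminus_0_r, Rminus_diag, !Rabs_R0. lra.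
- specialize (Hd h Hh Bh).
  replace (f (x + h) - f x - l * h) with (((f (x + h) - f x) / h - l) * h)
    by (field; exact Hh).
  rewrite Rabs_mult. generalize (Rabs_pos h); nra.
Qed.

Definition cexp (z : C) : C := (exp (Re z) * cos (Im z), exp (Re z) * sin (Im z)).

Lemma cexp_plus (z w : C) : cexp (z + w) = (cexp z * cexp w)%C.
Proof.
destruct z as [a b], w as [c d]. unfold cexp, Cmult, Cplus. simpl.
rewrite exp_plus, cos_plus, sin_plus. f_equal; ring.
Qed.

Lemma cexp_0 : cexp 0 = RtoC 1.
Proof. unfold cexp. simpl. rewrite exp_0, cos_0, sin_0. unfold RtoC. f_equal; ring. Qed.

Lemma cexp_polar (s t : R) : cexp (s, t) = (RtoC (exp s) * expi t)%C.
Proof. unfold cexp, expi, Cmult, RtoC. simpl. f_equal; ring. Qed.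

Lemma expi_plus (a b : R) : expi (a + b) = (expi a * expi b)%C.
Proof. unfold expi, Cmult. simpl. rewrite cos_plus, sin_plus. f_equal; ring. Qed.

Lemma expi_0 : expi 0 = RtoC 1.
Proof. unfold expi. now rewrite cos_0, sin_0. Qed.

Lemma expi_opp (a : R) : (expi (- a) * expi a)%C = RtoC 1.
Proof. rewrite <- expi_plus, Rplus_opp_l. apply expi_0. Qed.

Lemma Cmod_expi (a : R) : Cmod (expi a) = 1.
Proof.
unfold Cmod, expi. simpl. replace (cos a * (cos a * 1) + sin a * (sin a * 1))
  with (Rsqr (sin a) + Rsqr (cos a)) by (unfold Rsqr; ring).
rewrite sin2_cos2. apply sqrt_1.
Qed.

Lemma cexp_period (s t : R) : cexp (s, t + 2 * PI) = cexp (s, t).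
Proof.
unfold cexp. simpl. generalize (cos_period t 1) (sin_period t 1). simpl (INR 1).
replace (2 * 1 * PI) with (2 * PI) by ring. now intros -> ->.
Qed.

Lemma Cmod_cexp (z : C) : Cmod (cexp z) = exp (Re z).
Proof.
destruct z as [s t]. rewrite cexp_polar, Cmod_mult, Cmod_expi, Cmod_R, Rmult_1_r.
apply Rabs_pos_eq. simpl. left. apply exp_pos.
Qed.

Lemma polar_form (z : C) : z <> 0%C -> exists t, z = (RtoC (Cmod z) * expi t)%C.
Proof.
intros Hz. assert (Hm : 0 < Cmod z) by now apply Cmod_gt_0.
set (x := Re z / Cmod z). set (y := Im z / Cmod z).
assert (E : x * x + y * y = 1).
{ generalize (Cmod2_alt z). intros E. unfold x, y.
  replace (Re z / Cmod z * (Re z / Cmod z) + Im z / Cmod z * (Im z / Cmod z))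
    with ((Re z ^ 2 + Im z ^ 2) / Cmod z ^ 2) by (field; lra).
  rewrite <- E. field. lra. }
assert (Hx : -1 <= x <= 1) by nra.
assert (Hs : exists t, cos t = x /\ sin t = y).
{ destruct (Rle_or_lt 0 y) as [Hy|Hy].
  - exists (acos x). split; [now apply cos_acos|]. rewrite sin_acos by exact Hx.
    unfold Rsqr. replace (1 - x * x) with (y * y) by lra. now apply sqrt_square.
  - exists (- acos x). rewrite cos_neg, sin_neg. split; [now apply cos_acos|].
    rewrite sin_acos by exact Hx. unfold Rsqr.
    replace (1 - x * x) with ((- y) * (- y)) by lra. rewrite sqrt_square; lra. }
destruct Hs as [t [Hc Hsn]]. exists t. unfold expi. rewrite Hc, Hsn.
unfold x, y. apply C_eq; simpl; field; lra.
Qed.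

Lemma polar_cexp (c z : C) : z <> c ->
  exists t, z = (c + cexp (ln (Cmod (z - c)), t))%C.
Proof.
intros Hz. assert (Hn : (z - c)%C <> RtoC 0).
{ intros E. apply Hz. replace z with ((z - c) + c)%C by ring. rewrite E. ring. }
destruct (polar_form _ Hn) as [t Ht]. exists t.
rewrite cexp_polar, exp_ln by now apply Cmod_gt_0. rewrite <- Ht. ring.
Qed.

Lemma cderiv_cexp_0 : cderiv cexp 0 1.
Proof.
(* The error is a sum of pieces totalling at most seven times [e * m], where [m] is the modulus of
   the increment. *)
intros eps Heps. set (e := eps / 12).
assert (He : 0 < e) by (unfold e; lra).
destruct (derivable_pt_lim_small exp 0 1 derivable_pt_lim_exp_0 e He) as [d1 [Hd1 H1]].
destruct (derivable_pt_lim_small cos 0 (- sin 0) (derivable_pt_lim_cos 0) e He)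
  as [d2 [Hd2 H2]].
destruct (derivable_pt_lim_small sin 0 (cos 0) (derivable_pt_lim_sin 0) e He)
  as [d3 [Hd3 H3]].
rewrite exp_0 in H1. rewrite cos_0, sin_0 in H2. rewrite sin_0, cos_0 in H3.
exists (Rmin (Rmin d1 d2) (Rmin d3 (Rmin (1 / 2) (Rmin e (1 / (1 + e)))))). split.
{ repeat apply Rmin_glb_lt; try assumption; try lra. apply Rdiv_lt_0_compat; lra. }
intros y By. replace (y - 0)%C with y in * by ring.
rewrite cexp_0. destruct y as [a b].
assert (A1 := Rle_lt_trans _ _ _ (re_le_Cmod _) By).
assert (A2 := Rle_lt_trans _ _ _ (im_le_Cmod _) By).
assert (Ha := re_le_Cmod (a, b)). assert (Hb := im_le_Cmod (a, b)).
simpl in A1, A2, Ha, Hb.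
set (m := Cmod (a, b)) in *.
apply Rmin_Rgt in A1. destruct A1 as [A1 A1'].
apply Rmin_Rgt in A1. apply Rmin_Rgt in A1'. destruct A1' as [A3 A1'].
apply Rmin_Rgt in A1'. destruct A1' as [A4 A1'].
apply Rmin_Rgt in A1'. destruct A1' as [A5 A6].
apply Rmin_Rgt in A2. destruct A2 as [B1 B1'].
apply Rmin_Rgt in B1. apply Rmin_Rgt in B1'. destruct B1' as [B3 B1'].
specialize (H1 a (proj1 A1)). specialize (H2 b (proj2 B1)). specialize (H3 b B3).
rewrite Rplus_0_l in H1, H2, H3.
assert (M0 : 0 <= m) by apply Cmod_ge_0.
assert (K1 : e * Rabs a <= e * m) by nra.
assert (K2 : e * Rabs b <= e * m) by nra.
assert (Xa : Rabs (exp a - 1) <= 2 * e /\ 0 <= exp a <= 2).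
{ assert (Q1 : Rabs (exp a - 1) <= (1 + e) * Rabs a).
  { replace (exp a - 1) with ((exp a - 1 - 1 * a) + a) by ring.
    eapply Rle_trans; [apply Rabs_triang|]. lra. }
  assert (Q2 : (1 + e) * Rabs a <= 1).
  { apply Rmult_gt_compat_l with (r := 1 + e) in A6; [|lra].
    replace ((1 + e) * (1 / (1 + e))) with 1 in A6 by (field; lra). lra. }
  assert (Q3 : Rabs a <= 1) by lra.
  assert (Q4 : Rabs (exp a - 1) <= 1) by lra.
  generalize (Rle_abs (exp a - 1)) (exp_pos a). intros.
  split; [|lra]. nra. }
destruct Xa as [X1 X2].
set (u := exp a) in *. set (v := cos b) in *. set (w := sin b) in *.
eapply Rle_trans; [apply Cmod_le_abs|]. unfold cexp. simpl.
fold u v w.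
replace (u * v + - (1) + - (a * 1 - b * 0)) with
  (u * (v - 1 - - 0 * b) + (u - 1 - 1 * a)) by ring.
replace (u * w + - 0 + - (a * 0 + b * 1)) with
  (u * (w - 1 * b) + (u - 1) * b) by ring.
assert (T1 := Rabs_triang (u * (v - 1 - - 0 * b)) (u - 1 - 1 * a)).
assert (T2 := Rabs_triang (u * (w - 1 * b)) ((u - 1) * b)).
rewrite Rabs_mult, (Rabs_pos_eq u) in T1 by lra.
rewrite !Rabs_mult, (Rabs_pos_eq u) in T2 by lra.
replace (w - 0 - 1 * b) with (w - 1 * b) in H3 by ring.
assert (Z1 := Rabs_pos (v - 1 - - 0 * b)). assert (Z2 := Rabs_pos (w - 1 * b)).
assert (Z3 := Rabs_pos b). assert (Z4 := Rabs_pos (u - 1)).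
assert (Y1 : u * Rabs (v - 1 - - 0 * b) <= 2 * (e * m)) by nra.
assert (Y2 : u * Rabs (w - 1 * b) <= 2 * (e * m)) by nra.
assert (Y3 : Rabs (u - 1) * Rabs b <= 2 * e * m) by nra.
unfold e in *. lra.
Qed.

Lemma cdiff_cexp (z : C) : cdiff cexp z.
Proof.
apply cdiff_ext with (fun y => (cexp z * cexp (1 * y + - z))%C) 1; [lra| |].
- intros y _. rewrite <- cexp_plus. f_equal. ring.
- apply cdiff_scal, (cdiff_comp cexp (fun y => (1 * y + - z)%C)); [|apply cdiff_affine].
  replace (1 * z + - z)%C with (RtoC 0) by ring. exists (RtoC 1). exact cderiv_cexp_0.
Qed.

Lemma cdiff_half_CR (H : C -> C) (x y : R) : cdiff H (x, y) ->
  half_CR (fun s t => Re (H (s, t))) (fun s t => Im (H (s, t))) x y.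
Proof.
intros [[l1 l2] Hl]. exists l1, (- l2), l2. intros eps Heps.
destruct (Hl eps Heps) as [d [Hd Hy]]. exists (d / 2). split; [lra|].
intros x' y' Bx By.
assert (B := Cmod_le_abs ((x', y') - (x, y))%C). simpl in B.
fold (x' - x) (y' - y) in B.
specialize (Hy (x', y') ltac:(lra)).
assert (K : eps * Cmod ((x', y') - (x, y))%C <= eps * (Rabs (x' - x) + Rabs (y' - y)))
  by nra.
assert (R1 := re_le_Cmod (H (x', y') - H (x, y) - ((x', y') - (x, y)) * (l1, l2))%C).
assert (R2 := im_le_Cmod (H (x', y') - H (x, y) - ((x', y') - (x, y)) * (l1, l2))%C).
simpl in R1, R2. fold Re Im in R1, R2.
split; apply Rle_trans with (2 := K); eapply Rle_trans; try exact Hy.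
- eapply Rle_trans; [|exact R1]. apply Req_le. f_equal. unfold Re, Im. ring.
- eapply Rle_trans; [|exact R2]. apply Req_le. f_equal. unfold Re, Im. ring.
Qed.

(** The radius is [exp s]. The starting angle [b] is left free so that a given point of the circle
    can be placed in the interior of the interval of integration. *)
Definition circle_int (h : C -> C) (c : C) (b s : R) : R :=
  RInt (fun t => Re (h (c + cexp (s, t))%C)) b (b + 2 * PI).

Lemma circle_int_const (h : C -> C) (c : C) (b s1 s2 : R) : s1 < s2 ->
  (forall z, exp s1 <= Cmod (z - c) <= exp s2 -> cdiff h z) ->
  circle_int h c b s1 = circle_int h c b s2.
Proof.
intros Hs Hh.
set (H := fun z => h (c + cexp z)%C).
assert (HH : forall x y, s1 <= x <= s2 -> cdiff H (x, y)).
{ intros x y Hx. apply (cdiff_comp h (fun z => (c + cexp z)%C)).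
  - apply Hh. replace (c + cexp (x, y) - c)%C with (cexp (x, y)) by ring.
    rewrite Cmod_cexp. simpl.
    split; [destruct (proj1 Hx) as [h1| ->]|destruct (proj2 Hx) as [h1| ->]];
      try lra; left; now apply exp_increasing.
  - apply cdiff_plus; [apply cdiff_const|apply cdiff_cexp]. }
set (P := fun s t => Re (H (s, t))). set (Q := fun s t => Im (H (s, t))).
assert (Hcr : forall x y, s1 <= x <= s2 -> b <= y <= b + 2 * PI -> half_CR P Q x y).
{ intros x y Hx _. now apply cdiff_half_CR, HH. }
assert (G := goursat P Q s1 s2 b (b + 2 * PI) Hcr Hs ltac:(generalize PI_RGT_0; lra)).
unfold bdry_int in G.
rewrite (RInt_ext (fun x => Q x b - Q x (b + 2 * PI)) (fun _ => 0)) in G.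
2:{ intros x _. unfold Q, H. rewrite cexp_period. apply Rminus_diag_eq; reflexivity. }
rewrite RInt_const in G. unfold scal in G. simpl in G. unfold mult in G. simpl in G.
assert (Ex : forall s, s1 <= s <= s2 -> ex_RInt (fun y => P s y) b (b + 2 * PI)).
{ intros s h1. apply (@ex_RInt_continuous R_CompleteNormedModule). intros z _.
  apply (half_CR_cont P Q s z). now apply cdiff_half_CR, HH. }
assert (G2 := RInt_minus _ _ _ _ (Ex s2 ltac:(lra)) (Ex s1 ltac:(lra))).
unfold minus, plus, opp in G2. simpl in G2. unfold Rminus in G. rewrite G2 in G.
unfold circle_int. unfold P, H in G. lra.
Qed.

(** * Mean values on circles *)


Lemma circle_continuous (h : C -> C) (c : C) (s t : R) :
  cdiff h (c + cexp (s, t))%C -> continuous (fun t => Re (h (c + cexp (s, t))%C)) t.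
Proof.
intros Hh. set (H := fun z => h (c + cexp z)%C).
apply (half_CR_cont (fun s t => Re (H (s, t))) (fun s t => Im (H (s, t))) s t).
apply cdiff_half_CR. apply (cdiff_comp h (fun z => (c + cexp z)%C)); [exact Hh|].
apply cdiff_plus; [apply cdiff_const|apply cdiff_cexp].
Qed.

Lemma circle_ex_RInt (h : C -> C) (c : C) (a b s : R) :
  (forall z, Cmod (z - c) = exp s -> cdiff h z) ->
  ex_RInt (fun t => Re (h (c + cexp (s, t))%C)) a b.
Proof.
intros Hh. apply (@ex_RInt_continuous R_CompleteNormedModule). intros t _.
apply circle_continuous, Hh. replace (c + cexp (s, t) - c)%C with (cexp (s, t)) by ring.
apply Cmod_cexp.
Qed.

Lemma circle_int_approx (h : C -> C) (c : C) (b s k eps : R) :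
  (forall z, Cmod (z - c) = exp s -> cdiff h z) ->
  (forall z, Cmod (z - c) = exp s -> Rabs (Re (h z) - k) <= eps) ->
  Rabs (circle_int h c b s - 2 * PI * k) <= 2 * PI * eps.
Proof.
intros Hh Hk. assert (Ex := circle_ex_RInt h c b (b + 2 * PI) s Hh).
replace (circle_int h c b s - 2 * PI * k) with
  (RInt (fun t => Re (h (c + cexp (s, t))%C) + - k) b (b + 2 * PI)).
2:{ rewrite RInt_add_const by exact Ex. unfold circle_int. match goal with |- @eq _ ?u ?v => change (@eq R u v) end; ring. }
replace (2 * PI * eps) with ((b + 2 * PI - b) * eps) by ring.
apply abs_RInt_le_const; [generalize PI_RGT_0; lra|now apply ex_RInt_add_const|].
intros t _. apply Hk. replace (c + cexp (s, t) - c)%C with (cexp (s, t)) by ring.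
apply Cmod_cexp.
Qed.

Lemma Rabs_le_all_eps (x : R) : (forall eps, 0 < eps -> Rabs x <= 2 * PI * eps) -> x = 0.
Proof.
intros H. apply NNPP. intros Hx. apply Rabs_pos_lt in Hx.
assert (Hp := PI_RGT_0).
specialize (H (Rabs x / (4 * PI)) ltac:(apply Rdiv_lt_0_compat; lra)).
replace (2 * PI * (Rabs x / (4 * PI))) with (Rabs x / 2) in H by (field; lra). lra.
Qed.

(** The integral does not depend on the radius, and on a small circle [h] is close to [h c]. For
    [mean_zero] the circle grows instead of shrinking. *)
Lemma mean_value (h : C -> C) (c : C) (b rho : R) : 0 < rho ->
  (forall z, Cmod (z - c) <= rho -> cdiff h z) ->
  circle_int h c b (ln rho) = 2 * PI * Re (h c).
Proof.
intros Hr Hh. apply Rminus_diag_uniq, Rabs_le_all_eps. intros eps Heps.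
destruct (cdiff_cont h c) with (eps := eps) as [d [Hd Hc]]; [|exact Heps|].
{ apply Hh. replace (c - c)%C with (RtoC 0) by ring. rewrite Cmod_0. lra. }
set (s := ln (Rmin rho d / 2)).
assert (Hm : 0 < Rmin rho d) by now apply Rmin_glb_lt.
assert (Es : exp s = Rmin rho d / 2) by (apply exp_ln; lra).
assert (M1 := Rmin_l rho d). assert (M2 := Rmin_r rho d).
rewrite <- (circle_int_const h c b s).
- apply circle_int_approx.
  + intros z Hz. apply Hh. lra.
  + intros z Hz. specialize (Hc z ltac:(lra)).
    change (Re (h z) - Re (h c)) with (Re (h z - h c)%C).
    eapply Rle_trans; [apply re_le_Cmod|lra].
- apply ln_increasing; lra.
- intros z Hz. rewrite exp_ln in Hz by exact Hr. apply Hh. lra.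
Qed.

Definition vanishes_at_infinity (h : C -> C) : Prop :=
  forall eps, 0 < eps -> exists M, forall z, M < Cmod z -> Cmod (h z) < eps.

Lemma mean_zero (h : C -> C) (b rho : R) : 0 < rho ->
  (forall z, rho <= Cmod z -> cdiff h z) -> vanishes_at_infinity h ->
  circle_int h 0 b (ln rho) = 0.
Proof.
intros Hr Hh Hv. apply Rabs_le_all_eps. intros eps Heps.
destruct (Hv eps Heps) as [M HM].
set (s := ln (Rmax rho M + 1)).
assert (M1 := Rmax_l rho M). assert (M2 := Rmax_r rho M).
assert (Es : exp s = Rmax rho M + 1) by (apply exp_ln; lra).
rewrite (circle_int_const h 0 b (ln rho) s).
- replace (circle_int h 0 b s) with (circle_int h 0 b s - 2 * PI * 0) by ring.
  apply circle_int_approx.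
  + intros z Hz. apply Hh. replace (z - 0)%C with z in Hz by ring. lra.
  + intros z Hz. replace (z - 0)%C with z in Hz by ring.
    specialize (HM z ltac:(lra)).
    assert (R1 := re_le_Cmod (h z)). rewrite Rminus_0_r. lra.
- apply ln_increasing; lra.
- intros z Hz. replace (z - 0)%C with z in Hz by ring.
  rewrite exp_ln in Hz by exact Hr. apply Hh. lra.
Qed.

Lemma RInt_nonneg_zero (f : R -> R) (a b x : R) : a < x < b ->
  (forall t, continuous f t) -> (forall t, 0 <= f t) -> RInt f a b = 0 -> f x = 0.
Proof.
intros Hx Hc Hf HI. apply NNPP. intros Hne.
assert (Hp : 0 < f x) by (specialize (Hf x); lra).
destruct (proj1 (filterlim_locally f (f x)) (Hc x) (mkposreal (f x / 2) ltac:(lra)))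
  as [d Hd].
set (e := Rmin (d / 2) (Rmin (x - a) (b - x))).
assert (D := cond_pos d).
assert (He : 0 < e) by (unfold e; repeat apply Rmin_glb_lt; lra).
assert (E1 : e <= d / 2) by apply Rmin_l.
assert (E2 : e <= x - a)
  by (eapply Rle_trans; [apply Rmin_r|apply Rmin_l]).
assert (E3 : e <= b - x)
  by (eapply Rle_trans; [apply Rmin_r|apply Rmin_r]).
assert (Ex : forall u v, ex_RInt f u v).
{ intros u v. apply (@ex_RInt_continuous R_CompleteNormedModule). intros; apply Hc. }
assert (C1 := RInt_Chasles f a (x - e) b (Ex _ _) (Ex _ _)).
assert (C2 := RInt_Chasles f (x - e) (x + e) b (Ex _ _) (Ex _ _)).
unfold plus in C1, C2. simpl in C1, C2.
assert (I1 := RInt_ge_0 f a (x - e) ltac:(lra) (Ex _ _) (fun t _ => Hf t)).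
assert (I2 := RInt_ge_0 f (x + e) b ltac:(lra) (Ex _ _) (fun t _ => Hf t)).
assert (I3 : RInt (fun _ => f x / 2) (x - e) (x + e) <= RInt f (x - e) (x + e)).
{ apply RInt_le; [lra|apply ex_RInt_const|apply Ex|]. intros t Ht.
  assert (B : Rabs (f t - f x) < f x / 2).
  { apply (Hd t). change (Rabs (t - x) < d). apply Rabs_def1; lra. }
  apply Rabs_def2 in B. lra. }
rewrite RInt_const in I3. unfold scal in I3. simpl in I3. unfold mult in I3. simpl in I3.
nra.
Qed.

Lemma circle_nonneg_zero (h : C -> C) (c z : C) : z <> c ->
  (forall y, Cmod (y - c) = Cmod (z - c) -> cdiff h y /\ 0 <= Re (h y)) ->
  (forall b, circle_int h c b (ln (Cmod (z - c))) = 0) -> Re (h z) = 0.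
Proof.
intros Hz Hh HI. destruct (polar_cexp c z Hz) as [t Ht].
assert (Hn : 0 < Cmod (z - c)).
{ apply Cmod_gt_0. intros E. apply Hz. replace z with ((z - c) + c)%C by ring.
  rewrite E. ring. }
set (s := ln (Cmod (z - c))) in *.
assert (Hy : forall t, Cmod (c + cexp (s, t) - c)%C = Cmod (z - c)).
{ intros u. replace (c + cexp (s, u) - c)%C with (cexp (s, u)) by ring.
  rewrite Cmod_cexp. simpl. unfold s. now apply exp_ln. }
rewrite Ht.
apply (RInt_nonneg_zero (fun t => Re (h (c + cexp (s, t))%C)) (t - PI) (t - PI + 2 * PI)).
- generalize PI_RGT_0; lra.
- intros u. apply circle_continuous, Hh, Hy.
- intros u. apply Hh, Hy.
- apply HI.
Qed.

Definition open_at (D : C -> Prop) (z : C) : Prop :=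
  exists d, 0 < d /\ forall y, Cmod (y - z) < d -> D y.

Lemma Cmod2_expand (z y : C) :
  Cmod y ^ 2 = Cmod z ^ 2 + 2 * Re (Cconj z * (y - z))%C + Cmod (y - z) ^ 2.
Proof. rewrite !Cmod2_alt. destruct z, y. simpl. ring. Qed.

(* Adding [e |z|^2] to [Re h] makes the mean value inequality strict, so that the
   perturbed function has no interior maximum. *)
Lemma no_perturbed_max (h : C -> C) (z : C) (e r : R) : 0 < e -> 0 < r ->
  (forall y, Cmod (y - z) < r ->
     cdiff h y /\ Re (h y) + e * Cmod y ^ 2 <= Re (h z) + e * Cmod z ^ 2) -> False.
Proof.
intros He Hr H.
(* By [Cmod2_expand] the first-order part of [e * Cmod y ^ 2] at [z] is the real part of a
   holomorphic function. It is absorbed into [k], so that only [e * Cmod (y - z) ^ 2] remains as a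
   strict deficit on the circle. *)
set (k := fun y => (h y + RtoC (2 * e) * Cconj z * (y - z))%C).
set (rho := r / 2). assert (Hrho : 0 < rho) by (unfold rho; lra).
assert (Hk : forall y, Cmod (y - z) < r -> cdiff k y).
{ intros y Hy. apply cdiff_plus; [now apply H|].
  apply cdiff_scal, cdiff_minus; [apply cdiff_id|apply cdiff_const]. }
assert (Hkz : forall y, Cmod (y - z) < r ->
  Re (k y) <= Re (h z) - e * Cmod (y - z) ^ 2).
{ intros y Hy. destruct (H y Hy) as [_ B]. rewrite (Cmod2_expand z y) in B.
  assert (E : Re (k y) = Re (h y) + e * (2 * Re (Cconj z * (y - z))%C)).
  { unfold k. destruct (h y), z, y. simpl. ring. }
  rewrite E. nra. }
assert (Ekz : Re (k z) = Re (h z)).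
{ unfold k. replace (z - z)%C with (RtoC 0) by ring.
  rewrite Cmult_0_r, Cplus_0_r. reflexivity. }
assert (M : circle_int k z 0 (ln rho) = 2 * PI * Re (h z)).
{ rewrite <- Ekz. apply mean_value; [exact Hrho|].
  intros y Hy. apply Hk. unfold rho in Hy. lra. }
assert (Er : exp (ln rho) = rho) by now apply exp_ln.
assert (I : circle_int k z 0 (ln rho) <=
  RInt (fun _ => Re (h z) - e * rho ^ 2) 0 (0 + 2 * PI)).
{ apply RInt_le; [generalize PI_RGT_0; lra| |apply ex_RInt_const|].
  - apply circle_ex_RInt. intros y Hy. apply Hk. rewrite Hy, Er. unfold rho; lra.
  - intros t _. assert (E : Cmod (z + cexp (ln rho, t) - z)%C = rho).
    { replace (z + cexp (ln rho, t) - z)%C with (cexp (ln rho, t)) by ring.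
      now rewrite Cmod_cexp. }
    specialize (Hkz (z + cexp (ln rho, t))%C). rewrite E in Hkz.
    apply Hkz. unfold rho; lra. }
rewrite RInt_const in I. unfold scal in I. simpl in I. unfold mult in I. simpl in I.
rewrite M in I. generalize PI_RGT_0. intros.
assert (0 < e * (rho * (rho * 1))) by (apply Rmult_lt_0_compat; nra). nra.
Qed.

(** * Maximum principle *)


Definition in_rect (a b c d : R) (z : C) : Prop := a <= Re z <= b /\ c <= Im z <= d.

Lemma in_rect_split (a b c d : R) (z : C) : in_rect a b c d z ->
  let m := (a + b) / 2 in let n := (c + d) / 2 in
  in_rect a m c n z \/ in_rect m b c n z \/ in_rect a m n d z \/ in_rect m b n d z.
Proof.
intros [H1 H2] m n. unfold in_rect.
destruct (Rle_or_lt (Re z) m), (Rle_or_lt (Im z) n);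
  [left|right; right; left|right; left|right; right; right]; lra.
Qed.

Lemma ball_in_rect (R0 : R) (z : C) : Cmod z <= R0 -> in_rect (- R0) R0 (- R0) R0 z.
Proof.
intros H. generalize (re_le_Cmod z) (im_le_Cmod z). intros H1 H2.
split; apply Rabs_le_between; lra.
Qed.

(** Compactness of a square in a form suited to contradictions: an undesired property that survives
    in one of any four covering pieces must persist on arbitrarily small sets about some point. *)
Lemma rect_localize (Pr : (C -> Prop) -> Prop) (R0 : R) :
  0 <= R0 ->
  (forall A B1 B2 B3 B4 : C -> Prop,
     (forall z, A z -> B1 z \/ B2 z \/ B3 z \/ B4 z) -> Pr A ->
     Pr B1 \/ Pr B2 \/ Pr B3 \/ Pr B4) ->
  Pr (in_rect (- R0) R0 (- R0) R0) ->
  exists p, in_rect (- R0) R0 (- R0) R0 p /\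
    forall eps, 0 < eps -> exists A : C -> Prop, Pr A /\
      forall z, A z -> Cmod (z - p) < eps /\ in_rect (- R0) R0 (- R0) R0 z.
Proof.
intros HR Hsub H0.
destruct (bisection (fun a b c d => Pr (in_rect a b c d)) (- R0) R0 (- R0) R0)
  as [x [y [Hx [Hy Hloc]]]]; [lra|lra| |exact H0|].
- intros a b c d _ _ HP m n. apply (Hsub (in_rect a b c d)); [|exact HP].
  intros z Hz. now apply in_rect_split.
- exists (x, y). split; [now split|]. intros eps Heps.
  destruct (Hloc (eps / 2) ltac:(lra))
    as [a [b [c [d [k [h1 [h2 [h3 [h4 [_ [_ [h5 [h6 h7]]]]]]]]]]]]].
  exists (in_rect a b c d). split; [exact h7|]. intros z [Hz1 Hz2]. split.
  + eapply Rle_lt_trans; [apply Cmod_le_abs|]. destruct z as [u v]. simpl in *.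
    assert (Rabs (u + - x) <= b - a) by (apply Rabs_le; lra).
    assert (Rabs (v + - y) <= d - c) by (apply Rabs_le; lra). lra.
  + split; lra.
Qed.

(** The local bound is asked at every point of the plane, which stands in for closedness of [K].
    Were [h] unbounded on [K], it would be so on arbitrarily small pieces about one point. *)
Lemma bounded_by_local (K : C -> Prop) (h : C -> C) (R0 : R) :
  (forall z, K z -> Cmod z <= R0) ->
  (forall p, exists d B, 0 < d /\ forall z, K z -> Cmod (z - p) < d -> Cmod (h z) <= B) ->
  exists B, forall z, K z -> Cmod (h z) <= B.
Proof.
intros HK Hloc. apply NNPP. intros Hno.
destruct (rect_localize
  (fun A => forall B, exists z, K z /\ A z /\ B < Cmod (h z)) (Rmax 0 R0))
  as [p [_ Hp]].
- apply Rmax_l.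
- intros A B1 B2 B3 B4 Hsub HA. apply NNPP. intros Hn.
  apply not_or_and in Hn. destruct Hn as [N1 Hn].
  apply not_or_and in Hn. destruct Hn as [N2 Hn].
  apply not_or_and in Hn. destruct Hn as [N3 N4].
  apply not_all_ex_not in N1. apply not_all_ex_not in N2.
  apply not_all_ex_not in N3. apply not_all_ex_not in N4.
  destruct N1 as [b1 N1], N2 as [b2 N2], N3 as [b3 N3], N4 as [b4 N4].
  destruct (HA (Rmax (Rmax b1 b2) (Rmax b3 b4))) as [z [Kz [Az Hz]]].
  apply Rmax_Rlt in Hz. destruct Hz as [Hz1 Hz2].
  apply Rmax_Rlt in Hz1. apply Rmax_Rlt in Hz2.
  destruct (Hsub z Az) as [h1|[h1|[h1|h1]]];
    [apply N1|apply N2|apply N3|apply N4]; exists z; tauto.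
- intros B. apply NNPP. intros Hn. apply Hno. exists B. intros z Hz.
  apply Rnot_lt_le. intros Hlt. apply Hn. exists z. split; [exact Hz|].
  split; [|exact Hlt]. apply ball_in_rect.
  eapply Rle_trans; [now apply HK|apply Rmax_r].
- destruct (Hloc p) as [d [B [Hd HB]]]. destruct (Hp d Hd) as [A [HA Hn]].
  destruct (HA B) as [z [Kz [Az Hz]]]. specialize (HB z Kz (proj1 (Hn z Az))). lra.
Qed.

(** Boundary values enter only as upper limits at points outside [D], so that [D] may be unbounded
    and its boundary arbitrary. A value above [M] would give the perturbed function [phi] an
    interior maximum. *)
Lemma maximum_principle (D : C -> Prop) (h : C -> C) (M : R) :
  (forall z, D z -> open_at D z) -> (forall z, D z -> cdiff h z) ->
  (forall p, ~ D p -> forall eps, 0 < eps -> exists d, 0 < d /\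
     forall z, D z -> Cmod (z - p) < d -> Re (h z) <= M + eps) ->
  (forall eps, 0 < eps -> exists R0, forall z, D z -> R0 < Cmod z -> Re (h z) <= M + eps) ->
  forall z, D z -> Re (h z) <= M.
Proof.
intros Hop Hh Hb Hinf z1 Dz1. apply Rnot_lt_le. intros Hlt.
set (e0 := (Re (h z1) - M) / 2). assert (He0 : 0 < e0) by (unfold e0; lra).
destruct (Hinf e0 He0) as [R1 HR1].
set (R0 := Rmax (Rmax 0 R1) (Cmod z1) + 1).
assert (m1 := Rmax_l (Rmax 0 R1) (Cmod z1)). assert (m2 := Rmax_r (Rmax 0 R1) (Cmod z1)).
assert (m3 := Rmax_l 0 R1). assert (m4 := Rmax_r 0 R1).
assert (HR0 : 1 <= R0) by (unfold R0; lra).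
set (Sq := in_rect (- R0) R0 (- R0) R0).
assert (HSq : forall z, Sq z -> Cmod z ^ 2 <= 2 * R0 ^ 2).
{ intros z [[? ?] [? ?]]. rewrite Cmod2_alt. nra. }
(* Keeps the perturbation below [e0 / 2] on the square, where [Cmod z ^ 2 <= 2 * R0 ^ 2]: near the
   boundary and far away [phi <= M + 3 / 2 * e0], while [phi z1 >= M + 2 * e0]. *)
set (e := e0 / (4 * R0 ^ 2)).
assert (He : 0 < e) by (apply Rdiv_lt_0_compat; nra).
assert (Hee : forall z, Sq z -> 0 <= e * Cmod z ^ 2 <= e0 / 2).
{ intros z Hz. specialize (HSq z Hz). split.
  - apply Rmult_le_pos; [lra|apply pow2_ge_0].
  - replace (e0 / 2) with (e * (2 * R0 ^ 2)) by (unfold e; field; nra). nra. }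
set (phi := fun z => Re (h z) + e * Cmod z ^ 2).
assert (Sz1 : Sq z1) by (apply ball_in_rect; unfold R0; lra).
assert (Hz1 : M + 2 * e0 <= phi z1).
{ unfold phi. assert (Re (h z1) = M + 2 * e0) by (unfold e0; lra).
  generalize (Hee z1 Sz1). intros. lra. }
assert (Hmax : exists z0, D z0 /\ Sq z0 /\ forall z, D z -> Sq z -> phi z <= phi z0).
{ apply NNPP. intros Hno.
  assert (Hno' : forall z0, D z0 -> Sq z0 -> exists z, D z /\ Sq z /\ phi z0 < phi z).
  { intros z0 D0 S0. apply NNPP. intros Hn. apply Hno. exists z0.
    split; [exact D0|]. split; [exact S0|]. intros z Dz Sz. apply Rnot_lt_le.
    intros Hl. apply Hn. now exists z. }
  (* If no maximum is attained, the values of [phi] on some arbitrarily small sets about a point [p]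
     overtake every value of [phi]. Continuity excludes this when [p] lies in [D], and the boundary
     hypothesis when it does not. *)
  destruct (rect_localize (fun A => forall z0, D z0 -> Sq z0 ->
     exists z, D z /\ Sq z /\ A z /\ phi z0 < phi z) R0) as [p [Sp Hp]].
  - lra.
  - intros A B1 B2 B3 B4 Hsub HA. apply NNPP. intros Hn.
    apply not_or_and in Hn. destruct Hn as [N1 Hn].
    apply not_or_and in Hn. destruct Hn as [N2 Hn].
    apply not_or_and in Hn. destruct Hn as [N3 N4].
    assert (W : forall B : C -> Prop, ~ (forall z0, D z0 -> Sq z0 ->
      exists z, D z /\ Sq z /\ B z /\ phi z0 < phi z) ->
      exists z0, D z0 /\ Sq z0 /\ forall z, D z -> Sq z -> B z -> phi z <= phi z0).
    { intros B N. apply NNPP. intros Hn. apply N. intros z0 D0 S0.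
      apply NNPP. intros Hn'. apply Hn. exists z0. split; [exact D0|]. split; [exact S0|].
      intros z Dz Sz Bz. apply Rnot_lt_le. intros Hl. apply Hn'. now exists z. }
    apply W in N1. apply W in N2. apply W in N3. apply W in N4.
    destruct N1 as [u1 [? [? N1]]], N2 as [u2 [? [? N2]]],
      N3 as [u3 [? [? N3]]], N4 as [u4 [? [? N4]]].
    assert (V : exists u, D u /\ Sq u /\ phi u1 <= phi u /\ phi u2 <= phi u /\
      phi u3 <= phi u /\ phi u4 <= phi u).
    { destruct (Rle_or_lt (phi u1) (phi u2)), (Rle_or_lt (phi u3) (phi u4));
      [destruct (Rle_or_lt (phi u2) (phi u4)); [exists u4|exists u2]
      |destruct (Rle_or_lt (phi u2) (phi u3)); [exists u3|exists u2]
      |destruct (Rle_or_lt (phi u1) (phi u4)); [exists u4|exists u1]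
      |destruct (Rle_or_lt (phi u1) (phi u3)); [exists u3|exists u1]];
      refine (conj _ (conj _ (conj _ (conj _ (conj _ _))))); assumption || lra. }
    destruct V as [u [Du [Su V]]]. destruct (HA u Du Su) as [z [Dz [Sz [Az Hz]]]].
    destruct (Hsub z Az) as [k|[k|[k|k]]];
      [specialize (N1 z Dz Sz k)|specialize (N2 z Dz Sz k)
      |specialize (N3 z Dz Sz k)|specialize (N4 z Dz Sz k)]; lra.
  - intros z0 D0 S0. destruct (Hno' z0 D0 S0) as [z [Dz [Sz Hz]]]. now exists z.
  - destruct (classic (D p)) as [Dp|NDp].
    + destruct (Hno' p Dp Sp) as [q [Dq [Sq' Hq]]].
      assert (Hc : exists d, 0 < d /\ forall z, Cmod (z - p) < d -> phi z < phi q).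
      { set (g := (phi q - phi p) / 2). assert (Hg : 0 < g) by (unfold g; lra).
        destruct (cdiff_cont h p (Hh p Dp) g Hg) as [d1 [Hd1 H1]].
        set (L := 2 * Cmod p + 1). assert (HL : 0 < L)
          by (unfold L; generalize (Cmod_ge_0 p); lra).
        exists (Rmin d1 (Rmin 1 (g / (e * L)))). split.
        { repeat apply Rmin_glb_lt; try lra. apply Rdiv_lt_0_compat; nra. }
        intros z Hz. apply Rmin_Rgt in Hz. destruct Hz as [Z1 Z2].
        apply Rmin_Rgt in Z2. destruct Z2 as [Z2 Z3].
        specialize (H1 z Z1).
        assert (A1 : Re (h z) - Re (h p) < g).
        { change (Re (h z) - Re (h p)) with (Re (h z - h p)%C).
          eapply Rle_lt_trans; [apply Rle_abs|].
          eapply Rle_lt_trans; [apply re_le_Cmod|exact H1]. }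
        assert (A2 : Cmod z ^ 2 - Cmod p ^ 2 <= Cmod (z - p) * L).
        { assert (T := Cmod_triangle (z - p) p).
          replace (z - p + p)%C with z in T by ring.
          unfold L. generalize (Cmod_ge_0 z) (Cmod_ge_0 p) (Cmod_ge_0 (z - p)).
          intros. nra. }
        assert (A3 : Cmod (z - p) * (e * L) < g).
        { apply Rmult_gt_compat_r with (r := e * L) in Z3; [|nra].
          replace (g / (e * L) * (e * L)) with g in Z3 by (field; lra). lra. }
        unfold phi in *. unfold g in *. nra. }
      destruct Hc as [d [Hd Hc]]. destruct (Hp d Hd) as [A [HA Hn]].
      destruct (HA q Dq Sq') as [z [Dz [Sz [Az Hz]]]].
      specialize (Hc z (proj1 (Hn z Az))). lra.
    + destruct (Hb p NDp e0 He0) as [d [Hd Hc]]. destruct (Hp d Hd) as [A [HA Hn]].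
      destruct (HA z1 Dz1 Sz1) as [z [Dz [Sz [Az Hz]]]].
      specialize (Hc z Dz (proj1 (Hn z Az))). specialize (Hee z Sz).
      unfold phi in Hz at 2. lra. }
destruct Hmax as [z0 [D0 [S0 Hmax]]].
assert (Hz0 := Hmax z1 Dz1 Sz1). assert (E0 := Hee z0 S0).
(* The [+ 1] in [R0] pays off here: the unit disk about the maximum point stays inside the square,
   so the maximum is interior. *)
assert (B0 : Cmod z0 <= R0 - 1).
{ apply Rnot_lt_le. intros Hl. assert (R1 < Cmod z0) by (unfold R0 in Hl; lra).
  specialize (HR1 z0 D0 H). unfold phi in Hz0 at 2. lra. }
destruct (Hop z0 D0) as [r [Hr Hball]].
apply (no_perturbed_max h z0 e (Rmin r 1) He); [apply Rmin_glb_lt; lra|].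
intros y Hy. apply Rmin_Rgt in Hy. destruct Hy as [Y1 Y2].
assert (Dy := Hball y Y1). split; [now apply Hh|]. apply (Hmax y Dy).
apply ball_in_rect. assert (T := Cmod_triangle (y - z0) z0).
replace (y - z0 + z0)%C with y in T by ring. lra.
Qed.

Lemma open_at_exterior (rho : R) (z : C) : rho < Cmod z ->
  open_at (fun y => rho < Cmod y) z.
Proof.
intros Hz. exists (Cmod z - rho). split; [lra|]. intros y Hy.
assert (T := Cmod_triangle_inv z (z - y)). rewrite (Cmod_minus_sym z y) in T.
replace (z - (z - y))%C with y in T by ring. lra.
Qed.

(* The maximum principle for [z ^ k h] gives [|h z| <= C (rho / |z|) ^ k] for all [k]. *)
Lemma exterior_identity (h : C -> C) (rho0 M : R) :
  (forall z, rho0 < Cmod z -> cdiff h z) -> (forall z, M < Cmod z -> h z = RtoC 0) ->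
  forall z, rho0 < Cmod z -> 0 < Cmod z -> h z = RtoC 0.
Proof.
intros Hh H0 z Hz Hz0.
(* A radius strictly between [rho0] and [Cmod z]: on that circle [h] is differentiable, hence
   bounded. *)
set (rho := (Rmax rho0 0 + Cmod z) / 2).
assert (m1 := Rmax_l rho0 0). assert (m2 := Rmax_r rho0 0).
assert (m3 : Rmax rho0 0 < Cmod z) by now apply Rmax_lub_lt.
assert (Hrho : 0 < rho) by (unfold rho; lra).
assert (Hrho0 : rho0 < rho) by (unfold rho; lra).
assert (Hrz : rho < Cmod z) by (unfold rho; lra).
destruct (bounded_by_local (fun y => Cmod y = rho) h rho) as [B HB].
- intros y Hy. lra.
- intros p. destruct (Rlt_or_le rho0 (Cmod p)) as [Hp|Hp].
  + destruct (cdiff_cont h p (Hh p Hp) 1 Rlt_0_1) as [d [Hd Hc]].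
    exists d, (1 + Cmod (h p)). split; [exact Hd|]. intros y _ Hy.
    assert (T := Cmod_triangle (h y - h p) (h p)).
    replace (h y - h p + h p)%C with (h y) in T by ring. specialize (Hc y Hy). lra.
  + exists (rho - rho0), 0. split; [lra|]. intros y Hy Hyp.
    assert (T := Cmod_triangle_inv y p). lra.
- assert (Hk : forall k, Cmod z ^ k * Cmod (h z) <= rho ^ k * B).
  { intros k. destruct (Cmod_as_Re (z ^ k * h z)%C) as [lam [Hlam E]].
    rewrite Cmod_mult, Cmod_pow in E. rewrite <- E.
    apply (maximum_principle (fun y => rho < Cmod y) (fun y => (lam * (y ^ k * h y))%C)).
    - intros y Hy. now apply open_at_exterior.
    - intros y Hy. apply cdiff_scal, cdiff_mult; [apply cdiff_pow|apply Hh; lra].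
    - intros p Hp eps Heps. apply Rnot_lt_le in Hp.
      destruct (Rle_lt_or_eq_dec _ _ Hp) as [Hlt|Heq].
      + exists (rho - Cmod p). split; [lra|]. intros y Hy Hyp.
        assert (T := Cmod_triangle_inv y p). lra.
      + destruct (cdiff_cont (fun y => (lam * (y ^ k * h y))%C) p) with (eps := eps)
          as [d [Hd Hc]]; [|exact Heps|].
        { apply cdiff_scal, cdiff_mult; [apply cdiff_pow|apply Hh; lra]. }
        exists d. split; [exact Hd|]. intros y _ Hy. specialize (Hc y Hy).
        eapply Rle_trans; [apply Rle_abs|]. eapply Rle_trans; [apply re_le_Cmod|].
        assert (T := Cmod_triangle (lam * (y ^ k * h y) - lam * (p ^ k * h p))
          (lam * (p ^ k * h p))).
        replace (lam * (y ^ k * h y) - lam * (p ^ k * h p) + lam * (p ^ k * h p))%C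
          with (lam * (y ^ k * h y))%C in T by ring.
        rewrite (Cmod_mult lam (p ^ k * h p)), (Cmod_mult (p ^ k)), Cmod_pow, Hlam, Heq in T.
        assert (0 < rho ^ k) by now apply pow_lt. specialize (HB p Heq). nra.
    - intros eps Heps. exists M. intros y _ Hy. rewrite (H0 y Hy).
      rewrite !Cmult_0_r. simpl.
      assert (0 < rho ^ k) by now apply pow_lt.
      assert (0 <= B).
      { eapply Rle_trans; [apply Cmod_ge_0|apply (HB (RtoC rho))].
        rewrite Cmod_R. apply Rabs_pos_eq. lra. }
      nra.
    - exact Hrz. }
  apply Cmod_eq_0. apply NNPP. intros Hne.
  assert (Hp : 0 < Cmod (h z)) by (generalize (Cmod_ge_0 (h z)); lra).
  set (q := rho / Cmod z).
  assert (Hq : 0 < q < 1).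
  { unfold q. split; [now apply Rdiv_lt_0_compat|]. apply Rlt_div_l; lra. }
  assert (HB0 : 0 < B). { specialize (Hk O). simpl in Hk. lra. }
  destruct (pow_lt_1_zero q ltac:(rewrite Rabs_pos_eq; lra) (Cmod (h z) / (2 * B))
    ltac:(apply Rdiv_lt_0_compat; lra)) as [N HN].
  specialize (HN N (le_n N)). specialize (Hk N).
  rewrite Rabs_pos_eq in HN by (apply pow_le; lra).
  unfold q, Rdiv in HN. rewrite Rpow_mult_distr, pow_inv in HN.
  assert (Hzn : 0 < Cmod z ^ N) by now apply pow_lt.
  apply Rmult_lt_compat_r with (r := Cmod z ^ N * B) in HN; [|nra].
  replace (rho ^ N * / Cmod z ^ N * (Cmod z ^ N * B)) with (rho ^ N * B) in HN
    by (field; lra).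
  replace (Cmod (h z) * / (2 * B) * (Cmod z ^ N * B)) with (Cmod z ^ N * Cmod (h z) / 2)
    in HN by (field; lra).
  nra.
Qed.

(** * The conformal map of a shape *)


(** Cover the set by the complements of the closed disks of radius [/ INR (S n)] about [x]; a finite
    subcover leaves a disk about [x] free. *)
Lemma compact_closed (S0 : C -> Prop) (x : C) :
  compact_set S0 -> ~ S0 x -> open_at (fun y => ~ S0 y) x.
Proof.
intros Hc Hx.
destruct (Hc nat (fun n y => / INR (S n) < Cmod (y - x))) as [l Hl].
- intros n y Hy. 
  apply (locally_le_locally_norm (V := C_NormedModule)).
  exists (mkposreal (Cmod (y - x) - / INR (S n)) ltac:(lra)).
  intros z Hz. change (Cmod (z - y) < Cmod (y - x) - / INR (S n)) in Hz.
  generalize (Cmod_dist_triangle y z x) (Cmod_minus_sym y z). lra.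
- intros z Hz.
  assert (Hp : 0 < Cmod (z - x)).
  { apply Cmod_gt_0. intros E. apply Hx. replace x with (z - (z - x))%C by ring.
    rewrite E. now replace (z - 0)%C with z by ring. }
  destruct (archimed_cor1 _ Hp) as [N [HN HN0]].
  exists N. eapply Rlt_trans; [|exact HN]. apply Rinv_lt_contravar.
  + apply Rmult_lt_0_compat; apply lt_0_INR; lia.
  + apply lt_INR. lia.
- assert (Hd : exists d, 0 < d /\ forall i, In i l -> d < / INR (S i)).
  { clear. induction l as [|i l [d [Hd IH]]].
    - exists 1. split; [lra|]. intros i [].
    - assert (Hi : 0 < / INR (S i)) by (apply Rinv_0_lt_compat, lt_0_INR; lia).
      exists (Rmin d (/ INR (S i)) / 2).
      assert (m := Rmin_glb_lt _ _ _ Hd Hi).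
      assert (m1 := Rmin_l d (/ INR (S i))). assert (m2 := Rmin_r d (/ INR (S i))).
      split; [lra|]. intros j [<-|Hj]; [lra|]. specialize (IH j Hj). lra. }
  destruct Hd as [d [Hd Hi]]. exists d. split; [exact Hd|]. intros y Hy Sy.
  destruct (Hl y Sy) as [i [Ii Hiy]]. specialize (Hi i Ii). lra.
Qed.

Lemma compact_bounded (S0 : C -> Prop) :
  compact_set S0 -> exists B, forall z, S0 z -> Cmod z <= B.
Proof.
intros Hc. destruct (Hc nat (fun n y => Cmod y < INR n)) as [l Hl].
- intros n y Hy. apply (locally_le_locally_norm (V := C_NormedModule)).
  exists (mkposreal (INR n - Cmod y) ltac:(lra)).
  intros z Hz. change (Cmod (z - y) < INR n - Cmod y) in Hz.
  generalize (Cmod_le_dist z y). lra.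
- intros z _. destruct (INR_unbounded (Cmod z)) as [n Hn]. now exists n.
- exists (INR (list_max l)). intros z Sz. destruct (Hl z Sz) as [i [Ii Hi]].
  assert (K := proj1 (list_max_le l (list_max l)) (le_n _)).
  rewrite Forall_forall in K. specialize (K i Ii). apply le_INR in K. lra.
Qed.

Lemma continuous_on_eps (D : C -> Prop) (g : C -> C) (p : C) :
  continuous_on D g -> D p -> forall eps, 0 < eps -> exists d, 0 < d /\
    forall z, D z -> Cmod (z - p) < d -> Cmod (g z - g p) < eps.
Proof.
intros Hg Dp eps Heps.
assert (L := proj1 (filterlim_locally_ball_norm (K := C_AbsRing) (U := C_NormedModule) _ _)
  (Hg p Dp) (mkposreal eps Heps)).
apply (locally_norm_le_locally (V := C_NormedModule)) in L.
destruct L as [d Hd]. exists d. split; [apply cond_pos|]. intros z Dz Hz.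
exact (Hd z Hz Dz).
Qed.

Section LaurentSeries.

Variable c : nat -> C.
Hypothesis Hc : ex_series (fun k => Cmod (c k)).

(** Written in the variable [w = / z], so that truncations are polynomials, continuous on the whole
    closed unit disk. *)
Definition laurent_partial (N : nat) (w : C) : C :=
  @sum_n C_AbelianMonoid (fun k => (c k * w ^ (k + 1))%C) N.

Lemma cdiff_laurent_partial (N : nat) (w : C) : cdiff (laurent_partial N) w.
Proof.
induction N as [|N IH].
- apply cdiff_ext with (fun w => (c 0%nat * w ^ (0 + 1))%C) 1; [lra| |].
  + intros y _. unfold laurent_partial. now rewrite sum_O.
  + apply cdiff_scal, cdiff_pow.
- apply cdiff_ext with (fun w => (laurent_partial N w + c (S N) * w ^ (S N + 1))%C) 1;
    [lra| |].
  + intros y _. unfold laurent_partial. now rewrite sum_Sn.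
  + apply cdiff_plus; [exact IH|apply cdiff_scal, cdiff_pow].
Qed.

(** The Weierstrass test: each term is at most [Cmod (c k)] in modulus, so one [N] serves all [z] up
    to the unit circle. *)
Lemma laurent_approx (eps : R) : 0 < eps -> exists N, forall z l : C, 1 <= Cmod z ->
  @is_series C_AbsRing C_NormedModule (fun k => (c k / z ^ (k + 1))%C) l ->
  Cmod (l - laurent_partial N (/ z)) <= eps.
Proof.
intros Heps. destruct (Cauchy_ex_series _ Hc (mkposreal eps Heps)) as [N HN].
exists N. intros z l Hz Hl. apply Rnot_lt_le. intros Hlt.
assert (Hz0 : z <> RtoC 0) by (apply Cmod_gt_0; lra).
set (a := fun k => (c k / z ^ (k + 1))%C) in *.
assert (Ea : laurent_partial N (/ z) = @sum_n C_AbelianMonoid a N).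
{ apply sum_n_ext. intros k. unfold a, Cdiv. now rewrite Cpow_inv. }
rewrite Ea in Hlt.
set (r := Cmod (l - @sum_n C_AbelianMonoid a N) - eps).
assert (Hr : 0 < r) by (unfold r; lra).
destruct (proj1 (filterlim_locally_ball_norm (K := C_AbsRing) (U := C_NormedModule) _ _)
  Hl (mkposreal r Hr)) as [M HM].
set (m := max M (S N)).
specialize (HM m ltac:(lia)).
change (Cmod (@sum_n C_AbelianMonoid a m - l)%C < r) in HM.
assert (Hs : @sum_n C_AbelianMonoid a m =
  (@sum_n C_AbelianMonoid a N + @sum_n_m C_AbelianMonoid a (S N) m)%C).
{ unfold sum_n. apply (@sum_n_m_Chasles C_AbelianMonoid a 0 N m); lia. }
assert (Hb : Cmod (@sum_n_m C_AbelianMonoid a (S N) m) < eps).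
{ eapply Rle_lt_trans; [apply (norm_sum_n_m (V := C_NormedModule) a (S N) m)|].
  eapply Rle_lt_trans; [|apply (HN (S N) m); lia].
  eapply Rle_trans; [|apply Rle_abs]. apply sum_n_m_le. intros k.
  change (Cmod (a k) <= Cmod (c k)). unfold a.
  rewrite Cmod_div, Cmod_pow by now apply Cpow_nz.
  apply Rle_div_l; [apply pow_lt; lra|]. generalize (Cmod_ge_0 (c k)).
  assert (1 <= Cmod z ^ (k + 1)) by now apply pow_R1_Rle. nra. }
rewrite Hs in HM.
set (sN := @sum_n C_AbelianMonoid a N) in *.
set (t := @sum_n_m C_AbelianMonoid a (S N) m) in *.
assert (T := Cmod_triangle (- (sN + t - l))%C t).
replace (- (sN + t - l) + t)%C with (l - sN)%C in T by ring.
rewrite Cmod_opp in T. unfold r in *. lra.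
Qed.

End LaurentSeries.

Lemma Cinv_Lipschitz (z p : C) : 1 <= Cmod z -> 1 <= Cmod p ->
  Cmod (/ z - / p) <= Cmod (z - p).
Proof.
intros Hz Hp.
assert (Hz0 : z <> RtoC 0) by (apply Cmod_gt_0; lra).
assert (Hp0 : p <> RtoC 0) by (apply Cmod_gt_0; lra).
replace (/ z - / p)%C with ((p - z) / (z * p))%C by (field; now split).
rewrite Cmod_div, Cmod_mult, (Cmod_minus_sym p z) by now apply Cmult_neq_0.
apply Rle_div_l; [nra|]. generalize (Cmod_ge_0 (z - p)). 
assert (1 <= Cmod z * Cmod p) by nra. nra.
Qed.

Lemma Cmod_inv_le_1 (z : C) : 1 <= Cmod z -> Cmod (/ z) <= 1.
Proof.
intros Hz. rewrite Cmod_inv by (apply Cmod_gt_0; lra).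
rewrite <- Rinv_1. apply Rinv_le_contravar; lra.
Qed.

Section Shape.

Variables (S0 : C -> Prop) (f : C -> C).
Hypothesis hS0 : is_shape S0 f.

Lemma shape_open (y : C) : ~ S0 y -> open_at (fun x => ~ S0 x) y.
Proof. destruct hS0 as [_ [Hc _]]. now apply compact_closed. Qed.

Lemma shape_bounded : exists B, 0 <= B /\ forall y, S0 y -> Cmod y <= B.
Proof.
destruct hS0 as [_ [Hc _]]. destruct (compact_bounded S0 Hc) as [B HB].
exists (Rmax 0 B). split; [apply Rmax_l|]. intros y Hy.
eapply Rle_trans; [now apply HB|apply Rmax_r].
Qed.

Lemma shape_map_exterior (z : C) : 1 < Cmod z -> ~ S0 (f z).
Proof. destruct hS0 as [_ [_ [_ [_ [H _]]]]]. intros Hz. apply H. now exists z. Qed.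

Lemma shape_map_onto (y : C) : ~ S0 y -> exists z, 1 < Cmod z /\ f z = y.
Proof. destruct hS0 as [_ [_ [_ [_ [H _]]]]]. apply H. Qed.

Lemma shape_map_cdiff (z : C) : 1 < Cmod z -> cdiff f z.
Proof. destruct hS0 as [_ [_ [H _]]]. intros Hz. now apply ex_derive_cdiff, H. Qed.

(** The Laurent part is bounded, so [f] grows like its linear term. Hence preimages of bounded sets
    are bounded, and far points of the [z]-plane go to far points. *)
Lemma shape_map_growth :
  exists a b, 0 < a /\ forall z, 1 <= Cmod z -> a * Cmod z - b <= Cmod (f z).
Proof.
destruct hS0 as [_ [_ [_ [_ [_ [c1 [c [Hc1 [Hc Hf]]]]]]]]].
destruct (laurent_approx c Hc 1 Rlt_0_1) as [N HN].
destruct (bounded_by_local (fun w => Cmod w <= 1) (laurent_partial c N) 1) as [B HB].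
- tauto.
- intros p. destruct (cdiff_cont _ p (cdiff_laurent_partial c N p) 1 Rlt_0_1)
    as [d [Hd Hcont]].
  exists d, (Cmod (laurent_partial c N p) + 1). split; [exact Hd|]. intros z _ Hz.
  specialize (Hcont z Hz). generalize (Cmod_le_dist (laurent_partial c N z) (laurent_partial c N p)).
  lra.
- exists (Cmod c1), (B + 1). split; [now apply Cmod_gt_0|]. intros z Hz.
  specialize (HN z _ Hz (Hf z Hz)). specialize (HB (/ z)%C (Cmod_inv_le_1 z Hz)).
  generalize (Cmod_le_dist (f z - c1 * z) (laurent_partial c N (/ z))).
  generalize (Cmod_dist_triangle (c1 * z) (f z) 0).
  replace (c1 * z - 0)%C with (c1 * z)%C by ring.
  replace (f z - 0)%C with (f z)%C by ring.
  rewrite (Cmod_minus_sym (c1 * z) (f z)), Cmod_mult. lra.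
Qed.

Lemma shape_map_continuous (p : C) (eps : R) : 1 <= Cmod p -> 0 < eps ->
  exists d, 0 < d /\ forall z, 1 <= Cmod z -> Cmod (z - p) < d -> Cmod (f z - f p) < eps.
Proof.
intros Hp Heps.
destruct hS0 as [_ [_ [_ [_ [_ [c1 [c [Hc1 [Hc Hf]]]]]]]]].
destruct (laurent_approx c Hc (eps / 5) ltac:(lra)) as [N HN].
destruct (cdiff_cont _ (/ p)%C (cdiff_laurent_partial c N (/ p)%C) (eps / 5) ltac:(lra))
  as [d1 [Hd1 H1]].
destruct (cdiff_cont _ p (cdiff_scal c1 _ p (cdiff_id p)) (eps / 5) ltac:(lra))
  as [d2 [Hd2 H2]].
exists (Rmin d1 d2). split; [now apply Rmin_glb_lt|]. intros z Hz Bz.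
apply Rmin_Rgt in Bz. destruct Bz as [B1 B2].
specialize (H2 z B2). specialize (H1 (/ z)%C (Rle_lt_trans _ _ _ (Cinv_Lipschitz z p Hz Hp) B1)).
assert (K1 := HN z _ Hz (Hf z Hz)). assert (K2 := HN p _ Hp (Hf p Hp)).
set (G := laurent_partial c N) in *.
replace (f z - f p)%C with ((c1 * z - c1 * p) +
  ((f z - c1 * z - G (/ z)) + ((G (/ z) - G (/ p)) - (f p - c1 * p - G (/ p)))))%C by ring.
eapply Rle_lt_trans; [apply Cmod_triangle|].
eapply Rle_lt_trans; [apply Rplus_le_compat_l, Cmod_triangle|].
eapply Rle_lt_trans; [apply Rplus_le_compat_l, Rplus_le_compat_l, Cmod_sub_le|].
lra.
Qed.

End Shape.

(** * Potentials in the body frame *)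


(** The right-hand side of the slip condition, up to its constant, for the solid in its reference
    placement. *)
Definition stream (w : C) (om : R) (q : C) : R :=
  Im (Cconj w * q)%C - om / 2 * Cmod q ^ 2.

(* The complex potential seen from the body frame.  The slip condition is stated as a
   limit at the points of the solid, without reference to the conformal map. *)
Definition body_potential (S0 : C -> Prop) (w : C) (om : R) (X : C -> C) : Prop :=
  (forall y, ~ S0 y -> cdiff X y) /\ vanishes_at_infinity X /\
  exists K, forall q, S0 q -> forall eps, 0 < eps -> exists d, 0 < d /\
    forall y, ~ S0 y -> Cmod (y - q) < d -> Rabs (Im (X y) - (stream w om q + K)) < eps.

Lemma stream_plus (w1 w2 : C) (om1 om2 : R) (q : C) :
  stream (w1 + w2) (om1 + om2) q = stream w1 om1 q + stream w2 om2 q.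
Proof. unfold stream. destruct w1, w2, q. simpl. field. Qed.

Lemma stream_scal (k : R) (w : C) (om : R) (q : C) :
  stream (RtoC k * w) (k * om) q = k * stream w om q.
Proof. unfold stream. destruct w, q. simpl. field. Qed.

Lemma stream_rotate (a om : R) (w r q : C) :
  Im (Cconj w * (expi a * q + r))%C - om / 2 * Cmod (expi a * q + r - r)%C ^ 2 =
  stream (expi (- a) * w) om q + Im (Cconj w * r)%C.
Proof.
replace (expi a * q + r - r)%C with (expi a * q)%C by ring.
rewrite Cmod_mult, Cmod_expi, Rmult_1_l. unfold stream, expi.
rewrite cos_neg, sin_neg. destruct w, q, r. simpl. ring.
Qed.

Lemma vanishes_comp_rigid (X : C -> C) (a : R) (r : C) :
  vanishes_at_infinity X -> vanishes_at_infinity (fun y => X (expi a * y + r)%C).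
Proof.
intros H eps Heps. destruct (H eps Heps) as [M HM]. exists (M + Cmod r). intros y Hy.
apply HM. generalize (Cmod_triangle_inv (expi a * y) (- r)).
replace (expi a * y - - r)%C with (expi a * y + r)%C by ring.
rewrite Cmod_opp, Cmod_mult, Cmod_expi. lra.
Qed.

Lemma position_expi (S0 : C -> Prop) (a : R) (r y : C) :
  position S0 a r (expi a * y + r)%C <-> S0 y.
Proof.
split; [|intros Hy; now exists y]. intros [y' [Hy' E]].
replace y with (expi (- a) * expi a * y)%C by (rewrite expi_opp; ring).
replace y' with (expi (- a) * expi a * y')%C in Hy' by (rewrite expi_opp; ring).
replace (expi (- a) * expi a * y)%C with (expi (- a) * ((expi a * y + r) - r))%C by ring.
rewrite E. now replace (expi (- a) * (expi a * y' + r - r))%C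
  with (expi (- a) * expi a * y')%C by ring.
Qed.

(** If the limit failed at [q], the preimages of the offending points would accumulate at some [p]
    with [f p = q], necessarily on the unit circle; there the continuity of [g] and the slip
    condition give a contradiction. Several such [p] may exist, all with the same [Im (g p)]. *)
Lemma body_potential_intro (S0 : C -> Prop) (f : C -> C) (a : R) (r w : C) (om : R)
    (xi : C -> C) :
  is_shape S0 f -> is_complex_potential S0 f a r w om xi ->
  body_potential S0 (expi (- a) * w)%C om (fun y => xi (expi a * y + r)%C).
Proof.
intros Hs [Hhol [Hv [g [K [Hg [Hgx Hbd]]]]]]. split; [|split].
- intros y Hy. apply (cdiff_comp xi (fun y => (expi a * y + r)%C)); [|apply cdiff_affine].
  apply ex_derive_cdiff, Hhol. intros Hp. apply Hy. now apply position_expi in Hp.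
- now apply vanishes_comp_rigid.
- set (K' := K + Im (Cconj w * r)%C). exists K'. intros q Hq eps Heps.
  set (s := stream (expi (- a) * w) om q).
  apply NNPP. intros Hno.
  destruct (shape_map_growth S0 f Hs) as [ga [gb [Hga Hgrow]]].
  (* By the growth bound, all preimages of points within distance 1 of [q] lie in this square. *)
  set (R0 := Rmax 0 ((Cmod q + 1 + gb) / ga)).
  destruct (rect_localize (fun A => forall d, 0 < d -> exists z, A z /\ 1 < Cmod z /\
    Cmod (f z - q) < d /\ eps <= Rabs (Im (g z) - (s + K'))) R0) as [p [_ Hp]].
  + apply Rmax_l.
  + intros A B1 B2 B3 B4 Hsub HA. apply NNPP. intros Hn.
    apply not_or_and in Hn. destruct Hn as [N1 Hn].
    apply not_or_and in Hn. destruct Hn as [N2 Hn].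
    apply not_or_and in Hn. destruct Hn as [N3 N4].
    apply not_all_ex_not in N1. destruct N1 as [d1 N1].
    apply not_all_ex_not in N2. destruct N2 as [d2 N2].
    apply not_all_ex_not in N3. destruct N3 as [d3 N3].
    apply not_all_ex_not in N4. destruct N4 as [d4 N4].
    apply imply_to_and in N1, N2, N3, N4.
    destruct N1 as [D1 N1], N2 as [D2 N2], N3 as [D3 N3], N4 as [D4 N4].
    destruct (HA (Rmin (Rmin d1 d2) (Rmin d3 d4))) as [z [Az [Hz1 [Hz2 Hz3]]]].
    { repeat apply Rmin_glb_lt; assumption. }
    apply Rmin_Rgt in Hz2. destruct Hz2 as [Hz2 Hz4].
    apply Rmin_Rgt in Hz2. apply Rmin_Rgt in Hz4.
    destruct (Hsub z Az) as [h1|[h1|[h1|h1]]];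
      [apply N1|apply N2|apply N3|apply N4]; exists z; tauto.
  + intros d Hd. apply NNPP. intros Hn. apply Hno. exists (Rmin d 1).
    split; [apply Rmin_glb_lt; lra|]. intros y Hy Hyq.
    apply Rmin_Rgt in Hyq. destruct Hyq as [Hyq1 Hyq2].
    destruct (shape_map_onto S0 f Hs y Hy) as [z [Hz Ez]].
    apply Rnot_le_lt. intros Hle. apply Hn. exists z. rewrite Ez.
    refine (conj _ (conj Hz (conj Hyq1 _))).
    2:{ rewrite (Hgx z Hz), Ez. exact Hle. }
    apply ball_in_rect. apply Rle_trans with ((Cmod q + 1 + gb) / ga); [|apply Rmax_r].
    apply Rle_div_r; [exact Hga|]. specialize (Hgrow z ltac:(lra)).
    rewrite Ez in Hgrow. generalize (Cmod_le_dist y q). lra.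
  + assert (Hp1 : 1 <= Cmod p).
    { apply Rnot_lt_le. intros Hlt. destruct (Hp (1 - Cmod p) ltac:(lra)) as [A [HA Hn]].
      destruct (HA 1 Rlt_0_1) as [z [Az [Hz _]]].
      generalize (proj1 (Hn z Az)) (Cmod_le_dist z p). lra. }
    (* Continuity of [f] up to the circle: points near [p] have images near [f p], yet some of these
       images are as close to [q] as desired. *)
    assert (Efp : f p = q).
    { apply NNPP. intros Hne.
      assert (Hm : 0 < Cmod (f p - q)).
      { apply Cmod_gt_0. intros E. apply Hne. replace (f p) with (f p - q + q)%C by ring.
        rewrite E. ring. }
      destruct (shape_map_continuous S0 f Hs p (Cmod (f p - q) / 2) Hp1 ltac:(lra))
        as [d [Hd Hc]].
      destruct (Hp d Hd) as [A [HA Hn]].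
      destruct (HA (Cmod (f p - q) / 2) ltac:(lra)) as [z [Az [Hz1 [Hz2 _]]]].
      specialize (Hc z ltac:(lra) (proj1 (Hn z Az))).
      generalize (Cmod_dist_triangle (f p) (f z) q).
      rewrite (Cmod_minus_sym (f p) (f z)). lra. }
    assert (Ep : Cmod p = 1).
    { apply NNPP. intros Hne. apply (shape_map_exterior S0 f Hs p); [lra|].
      now rewrite Efp. }
    destruct (continuous_on_eps _ g p Hg Hp1 eps Heps) as [d [Hd Hc]].
    destruct (Hp d Hd) as [A [HA Hn]].
    destruct (HA 1 Rlt_0_1) as [z [Az [Hz1 [_ Hz3]]]].
    specialize (Hc z ltac:(lra) (proj1 (Hn z Az))).
    assert (Eg : Im (g p) = s + K').
    { rewrite (Hbd p Ep), Efp, stream_rotate. unfold s, K'. ring. }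
    rewrite <- Eg in Hz3.
    generalize (im_le_Cmod (g z - g p)).
    change (Im (g z - g p)%C) with (Im (g z) - Im (g p)). lra.
Qed.

Lemma body_potential_plus (S0 : C -> Prop) (w1 w2 : C) (om1 om2 : R) (X1 X2 : C -> C) :
  body_potential S0 w1 om1 X1 -> body_potential S0 w2 om2 X2 ->
  body_potential S0 (w1 + w2)%C (om1 + om2) (fun y => (X1 y + X2 y)%C).
Proof.
intros [A1 [B1 [K1 C1]]] [A2 [B2 [K2 C2]]]. split; [|split].
- intros y Hy. apply cdiff_plus; auto.
- intros eps Heps. destruct (B1 (eps / 2) ltac:(lra)) as [M1 H1].
  destruct (B2 (eps / 2) ltac:(lra)) as [M2 H2]. exists (Rmax M1 M2). intros z Hz.
  apply Rmax_Rlt in Hz. destruct Hz as [Z1 Z2].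
  specialize (H1 z Z1). specialize (H2 z Z2). generalize (Cmod_triangle (X1 z) (X2 z)). lra.
- exists (K1 + K2). intros q Hq eps Heps.
  destruct (C1 q Hq (eps / 2) ltac:(lra)) as [d1 [D1 H1]].
  destruct (C2 q Hq (eps / 2) ltac:(lra)) as [d2 [D2 H2]].
  exists (Rmin d1 d2). split; [now apply Rmin_glb_lt|]. intros y Hy Hyq.
  apply Rmin_Rgt in Hyq. destruct Hyq as [Y1 Y2].
  specialize (H1 y Hy Y1). specialize (H2 y Hy Y2). rewrite stream_plus.
  change (Im (X1 y + X2 y)%C) with (Im (X1 y) + Im (X2 y)).
  replace (Im (X1 y) + Im (X2 y) - (stream w1 om1 q + stream w2 om2 q + (K1 + K2))) with
    ((Im (X1 y) - (stream w1 om1 q + K1)) + (Im (X2 y) - (stream w2 om2 q + K2))) by ring.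
  eapply Rle_lt_trans; [apply Rabs_triang|]. lra.
Qed.

Lemma body_potential_scal (S0 : C -> Prop) (k : R) (w : C) (om : R) (X : C -> C) :
  body_potential S0 w om X ->
  body_potential S0 (RtoC k * w)%C (k * om) (fun y => (RtoC k * X y)%C).
Proof.
intros [A1 [B1 [K1 C1]]].
assert (Hk : 0 < Rabs k + 1) by (generalize (Rabs_pos k); lra). split; [|split].
- intros y Hy. apply cdiff_scal; auto.
- intros eps Heps.
  destruct (B1 (eps / (Rabs k + 1))) as [M1 H1]; [now apply Rdiv_lt_0_compat|].
  exists M1. intros z Hz. specialize (H1 z Hz). rewrite Cmod_mult, Cmod_R.
  apply Rlt_div_r in H1; [|exact Hk]. generalize (Cmod_ge_0 (X z)). nra.
- exists (k * K1). intros q Hq eps Heps.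
  destruct (C1 q Hq (eps / (Rabs k + 1))) as [d1 [D1 H1]]; [now apply Rdiv_lt_0_compat|].
  exists d1. split; [exact D1|]. intros y Hy Hyq. specialize (H1 y Hy Hyq).
  rewrite stream_scal.
  replace (Im (RtoC k * X y)%C) with (k * Im (X y)) by (destruct (X y); simpl; ring).
  replace (k * Im (X y) - (k * stream w om q + k * K1)) with
    (k * (Im (X y) - (stream w om q + K1))) by ring.
  rewrite Rabs_mult. apply Rlt_div_r in H1; [|exact Hk].
  generalize (Rabs_pos (Im (X y) - (stream w om q + K1))). nra.
Qed.

Lemma vanishes_scal (X : C -> C) (l : C) : Cmod l = 1 ->
  vanishes_at_infinity X -> vanishes_at_infinity (fun y => (l * X y)%C).
Proof.
intros Hl H eps Heps. destruct (H eps Heps) as [M HM]. exists M. intros z Hz.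
rewrite Cmod_mult, Hl, Rmult_1_l. now apply HM.
Qed.

(** Composition with the conformal map replaces the exterior of the solid by the exterior of the
    unit disk, where the identity theorem was proved by powers of [z]. *)
Lemma exterior_zero (S0 : C -> Prop) (f : C -> C) (X : C -> C) (M : R) :
  is_shape S0 f -> (forall y, ~ S0 y -> cdiff X y) ->
  (forall y, M < Cmod y -> X y = RtoC 0) -> forall y, ~ S0 y -> X y = RtoC 0.
Proof.
intros Hs HX HM y Hy. destruct (shape_map_onto S0 f Hs y Hy) as [z [Hz <-]].
destruct (shape_map_growth S0 f Hs) as [a [b [Ha Hgr]]].
apply (exterior_identity (fun z => X (f z)) 1 (Rmax 1 ((M + b) / a))); [| |exact Hz|lra].
- intros u Hu. apply (cdiff_comp X f); [|now apply (shape_map_cdiff S0 f Hs)].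
  now apply HX, (shape_map_exterior S0 f Hs).
- intros u Hu. apply Rmax_Rlt in Hu. destruct Hu as [U1 U2]. apply HM.
  specialize (Hgr u ltac:(lra)). apply Rlt_div_l in U2; [|exact Ha]. lra.
Qed.

Lemma body_potential_zero (S0 : C -> Prop) (f : C -> C) (X : C -> C) :
  is_shape S0 f -> body_potential S0 0 0 X -> forall y, ~ S0 y -> X y = RtoC 0.
Proof.
intros Hs [HX [Hv [K HK]]].
destruct (shape_bounded S0 f Hs) as [B [HB0 HB]].
assert (Hout : forall y, B < Cmod y -> ~ S0 y).
{ intros y Hy Sy. specialize (HB y Sy). lra. }
assert (Hs0 : forall q, stream 0 0 q = 0).
{ intros q. unfold stream. simpl. field. }
(* Taking [l = 1] and [l = -1] bounds [Im X] on both sides. The boundary value is the unknown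
   constant [K], and the value at infinity is 0, hence the maximum of the two. *)
assert (Hbd : forall l : R, l * l = 1 ->
  forall y, ~ S0 y -> Re (Ci * RtoC l * X y)%C <= Rmax 0 (- l * K)).
{ intros l Hl. assert (Hla : Rabs l = 1).
  { unfold Rabs. destruct (Rcase_abs l); nra. }
  assert (E : forall y, Re (Ci * RtoC l * X y)%C = - l * Im (X y)).
  { intros y. destruct (X y). simpl. ring. }
  apply (maximum_principle (fun y => ~ S0 y) (fun y => (Ci * RtoC l * X y)%C)).
  - now apply (shape_open S0 f Hs).
  - intros y Hy. now apply cdiff_scal, HX.
  - intros p Hp eps Heps. apply NNPP in Hp. destruct (HK p Hp eps Heps) as [d [Hd H]].
    exists d. split; [exact Hd|]. intros y Hy Hyp. specialize (H y Hy Hyp).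
    rewrite Hs0, Rplus_0_l in H. rewrite E.
    apply Rle_trans with (- l * K + eps); [|generalize (Rmax_r 0 (- l * K)); lra].
    replace (- l * Im (X y)) with (- l * K + - l * (Im (X y) - K)) by ring.
    assert (- l * (Im (X y) - K) <= Rabs (Im (X y) - K)).
    { eapply Rle_trans; [apply Rle_abs|]. rewrite Rabs_mult, Rabs_Ropp, Hla. lra. }
    lra.
  - intros eps Heps. destruct (Hv eps Heps) as [M HM]. exists M. intros y _ Hy.
    specialize (HM y Hy). rewrite E. generalize (Rmax_l 0 (- l * K)) (im_le_Cmod (X y)).
    assert (- l * Im (X y) <= Rabs (Im (X y))).
    { eapply Rle_trans; [apply Rle_abs|]. rewrite Rabs_mult, Rabs_Ropp, Hla. lra. }
    lra. }
assert (HIm : forall y, B < Cmod y -> Im (X y) = 0).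
(* Whatever the sign of [K], one choice of [l] makes the bound [Rmax 0 (- l * K)] equal to 0. *)
{ assert (Hl : exists l : R, l * l = 1 /\ forall y, ~ S0 y -> 0 <= l * Im (X y)).
  { destruct (Rle_or_lt 0 K) as [k|k].
    - exists 1. split; [lra|]. intros y Hy.
      generalize (Hbd 1 ltac:(lra) y Hy). rewrite Rmax_left by lra.
      destruct (X y). simpl. lra.
    - exists (-1). split; [lra|]. intros y Hy.
      generalize (Hbd (-1) ltac:(lra) y Hy). rewrite Rmax_left by lra.
      destruct (X y). simpl. lra. }
  destruct Hl as [l [Hl Hpos]]. intros y Hy.
  set (h := fun y => (- (Ci * RtoC l) * X y)%C).
  assert (E : forall y, Re (h y) = l * Im (X y)).
  { intros u. unfold h. destruct (X u). simpl. ring. }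
  assert (Z : Re (h y) = 0).
  { assert (y0 : y <> RtoC 0) by (apply Cmod_gt_0; lra).
    apply (circle_nonneg_zero h 0 y y0).
    - replace (y - 0)%C with y by ring. intros u Hu.
      replace (u - 0)%C with u in Hu by ring.
      assert (~ S0 u) by (apply Hout; lra). split; [now apply cdiff_scal, HX|].
      rewrite E. now apply Hpos.
    - replace (y - 0)%C with y by ring. intros b.
      apply mean_zero; [lra| |].
      + intros u Hu. apply cdiff_scal, HX, Hout. lra.
      + apply vanishes_scal; [|exact Hv].
        rewrite Cmod_opp, Cmod_mult, Cmod_Ci, Cmod_R. unfold Rabs.
        destruct (Rcase_abs l); nra. }
  rewrite E in Z. nra. }
assert (HRe : forall y, B < Cmod y -> Re (X y) = 0).
{ intros y Hy. set (h := fun y => (X y * X y)%C).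
  assert (E : forall u, B < Cmod u -> Re (h u) = Re (X u) ^ 2).
  { intros u Hu. specialize (HIm u Hu). unfold h. destruct (X u) as [p q].
    simpl in *. rewrite HIm. ring. }
  assert (Z : Re (h y) = 0).
  { assert (y0 : y <> RtoC 0) by (apply Cmod_gt_0; lra).
    apply (circle_nonneg_zero h 0 y y0).
    - replace (y - 0)%C with y by ring. intros u Hu.
      replace (u - 0)%C with u in Hu by ring.
      assert (~ S0 u) by (apply Hout; lra). split; [apply cdiff_mult; now apply HX|].
      rewrite E by lra. apply pow2_ge_0.
    - replace (y - 0)%C with y by ring. intros b.
      apply mean_zero; [lra| |].
      + intros u Hu. assert (~ S0 u) by (apply Hout; lra). apply cdiff_mult; now apply HX.
      + intros eps Heps. destruct (Hv (Rmin 1 eps)) as [M HM]; [apply Rmin_glb_lt; lra|].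
        exists M. intros z Hz. specialize (HM z Hz). apply Rmin_Rgt in HM.
        unfold h. rewrite Cmod_mult. generalize (Cmod_ge_0 (X z)). nra. }
  rewrite E in Z by exact Hy. nra. }
apply (exterior_zero S0 f X B Hs HX). intros y Hy.
apply C_eq; [now apply HRe|now apply HIm].
Qed.

Lemma body_potential_unique (S0 : C -> Prop) (f : C -> C) (w : C) (om : R) (X Y : C -> C) :
  is_shape S0 f -> body_potential S0 w om X -> body_potential S0 w om Y ->
  forall y, ~ S0 y -> X y = Y y.
Proof.
intros Hs HX HY y Hy.
assert (H := body_potential_plus _ _ _ _ _ _ _ HX (body_potential_scal _ (-1) _ _ _ HY)).
replace (w + RtoC (-1) * w)%C with (RtoC 0) in H by ring.
replace (om + -1 * om) with 0 in H by ring.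
assert (E := body_potential_zero S0 f _ Hs H y Hy). simpl in E.
replace (X y) with (X y + RtoC (-1) * Y y + Y y)%C by ring. rewrite E. ring.
Qed.

(** * Separation of twists *)


Definition boundary_point (S0 : C -> Prop) (q : C) : Prop :=
  S0 q /\ forall d, 0 < d -> exists y, ~ S0 y /\ Cmod (y - q) < d.

(** The supremum of the parameters at which the segment meets [S0] gives the point: it belongs to
    [S0] by closedness, and all later points are outside. *)
Lemma segment_exit (S0 : C -> Prop) (p u : C) :
  (forall y, ~ S0 y -> open_at (fun x => ~ S0 x) y) -> S0 p -> ~ S0 u ->
  exists t, 0 <= t <= 1 /\ boundary_point S0 (p + RtoC t * (u - p))%C.
Proof.
intros Hop Hp Hu.
set (g := fun t => (p + RtoC t * (u - p))%C).
assert (Hg : forall s t, Cmod (g s - g t) = Rabs (s - t) * Cmod (u - p)).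
{ intros s t. unfold g.
  replace (p + RtoC s * (u - p) - (p + RtoC t * (u - p)))%C
    with (RtoC (s - t) * (u - p))%C by (rewrite RtoC_minus; ring).
  now rewrite Cmod_mult, Cmod_R. }
assert (Hm : 0 < Cmod (u - p)).
{ apply Cmod_gt_0. intros E. apply Hu. replace u with (p + (u - p))%C by ring.
  rewrite E. now replace (p + 0)%C with p by ring. }
destruct (completeness (fun t => 0 <= t <= 1 /\ S0 (g t))) as [t [Ht1 Ht2]].
- exists 1. intros t [Ht _]. lra.
- exists 0. split; [lra|]. unfold g. now replace (p + RtoC 0 * (u - p))%C with p by ring.
- assert (T0 : 0 <= t).
  { apply Ht1. split; [lra|]. unfold g. now replace (p + RtoC 0 * (u - p))%C with p by ring. }
  assert (T1 : t <= 1) by (apply Ht2; intros s [Hs _]; lra).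
  exists t. split; [lra|]. fold (g t).
  assert (St : S0 (g t)).
  { apply NNPP. intros Hn. destruct (Hop _ Hn) as [d [Hd H]].
    assert (Hd' : 0 < d / Cmod (u - p)) by now apply Rdiv_lt_0_compat.
    assert (t <= t - d / Cmod (u - p)); [|lra].
    apply Ht2. intros s [Hs Ss]. apply Rnot_lt_le. intros Hlt.
    assert (Hst := Ht1 s (conj Hs Ss)). apply (H (g s)); [|exact Ss].
    rewrite Hg, Rabs_left1 by lra. apply Rlt_div_r; [exact Hm|]. lra. }
  split; [exact St|]. intros d Hd.
  assert (T1' : t < 1).
  { destruct T1 as [h|h]; [exact h|]. exfalso. apply Hu. rewrite h in St. unfold g in St.
    now replace (p + RtoC 1 * (u - p))%C with u in St by ring. }
  assert (Hd' : 0 < d / Cmod (u - p)) by now apply Rdiv_lt_0_compat.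
  set (s := Rmin 1 (t + d / Cmod (u - p) / 2)).
  assert (s1 := Rmin_l 1 (t + d / Cmod (u - p) / 2)).
  assert (s2 := Rmin_r 1 (t + d / Cmod (u - p) / 2)). fold s in s1, s2.
  assert (s3 : t < s) by (apply Rmin_glb_lt; lra).
  exists (g s). split.
  + intros Ss. assert (s <= t) by (apply Ht1; split; [lra|exact Ss]). lra.
  + rewrite Hg, Rabs_pos_eq by lra. apply Rlt_div_r; [exact Hm|]. lra.
Qed.

(** [Ci * w] is the gradient of [stream w 0], which is affine. *)
Lemma stream_line (w : C) (q : C) (t : R) :
  stream w 0 (q + RtoC t * (Ci * w))%C = stream w 0 q + t * Cmod w ^ 2.
Proof. unfold stream. rewrite !Cmod2_alt. destruct w, q. simpl. field. Qed.

(** Completion of the square about [Ci * w / om], the instantaneous centre of rotation, where the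
    velocity [i om q + w] vanishes. *)
Lemma stream_circle (w : C) (om : R) (q : C) : om <> 0 ->
  Cmod (q - Ci * w / RtoC om)%C ^ 2 =
  Cmod (Ci * w / RtoC om)%C ^ 2 - 2 / om * stream w om q.
Proof.
intros Hom. unfold stream.
replace (Ci * w / RtoC om)%C with (RtoC (/ om) * (Ci * w))%C
  by (rewrite RtoC_inv by exact Hom; unfold Cdiv; ring).
rewrite !Cmod2_alt. destruct w, q. simpl. field. exact Hom.
Qed.

Section Separation.

Variables (S0 : C -> Prop) (f : C -> C).
Hypothesis hS0 : is_shape S0 f.
Hypothesis hline : ~ on_line S0.
Hypothesis hcircle : ~ on_circle S0.

Lemma shape_exit (q v : C) : S0 q -> v <> RtoC 0 ->
  exists t, 0 <= t /\ boundary_point S0 (q + RtoC t * v)%C.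
Proof.
intros Hq Hv. destruct (shape_bounded S0 f hS0) as [B [HB0 HB]].
assert (Hm : 0 < Cmod v) by now apply Cmod_gt_0.
set (t := (B + Cmod q + 1) / Cmod v).
assert (Ht : 0 < t) by (apply Rdiv_lt_0_compat; [generalize (Cmod_ge_0 q); lra|exact Hm]).
assert (Hu : ~ S0 (q + RtoC t * v)%C).
{ intros Su. specialize (HB _ Su).
  generalize (Cmod_triangle_inv (RtoC t * v) (- q)).
  replace (RtoC t * v - - q)%C with (q + RtoC t * v)%C by ring.
  rewrite Cmod_opp, Cmod_mult, Cmod_R, Rabs_pos_eq by lra.
  replace (t * Cmod v) with (B + Cmod q + 1) by (unfold t; field; lra). lra. }
destruct (segment_exit S0 q _ (shape_open S0 f hS0) Hq Hu) as [s [Hs Hb]].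
exists (s * t). split; [nra|].
replace (q + RtoC (s * t) * v)%C with (q + RtoC s * (q + RtoC t * v - q))%C
  by (rewrite RtoC_mult; ring). exact Hb.
Qed.

(** The boundary lies on a level line of [stream w 0]. A point of the solid off that line would,
    when pushed further away along the gradient or against it, reach the boundary off the line; so
    the whole solid lies on it. *)
Lemma boundary_stream_line (w : C) (K : R) :
  (forall q, boundary_point S0 q -> stream w 0 q + K = 0) -> w = RtoC 0.
Proof.
intros H. apply NNPP. intros Hw. apply hline.
assert (Hiw : (Ci * w)%C <> RtoC 0).
{ apply Cmod_gt_0. rewrite Cmod_mult, Cmod_Ci. apply Cmod_gt_0 in Hw. lra. }
assert (Hw2 : 0 < Cmod w ^ 2) by (apply pow_lt; now apply Cmod_gt_0).
exists (Ci * w)%C, (- K). split; [exact Hiw|]. intros q Hq.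
assert (E : Re (Cconj (Ci * w) * q)%C = stream w 0 q).
{ unfold stream. destruct w, q. simpl. field. }
rewrite E. destruct (Rtotal_order (stream w 0 q + K) 0) as [Hlt|[Heq|Hgt]]; [|lra|].
- destruct (shape_exit q (RtoC (-1) * (Ci * w))%C Hq) as [t [Ht Hb]].
  { apply Cmult_neq_0; [|exact Hiw]. intros h. apply (f_equal Re) in h. simpl in h. lra. }
  apply H in Hb.
  replace (q + RtoC t * (RtoC (-1) * (Ci * w)))%C with (q + RtoC (- t) * (Ci * w))%C in Hb
    by (rewrite RtoC_opp; ring).
  rewrite stream_line in Hb. nra.
- destruct (shape_exit q (Ci * w)%C Hq Hiw) as [t [Ht Hb]].
  apply H in Hb. rewrite stream_line in Hb. nra.
Qed.

(** The boundary lies on a circle about the centre of rotation, and leaving the solid radially shows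
    that the solid is inside it. If some point of the solid is strictly inside, segments from it
    fill the open disk; otherwise the solid is part of the circle, which is excluded. *)
Lemma boundary_stream_circle (w : C) (om K : R) : om <> 0 ->
  (forall q, boundary_point S0 q -> stream w om q + K = 0) -> is_disk S0.
Proof.
intros Hom H. set (p := (Ci * w / RtoC om)%C).
set (kap := Cmod p ^ 2 + 2 / om * K).
assert (Hk : forall q, boundary_point S0 q -> Cmod (q - p) ^ 2 = kap).
{ intros q Hq. unfold p. rewrite stream_circle by exact Hom. fold p.
  specialize (H q Hq). unfold kap. replace K with (- stream w om q) by lra. field.
  exact Hom. }
assert (Hne : exists q, S0 q) by (destruct hS0 as [[[h _] _] _]; exact h).
assert (Hk0 : 0 <= kap).
{ destruct Hne as [q Hq].
  destruct (shape_exit q 1 Hq) as [t [_ Hb]].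
  { intros h. apply (f_equal Re) in h. simpl in h. lra. }
  rewrite <- (Hk _ Hb). apply pow2_ge_0. }
set (rho := sqrt kap).
assert (Hr0 : 0 <= rho) by apply sqrt_pos.
assert (Hr2 : rho ^ 2 = kap) by (unfold rho; simpl; rewrite Rmult_1_r; now apply sqrt_sqrt).
assert (Hb : forall q, boundary_point S0 q -> Cmod (q - p) = rho).
{ intros q Hq. specialize (Hk q Hq). apply Rsqr_inj; [apply Cmod_ge_0|exact Hr0|].
  rewrite !Rsqr_pow2, Hr2. exact Hk. }
assert (Hin : forall q, S0 q -> Cmod (q - p) <= rho).
{ intros q Hq. apply Rnot_lt_le. intros Hlt.
  destruct (shape_exit q (q - p)%C Hq) as [t [Ht Hbt]].
  { apply Cmod_gt_0. lra. }
  apply Hb in Hbt.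
  replace (q + RtoC t * (q - p) - p)%C with (RtoC (1 + t) * (q - p))%C in Hbt
    by (rewrite RtoC_plus; ring).
  rewrite Cmod_mult, Cmod_R, Rabs_pos_eq in Hbt by lra. nra. }
destruct (classic (exists q, S0 q /\ Cmod (q - p) < rho)) as [[q [Hq Hqr]]|Hno].
- exists p, rho.
  assert (Hop : forall z, Cmod (z - p) < rho -> S0 z).
  { intros z Hz. apply NNPP. intros Hn.
    destruct (segment_exit S0 q z (shape_open S0 f hS0) Hq Hn) as [t [Ht Hbt]].
    apply Hb in Hbt.
    replace (q + RtoC t * (z - q) - p)%C with (RtoC (1 - t) * (q - p) + RtoC t * (z - p))%C
      in Hbt by (rewrite RtoC_minus; ring).
    assert (T := Cmod_triangle (RtoC (1 - t) * (q - p)) (RtoC t * (z - p))).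
    rewrite Hbt, !Cmod_mult, !Cmod_R, !Rabs_pos_eq in T by lra. destruct (Rle_or_lt (Cmod (q - p)) (Cmod (z - p))); nra. }
  intros z. split; [apply Hin|]. intros Hz. apply NNPP. intros Hn.
  destruct (shape_open S0 f hS0 z Hn) as [d [Hd Hball]].
  assert (Hrp : 0 < rho) by (generalize (Cmod_ge_0 (q - p)); lra).
  (* Moving [z] towards the centre by at most [d / 2] enters the open disk without leaving the ball
     about [z] that avoids [S0]. *)
  set (s := Rmin 1 (d / (2 * rho))).
  assert (s0 : 0 < s) by (apply Rmin_glb_lt; [lra|apply Rdiv_lt_0_compat; lra]).
  assert (s1 : s <= 1) by apply Rmin_l.
  assert (s2 : s * (2 * rho) <= d) by (apply Rle_div_r; [lra|apply Rmin_r]).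
  apply (Hball (z - RtoC s * (z - p))%C).
  + replace (z - RtoC s * (z - p) - z)%C with (- (RtoC s * (z - p)))%C by ring.
    rewrite Cmod_opp, Cmod_mult, Cmod_R, Rabs_pos_eq by lra. nra.
  + apply Hop.
    replace (z - RtoC s * (z - p) - p)%C with (RtoC (1 - s) * (z - p))%C
      by (rewrite RtoC_minus; ring).
    rewrite Cmod_mult, Cmod_R, Rabs_pos_eq by lra. nra.
- exfalso. apply hcircle. exists p, rho. intros z Hz. specialize (Hin z Hz).
  apply Rle_antisym; [exact Hin|]. apply Rnot_lt_le. intros Hlt. apply Hno. now exists z.
Qed.

Lemma body_potential_separates (w : C) (om : R) (X : C -> C) :
  (is_disk S0 -> om = 0) -> body_potential S0 w om X ->
  (forall y, ~ S0 y -> X y = RtoC 0) -> w = RtoC 0 /\ om = 0.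
Proof.
intros Hdisk [_ [_ [K HK]]] HX.
assert (H : forall q, boundary_point S0 q -> stream w om q + K = 0).
{ intros q [Hq Hlim]. apply NNPP. intros Hne. apply Rabs_pos_lt in Hne.
  destruct (HK q Hq _ Hne) as [d [Hd Hc]]. destruct (Hlim d Hd) as [y [Hy Hyq]].
  specialize (Hc y Hy Hyq). rewrite (HX y Hy) in Hc. simpl in Hc.
  rewrite Rminus_0_l, Rabs_Ropp in Hc. lra. }
destruct (Req_dec om 0) as [Hom|Hom].
- split; [|exact Hom]. subst om. now apply (boundary_stream_line w K).
- exfalso. apply Hom, Hdisk. now apply (boundary_stream_circle w om K).
Qed.

End Separation.

(** Change of body frame by a symmetry of the solid: the new origin [s] has velocity [w + i om s],
    read in axes turned by [b]. *)
Lemma body_potential_rigid (S0 : C -> Prop) (w s : C) (om b : R) (X : C -> C) :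
  (forall y, S0 (expi b * y + s)%C <-> S0 y) ->
  body_potential S0 w om X ->
  body_potential S0 (expi (- b) * (w + Ci * RtoC om * s))%C om
    (fun y => X (expi b * y + s)%C).
Proof.
intros Hsym [HX [Hv [K HK]]]. split; [|split].
- intros y Hy. apply (cdiff_comp X (fun y => (expi b * y + s)%C)); [|apply cdiff_affine].
  apply HX. intros Hs. now apply Hy, Hsym.
- now apply vanishes_comp_rigid.
- exists (K + Im (Cconj w * s)%C - om / 2 * Cmod s ^ 2). intros q Hq eps Heps.
  destruct (HK _ (proj2 (Hsym q) Hq) eps Heps) as [d [Hd H]].
  exists d. split; [exact Hd|]. intros y Hy Hyq.
  assert (Hy' : ~ S0 (expi b * y + s)%C) by (intros h; now apply Hy, Hsym).
  specialize (H _ Hy').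
  replace (expi b * y + s - (expi b * q + s))%C with (expi b * (y - q))%C in H by ring.
  rewrite Cmod_mult, Cmod_expi, Rmult_1_l in H. specialize (H Hyq).
  replace (stream (expi (- b) * (w + Ci * RtoC om * s)) om q +
    (K + Im (Cconj w * s)%C - om / 2 * Cmod s ^ 2)) with
    (stream w om (expi b * q + s)%C + K); [exact H|].
  unfold stream.
  assert (E : Cmod (expi b * q + s)%C ^ 2 =
    Cmod q ^ 2 + 2 * Re (Cconj s * (expi b * q))%C + Cmod s ^ 2).
  { replace (Cmod q ^ 2) with (Cmod (expi b * q)%C ^ 2)
      by (now rewrite Cmod_mult, Cmod_expi, Rmult_1_l).
    rewrite !Cmod2_alt. destruct (expi b * q)%C as [u v], s. simpl. ring. }
  rewrite E. unfold expi. rewrite cos_neg, sin_neg. destruct w, s, q. simpl. field.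
Qed.

(** On the bounding circle [Cmod q ^ 2] is an affine function of [q], so the spin contributes only
    through the velocity [w + i om p] of the centre. *)
Lemma body_potential_disk (S0 : C -> Prop) (p w : C) (rho om : R) (X : C -> C) :
  (forall z, S0 z <-> Cmod (z - p) <= rho) ->
  body_potential S0 w om X -> body_potential S0 (w + Ci * RtoC om * p)%C 0 X.
Proof.
intros Hd [HX [Hv [K HK]]]. split; [exact HX|]. split; [exact Hv|].
exists (K - om / 2 * (rho ^ 2 - Cmod p ^ 2)). intros q Hq eps Heps.
apply Hd in Hq. destruct Hq as [Hq|Hq].
(* At an interior point of the disk the limit condition is vacuous. *)
- exists (rho - Cmod (q - p)). split; [lra|]. intros y Hy Hyq. exfalso. apply Hy, Hd.
  generalize (Cmod_dist_triangle y q p). lra.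
- destruct (HK q (proj2 (Hd q) (Req_le _ _ Hq)) eps Heps) as [d [Hd0 H]].
  exists d. split; [exact Hd0|]. intros y Hy Hyq. specialize (H y Hy Hyq).
  replace (stream (w + Ci * RtoC om * p) 0 q + (K - om / 2 * (rho ^ 2 - Cmod p ^ 2)))
    with (stream w om q + K); [exact H|].
  rewrite <- Hq. unfold stream. rewrite !Cmod2_alt. destruct w, p, q. simpl. field.
Qed.

(** * Twists and dual bases *)


(* A rigid velocity in the body frame: translation and angular velocity. *)
Definition twist : Type := (C * R)%type.

Definition tadd (u v : twist) : twist := ((fst u + fst v)%C, snd u + snd v).
Definition tscal (k : R) (u : twist) : twist := ((RtoC k * fst u)%C, k * snd u).
Definition tzero : twist := (RtoC 0, 0).

Lemma twist_eq (u v : twist) :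
  Re (fst u) = Re (fst v) -> Im (fst u) = Im (fst v) -> snd u = snd v -> u = v.
Proof. destruct u as [[? ?] ?], v as [[? ?] ?]. simpl. congruence. Qed.

Ltac tring := apply twist_eq; unfold tadd, tscal, tzero; simpl; unfold Re, Im; ring.

Definition subspace (W : twist -> Prop) : Prop :=
  W tzero /\ (forall u v, W u -> W v -> W (tadd u v)) /\ (forall k u, W u -> W (tscal k u)).

Definition linear_on (W : twist -> Prop) (l : twist -> R) : Prop :=
  (forall u v, W u -> W v -> l (tadd u v) = l u + l v) /\
  (forall k u, W u -> l (tscal k u) = k * l u).

(** Reconstruction of a twist from measurements: each pair holds a functional and the twist that its
    value multiplies. *)
Definition combination (us : list ((twist -> R) * twist)) (v : twist) : twist :=
  fold_right (fun p acc => tadd (tscal (fst p v) (snd p)) acc) tzero us.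

Lemma linear_on_zero (W : twist -> Prop) (l : twist -> R) :
  W tzero -> linear_on W l -> l tzero = 0.
Proof.
intros W0 [_ L2]. generalize (L2 0 tzero W0).
replace (tscal 0 tzero) with tzero by tring. lra.
Qed.

Lemma combination_in (W : twist -> Prop) (us : list ((twist -> R) * twist)) (v : twist) :
  subspace W -> (forall p, In p us -> W (snd p)) -> W (combination us v).
Proof.
intros [W0 [Wp Ws]]. induction us as [|p us IH]; intros H; [exact W0|].
simpl. apply Wp; [apply Ws, H; now left|apply IH; intros q Hq; apply H; now right].
Qed.

Lemma combination_linear (W : twist -> Prop) (us : list ((twist -> R) * twist)) :
  (forall p, In p us -> linear_on W (fst p)) ->
  (forall u v, W u -> W v ->
     combination us (tadd u v) = tadd (combination us u) (combination us v)) /\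
  (forall k u, W u -> combination us (tscal k u) = tscal k (combination us u)).
Proof.
induction us as [|p us IH]; intros H; simpl.
- split; intros; tring.
- destruct IH as [IH1 IH2]; [intros q Hq; apply H; now right|].
  destruct (H p (or_introl eq_refl)) as [L1 L2]. split.
  + intros u v Hu Hv. rewrite (L1 u v Hu Hv), (IH1 u v Hu Hv). tring.
  + intros k u Hu. rewrite (L2 k u Hu), (IH2 k u Hu). tring.
Qed.

Lemma functional_combination (W : twist -> Prop) (l : twist -> R)
    (us : list ((twist -> R) * twist)) (v : twist) :
  subspace W -> linear_on W l -> (forall p, In p us -> W (snd p)) ->
  l (combination us v) = fold_right (fun p acc => fst p v * l (snd p) + acc) 0 us.
Proof.
intros HW Hl. assert (HW' := HW). destruct HW' as [W0 [Wp Ws]].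
assert (Hl' := Hl). destruct Hl' as [L1 L2].
induction us as [|p us IH]; intros H; simpl.
- now apply (linear_on_zero W).
- rewrite L1.
  + rewrite L2 by (apply H; now left). f_equal. apply IH. intros q Hq. apply H. now right.
  + apply Ws, H. now left.
  + apply combination_in; [exact HW|]. intros q Hq. apply H. now right.
Qed.

(** Removes from every vector its component along [t] as measured by [k], collecting what is removed
    in one multiple of [t]; this makes room for a new dual pair. *)
Lemma combination_shift (us : list ((twist -> R) * twist)) (k : twist -> R) (t v : twist) :
  combination us v =
  tadd (tscal (fold_right (fun p acc => fst p v * k (snd p) + acc) 0 us) t)
    (combination
       (map (fun p => (fst p, tadd (snd p) (tscal (- k (snd p)) t))) us) v).
Proof.
induction us as [|p us IH]; simpl; [tring|]. rewrite IH at 1. tring.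
Qed.

(* The list [cs] acts as a coordinate system: the induction on it replaces an induction on
   the dimension of [W]. *)
Lemma dual_basis (L : (twist -> R) -> Prop) (cs : list (twist -> R)) :
  forall W : twist -> Prop,
  subspace W -> (forall c, In c cs -> linear_on W c) -> (forall l, L l -> linear_on W l) ->
  (forall v, W v -> (forall c, In c cs -> c v = 0) -> v = tzero) ->
  (forall v, W v -> (forall l, L l -> l v = 0) -> v = tzero) ->
  exists us : list ((twist -> R) * twist),
    (forall p, In p us -> L (fst p) /\ W (snd p)) /\
    forall v, W v -> v = combination us v.
Proof.
induction cs as [|c cs IH]; intros W HW Hc HL Sc SL.
- exists nil. split; [intros p []|]. intros v Hv. apply Sc; [exact Hv|intros c []].
- assert (HW' := HW). destruct HW' as [W0 [Wp Ws]].
  assert (Lc : linear_on W c) by (apply Hc; now left).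
  assert (Lc' := Lc). destruct Lc' as [c1 c2].
  assert (restr : forall l, linear_on W l -> linear_on (fun v => W v /\ c v = 0) l).
  { intros l [h1 h2]. split; intros; [apply h1|apply h2]; tauto. }
  destruct (IH (fun v => W v /\ c v = 0)) as [us [Hus Hcomb]].
  + split; [split; [exact W0|now apply (linear_on_zero W)]|split].
    * intros u v [Hu Eu] [Hv Ev]. split; [now apply Wp|]. rewrite c1 by assumption. lra.
    * intros k u [Hu Eu]. split; [now apply Ws|]. rewrite c2, Eu by assumption. ring.
  + intros d Hd. apply restr, Hc. now right.
  + intros l Hl. now apply restr, HL.
  + intros v [Hv Ev] H. apply Sc; [exact Hv|]. intros d [<-|Hd]; [exact Ev|now apply H].
  + intros v [Hv Ev] H. now apply SL.
  + destruct (classic (forall v, W v -> v = combination us v)) as [Hall|Hne].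
    { exists us. split; [|exact Hall]. intros p Hp. destruct (Hus p Hp); tauto. }
    apply not_all_ex_not in Hne. destruct Hne as [e Hne].
    apply imply_to_and in Hne. destruct Hne as [We Hne].
    assert (Hlin : forall p, In p us -> linear_on W (fst p)) by (intros p Hp; apply HL, Hus, Hp).
    destruct (combination_linear W us Hlin) as [K1 K2].
    assert (Win : forall v, W (combination us v)).
    { intros v. apply combination_in; [exact HW|]. intros p Hp. apply Hus, Hp. }
    assert (Ec : c e <> 0).
    { intros E. apply Hne, Hcomb. now split. }
    (* The part of [e] that the present pairs fail to reconstruct. It is nonzero, so some functional
       of [L] detects it. *)
    set (t := tadd e (tscal (-1) (combination us e))).
    assert (Wt : W t) by now apply Wp, Ws.
    assert (Ht : exists l, L l /\ l t <> 0).
    { apply NNPP. intros Hno. apply Hne.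
      assert (Z : t = tzero).
      { apply SL; [exact Wt|]. intros l Hl. apply NNPP. intros h. apply Hno. now exists l. }
      transitivity (tadd t (combination us e)); [unfold t; tring|]. rewrite Z. tring. }
    destruct Ht as [l [Ll Hl]]. destruct (HL l Ll) as [l1 l2].
    (* Subtracting [c v / c e] times [e] brings [v] into the kernel of [c], where reconstruction is
       exact; the whole error is thus a multiple of [t]. *)
    assert (Hv : forall v, W v -> exists k : R, v = tadd (combination us v) (tscal k t)).
    { intros v Wv. exists (c v / c e). set (k := c v / c e).
      assert (Q : tadd v (tscal (- k) e) = combination us (tadd v (tscal (- k) e))).
      { apply Hcomb. split; [now apply Wp, Ws|].
        rewrite c1, c2 by auto. unfold k. field. exact Ec. }
      rewrite K1, K2 in Q by auto.
      transitivity (tadd (tadd v (tscal (- k) e)) (tscal k e)); [tring|].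
      rewrite Q. unfold t. tring. }
    assert (Hk : exists k : twist -> R, forall u, k u = l u / l t) by now exists (fun u => l u / l t).
    destruct Hk as [k Hk].
    (* The new pair measures the coefficient of [t] by [l]; the old vectors are corrected to lie in
       the kernel of [l], so that they do not disturb this measurement. *)
    exists ((l, tscal (/ l t) t) ::
      map (fun p => (fst p, tadd (snd p) (tscal (- k (snd p)) t))) us). split.
    * intros p [<-|Hp]; [split; [exact Ll|now apply Ws]|].
      apply in_map_iff in Hp. destruct Hp as [q [<- Hq]]. simpl.
      split; [apply Hus, Hq|]. apply Wp; [apply Hus, Hq|now apply Ws].
    * intros v Wv. destruct (Hv v Wv) as [m Hm]. simpl.
      assert (El : l v = l (combination us v) + m * l t).
      { rewrite Hm at 1. now rewrite l1, l2 by auto. }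
      rewrite (functional_combination W l us v HW (HL l Ll)
        (fun p Hp => proj1 (proj2 (Hus p Hp)))) in El.
      assert (Hf : fold_right (fun p acc => fst p v * k (snd p) + acc) 0 us =
        fold_right (fun p acc => fst p v * l (snd p) + acc) 0 us / l t).
      { clear -Hk. revert Hk. generalize (l t). clear. intros d Hk.
        induction us as [|p us IH]; simpl; [unfold Rdiv; ring|].
        rewrite IH, Hk. unfold Rdiv. ring. }
      assert (Em : m = l v * / l t - fold_right (fun p acc => fst p v * k (snd p) + acc) 0 us).
      { rewrite Hf, El. field. exact Hl. }
      rewrite Hm at 1. rewrite (combination_shift us k t v), Em. tring.
Qed.

(** * Gronwall's lemma *)


Definition clamp (T s : R) : R := Rmax 0 (Rmin T s).

Lemma clamp_in (T s : R) : 0 <= T -> 0 <= clamp T s <= T.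
Proof.
intros HT. split; [apply Rmax_l|]. apply Rmax_lub; [exact HT|apply Rmin_l].
Qed.

Lemma clamp_id (T s : R) : 0 <= s <= T -> clamp T s = s.
Proof. intros Hs. unfold clamp. rewrite Rmin_right, Rmax_right; lra. Qed.

Lemma clamp_Lipschitz (T s t : R) : Rabs (clamp T s - clamp T t) <= Rabs (s - t).
Proof.
unfold clamp, Rmax, Rmin.
destruct (Rle_dec T s), (Rle_dec T t), (Rle_dec 0 T), (Rle_dec 0 s), (Rle_dec 0 t);
  try destruct (Rle_dec 0 T); try lra; unfold Rabs;
  repeat destruct Rcase_abs; lra.
Qed.

(* Continuity on [0, T] is expressed by composing with [clamp T], which makes it
   two-sided at the end points. *)
Definition C1_real (T : R) (u du : R -> R) : Prop :=
  (forall t, 0 < t < T -> is_derive u t (du t)) /\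
  (forall t, continuity_pt (fun s => u (clamp T s)) t) /\
  exists B, forall t, 0 <= t <= T -> Rabs (du t) <= B.

Lemma continuity_pt_eps (f : R -> R) (x : R) :
  (forall eps, 0 < eps -> exists d, 0 < d /\
     forall y, Rabs (y - x) < d -> Rabs (f y - f x) < eps) -> continuity_pt f x.
Proof. intros H. now apply continuity_pt_filterlim, continuous_eps. Qed.

(** Treats the identity of the reals, [Re] and [Im] at once: [pi] is linear and does not increase
    norms. *)
Lemma C1_on_projection {V : NormedModule R_AbsRing} (pi : V -> R) (T : R) (u du : R -> V) :
  (forall x y, pi (minus x y) = pi x - pi y) ->
  (forall (k : R) x, pi (scal k x) = k * pi x) ->
  (forall x, Rabs (pi x) <= norm x) ->
  0 <= T -> C1_on T u du -> C1_real T (fun t => pi (u t)) (fun t => pi (du t)).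
Proof.
intros Hm Hs Hn HT [Hd Hc].
set (I := fun t => 0 <= t <= T).
assert (D : forall t, 0 <= t <= T -> forall eps, 0 < eps -> exists d, 0 < d /\
  forall y, 0 <= y <= T -> Rabs (y - t) < d ->
    Rabs (pi (u y) - pi (u t) - (y - t) * pi (du t)) <= eps * Rabs (y - t)).
{ intros t Ht eps Heps. destruct (Hd t Ht) as [_ H].
  assert (Hlim : is_filter_lim (within I (locally t)) t).
  { intros P [d HP]. exists d. intros y By _. now apply HP. }
  destruct (H t Hlim (mkposreal eps Heps)) as [d HP].
  exists d. split; [apply cond_pos|]. intros y Hy By.
  specialize (HP y By Hy). simpl in HP.
  rewrite <- Hm. rewrite <- Hs, <- Hm.
  eapply Rle_trans; [apply Hn|exact HP]. }
assert (C' : forall t, 0 <= t <= T -> forall eps, 0 < eps -> exists d, 0 < d /\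
  forall y, 0 <= y <= T -> Rabs (y - t) < d -> Rabs (pi (du y) - pi (du t)) < eps).
{ intros t Ht eps Heps.
  destruct (proj1 (filterlim_locally_ball_norm _ _) (Hc t Ht) (mkposreal eps Heps)) as [d HP].
  exists d. split; [apply cond_pos|]. intros y Hy By. specialize (HP y By Hy).
  rewrite <- Hm. eapply Rle_lt_trans; [apply Hn|exact HP]. }
split; [|split].
- intros t Ht. apply is_derive_Reals. intros eps Heps.
  destruct (D t ltac:(lra) (eps / 2) ltac:(lra)) as [d [Hd0 H]].
  assert (Hm0 : 0 < Rmin d (Rmin t (T - t))) by (repeat apply Rmin_glb_lt; lra).
  exists (mkposreal _ Hm0). intros h Hh Bh. simpl in Bh.
  apply Rmin_Rgt in Bh. destruct Bh as [B1 B2]. apply Rmin_Rgt in B2. destruct B2 as [B2 B3].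
  assert (-t < h < T - t) by (apply Rgt_lt in B2, B3; apply Rabs_def2 in B2, B3; lra).
  specialize (H (t + h) ltac:(lra)).
  replace (t + h - t) with h in H by ring. specialize (H B1).
  apply Rmult_lt_reg_r with (Rabs h); [now apply Rabs_pos_lt|].
  rewrite <- Rabs_mult.
  replace (((pi (u (t + h)) - pi (u t)) / h - pi (du t)) * h) with
    (pi (u (t + h)) - pi (u t) - h * pi (du t)) by (field; exact Hh).
  apply Rabs_pos_lt in Hh. nra.
- intros t. apply continuity_pt_eps. intros eps Heps.
  assert (Hct := clamp_in T t HT).
  destruct (D _ Hct 1 Rlt_0_1) as [d [Hd0 H]].
  set (L := 1 + Rabs (pi (du (clamp T t)))).
  assert (HL : 0 < L) by (unfold L; generalize (Rabs_pos (pi (du (clamp T t)))); lra).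
  exists (Rmin d (eps / L)). split; [apply Rmin_glb_lt; [exact Hd0|now apply Rdiv_lt_0_compat]|].
  intros y By. apply Rmin_Rgt in By. destruct By as [B1 B2].
  assert (Q := clamp_Lipschitz T y t).
  specialize (H _ (clamp_in T y HT) ltac:(lra)).
  set (y' := clamp T y) in *. set (t' := clamp T t) in *.
  replace (pi (u y') - pi (u t')) with
    ((pi (u y') - pi (u t') - (y' - t') * pi (du t')) + (y' - t') * pi (du t')) by ring.
  eapply Rle_lt_trans; [apply Rabs_triang|]. rewrite (Rabs_mult (y' - t')).
  apply Rgt_lt in B2. apply Rlt_div_r in B2; [|exact HL].
  assert (Rabs (y' - t') * L <= Rabs (y - t) * L) by nra.
  unfold L in *. nra.
- assert (Hcont : forall t, continuity_pt (fun s => pi (du (clamp T s))) t).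
  { intros t. apply continuity_pt_eps. intros eps Heps.
    destruct (C' _ (clamp_in T t HT) eps Heps) as [d [Hd0 H]].
    exists d. split; [exact Hd0|]. intros y By. apply H; [now apply clamp_in|].
    eapply Rle_lt_trans; [apply clamp_Lipschitz|exact By]. }
  destruct (continuity_ab_maj _ 0 T HT (fun t _ => Hcont t)) as [M [HM _]].
  destruct (continuity_ab_min _ 0 T HT (fun t _ => Hcont t)) as [m [Hm0 _]].
  exists (Rabs (pi (du (clamp T M))) + Rabs (pi (du (clamp T m)))). intros t Ht.
  specialize (HM t Ht). specialize (Hm0 t Ht). simpl in HM, Hm0.
  rewrite (clamp_id T t Ht) in HM, Hm0.
  generalize (Rle_abs (pi (du (clamp T M)))) (Rabs_pos (pi (du (clamp T m))))
    (Rabs_pos (pi (du (clamp T M)))) (Rle_abs (- pi (du (clamp T m)))).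
  rewrite Rabs_Ropp. intros. apply Rabs_le. lra.
Qed.

Lemma C1_on_R (T : R) (u du : R -> R) :
  0 <= T -> C1_on (V := R_NormedModule) T u du -> C1_real T u du.
Proof.
intros HT H. apply (C1_on_projection (V := R_NormedModule) (fun x => x) T u du); try assumption.
- reflexivity.
- reflexivity.
- intros x. apply Rle_refl.
Qed.

Lemma C1_on_Re (T : R) (u du : R -> C) : 0 <= T -> C1_on (V := C_R_NormedModule) T u du ->
  C1_real T (fun t => Re (u t)) (fun t => Re (du t)).
Proof.
intros HT H. apply (C1_on_projection (V := C_R_NormedModule) Re T u du); try assumption.
- reflexivity.
- reflexivity.
- intros x. eapply Rle_trans; [apply Rmax_l|].
  exact (proj1 (norm_prod (U := R_NormedModule) (V := R_NormedModule) (fst x) (snd x))).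
Qed.

Lemma C1_on_Im (T : R) (u du : R -> C) : 0 <= T -> C1_on (V := C_R_NormedModule) T u du ->
  C1_real T (fun t => Im (u t)) (fun t => Im (du t)).
Proof.
intros HT H. apply (C1_on_projection (V := C_R_NormedModule) Im T u du); try assumption.
- reflexivity.
- reflexivity.
- intros x. eapply Rle_trans; [apply Rmax_r|].
  exact (proj1 (norm_prod (U := R_NormedModule) (V := R_NormedModule) (fst x) (snd x))).
Qed.

Lemma C1_real_minus (T : R) (u v du dv : R -> R) : C1_real T u du -> C1_real T v dv ->
  C1_real T (fun t => u t - v t) (fun t => du t - dv t).
Proof.
intros [A1 [B1 [b1 C1]]] [A2 [B2 [b2 C2]]]. split; [|split].
- intros t Ht. apply (is_derive_minus u v); auto.
- intros t. apply (continuity_pt_minus (fun s => u (clamp T s)) (fun s => v (clamp T s))); auto.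
- exists (b1 + b2). intros t Ht. specialize (C1 t Ht). specialize (C2 t Ht).
  eapply Rle_trans; [apply Rabs_triang|]. rewrite Rabs_Ropp. lra.
Qed.

Lemma C1_real_shift (T k : R) (u du : R -> R) : C1_real T u du ->
  C1_real T (fun t => u t + k) du.
Proof.
intros [A1 [B1 C1]]. split; [|split].
- intros t Ht. replace (du t) with (plus (du t) 0) by apply Rplus_0_r.
  apply (is_derive_plus u (fun _ => k)); [auto|apply (is_derive_const k t)].
- intros t. apply (continuity_pt_plus (fun s => u (clamp T s)) (fun _ => k)); auto.
  apply continuity_pt_const. now intros ? ?.
- exact C1.
Qed.

Lemma C1_real_zero (T : R) : C1_real T (fun _ => 0) (fun _ => 0).
Proof.
split; [|split].
- intros t _. apply (is_derive_const (0 : R) t).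
- intros t. apply continuity_pt_const. now intros ? ?.
- exists 0. intros t _. rewrite Rabs_R0. lra.
Qed.

(** The coordinates of a point [r + expi a * s] attached to the solid: [(m, n)] is [(Re s, - Im s)]
    for the real part and [(Im s, Re s)] for the imaginary part. *)
Lemma C1_real_rotate (T m n : R) (x a dx da : R -> R) : C1_real T x dx -> C1_real T a da ->
  C1_real T (fun t => x t + (cos (a t) * m + sin (a t) * n))
    (fun t => dx t + da t * (- sin (a t) * m + cos (a t) * n)).
Proof.
intros [A1 [B1 [b1 C1]]] [A2 [B2 [b2 C2]]]. split; [|split].
- intros t Ht. assert (D1 := A1 t Ht). assert (D2 := A2 t Ht).
  apply (is_derive_plus x (fun t => cos (a t) * m + sin (a t) * n)); [exact D1|].
  replace (da t * (- sin (a t) * m + cos (a t) * n)) with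
    (scal (da t) (- sin (a t) * m + cos (a t) * n)) by reflexivity.
  apply (is_derive_comp (fun y => cos y * m + sin y * n) a); [|exact D2].
  auto_derive; [exact I|ring].
- intros t.
  apply (continuity_pt_plus (fun s => x (clamp T s))
    (fun s => cos (a (clamp T s)) * m + sin (a (clamp T s)) * n)); [apply B1|].
  apply (continuity_pt_comp (fun s => a (clamp T s)) (fun y => cos y * m + sin y * n)); [apply B2|].
  apply derivable_continuous_pt. exists (- sin (a (clamp T t)) * m + cos (a (clamp T t)) * n).
  apply is_derive_Reals. auto_derive; [exact I|ring].
- exists (b1 + b2 * (Rabs m + Rabs n)). intros t Ht. specialize (C1 t Ht). specialize (C2 t Ht).
  eapply Rle_trans; [apply Rabs_triang|]. apply Rplus_le_compat; [exact C1|].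
  rewrite Rabs_mult. apply Rmult_le_compat; try apply Rabs_pos; [exact C2|].
  eapply Rle_trans; [apply Rabs_triang|]. rewrite !Rabs_mult, Rabs_Ropp.
  assert (Rabs (sin (a t)) <= 1) by (apply Rabs_le; generalize (SIN_bound (a t)); lra).
  assert (Rabs (cos (a t)) <= 1) by (apply Rabs_le; generalize (COS_bound (a t)); lra).
  generalize (Rabs_pos m) (Rabs_pos n). nra.
Qed.

Lemma C1_real_bounded (T : R) (u du : R -> R) : 0 <= T -> C1_real T u du ->
  exists B, forall t, 0 <= t <= T -> Rabs (u t) <= B.
Proof.
intros HT [_ [Hcont _]].
destruct (continuity_ab_maj _ 0 T HT (fun t _ => Hcont t)) as [M [HM _]].
destruct (continuity_ab_min _ 0 T HT (fun t _ => Hcont t)) as [m [Hm0 _]].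
exists (Rabs (u (clamp T M)) + Rabs (u (clamp T m))). intros t Ht.
specialize (HM t Ht). specialize (Hm0 t Ht). simpl in HM, Hm0.
rewrite (clamp_id T t Ht) in HM, Hm0.
generalize (Rle_abs (u (clamp T M))) (Rabs_pos (u (clamp T m)))
  (Rabs_pos (u (clamp T M))) (Rle_abs (- u (clamp T m))).
rewrite Rabs_Ropp. intros. apply Rabs_le. lra.
Qed.

(** The sum of squares [E], unlike the sum of absolute values, is differentiable, and
    [E * exp (- 6 K t)] does not increase from its initial value 0. *)
Lemma gronwall_zero (T K : R) (A p q dA dp dq : R -> R) :
  0 <= T -> 0 <= K -> C1_real T A dA -> C1_real T p dp -> C1_real T q dq ->
  A 0 = 0 -> p 0 = 0 -> q 0 = 0 ->
  (forall t, 0 <= t <= T ->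
     Rabs (dA t) <= K * (Rabs (A t) + Rabs (p t) + Rabs (q t)) /\
     Rabs (dp t) <= K * (Rabs (A t) + Rabs (p t) + Rabs (q t)) /\
     Rabs (dq t) <= K * (Rabs (A t) + Rabs (p t) + Rabs (q t))) ->
  forall t, 0 <= t <= T -> A t = 0 /\ p t = 0 /\ q t = 0.
Proof.
intros HT HK [DA [CA _]] [Dp [Cp _]] [Dq [Cq _]] A0 p0 q0 Hb t Ht.
set (E := fun s => A s * A s + p s * p s + q s * q s).
set (dE := fun s => 2 * (A s * dA s + p s * dp s + q s * dq s)).
set (F := fun s => E s * exp (- (6 * K) * s)).
set (dF := fun s => (dE s - 6 * K * E s) * exp (- (6 * K) * s)).
(* The 6 comes from the factor 2 of the derivative of a square and from [(x + y + z) ^ 2 <= 3 * (x ^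
   2 + y ^ 2 + z ^ 2)]. *)
assert (HdE : forall s, 0 <= s <= T -> dE s <= 6 * K * E s).
{ intros s Hs. destruct (Hb s Hs) as [b1 [b2 b3]]. unfold dE, E.
  set (e := Rabs (A s) + Rabs (p s) + Rabs (q s)) in *.
  assert (Q : forall x y, Rabs y <= K * e -> x * y <= Rabs x * (K * e)).
  { intros x y Hy. eapply Rle_trans; [apply Rle_abs|]. rewrite Rabs_mult.
    apply Rmult_le_compat_l; [apply Rabs_pos|exact Hy]. }
  assert (Q1 := Q (A s) _ b1). assert (Q2 := Q (p s) _ b2). assert (Q3 := Q (q s) _ b3).
  assert (S : forall x, x * x = Rabs x * Rabs x).
  { intros x. rewrite <- Rabs_mult. symmetry. apply Rabs_pos_eq. nra. }
  rewrite (S (A s)), (S (p s)), (S (q s)).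
  unfold e in *. set (x := Rabs (A s)) in *. set (y := Rabs (p s)) in *. set (z := Rabs (q s)) in *.
  assert (K * ((x + y + z) * (x + y + z)) <= K * (3 * (x * x + y * y + z * z))).
  { apply Rmult_le_compat_l; [exact HK|].
    generalize (pow2_ge_0 (x - y)) (pow2_ge_0 (y - z)) (pow2_ge_0 (x - z)). nra. }
  nra. }
assert (HE : E t = 0).
{ destruct (MVT_gen (fun s => F (clamp T s)) 0 t dF) as [c [Hc Heq]].
  - rewrite Rmin_left, Rmax_right by lra. intros s Hs.
    apply is_derive_ext_loc with F.
    { assert (He : 0 < Rmin s (T - s)) by (apply Rmin_glb_lt; lra).
      exists (mkposreal _ He). intros y By. change (Rabs (y - s) < Rmin s (T - s)) in By.
      apply Rmin_Rgt in By. destruct By as [B1 B2].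
      apply Rgt_lt in B1, B2. apply Rabs_def2 in B1, B2. rewrite clamp_id; [reflexivity|lra]. }
    assert (d1 := DA s ltac:(lra)). assert (d2 := Dp s ltac:(lra)).
    assert (d3 := Dq s ltac:(lra)). unfold F, dF, E, dE.
    auto_derive.
    + repeat split; eexists; eassumption.
    + replace (Derive (fun x : R => A x) s) with (dA s) by (symmetry; now apply is_derive_unique).
      replace (Derive (fun x : R => p x) s) with (dp s) by (symmetry; now apply is_derive_unique).
      replace (Derive (fun x : R => q x) s) with (dq s) by (symmetry; now apply is_derive_unique).
      ring.
  - intros s _. unfold F, E.
    apply (continuity_pt_mult (fun s => A (clamp T s) * A (clamp T s) +
       p (clamp T s) * p (clamp T s) + q (clamp T s) * q (clamp T s))
       (fun s => exp (- (6 * K) * clamp T s))).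
    + apply (continuity_pt_plus (fun s => A (clamp T s) * A (clamp T s) +
        p (clamp T s) * p (clamp T s)) (fun s => q (clamp T s) * q (clamp T s))).
      * apply (continuity_pt_plus (fun s => A (clamp T s) * A (clamp T s))
          (fun s => p (clamp T s) * p (clamp T s))).
        -- now apply (continuity_pt_mult (fun s => A (clamp T s)) (fun s => A (clamp T s))).
        -- now apply (continuity_pt_mult (fun s => p (clamp T s)) (fun s => p (clamp T s))).
      * now apply (continuity_pt_mult (fun s => q (clamp T s)) (fun s => q (clamp T s))).
    + apply (continuity_pt_comp (clamp T) (fun y => exp (- (6 * K) * y))).
      * apply continuity_pt_eps. intros eps Heps. exists eps. split; [exact Heps|].
        intros y By. eapply Rle_lt_trans; [apply clamp_Lipschitz|exact By].
      * apply derivable_continuous_pt. exists (- (6 * K) * exp (- (6 * K) * clamp T s)).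
        apply is_derive_Reals. auto_derive; [exact I|ring].
  - rewrite Rmin_left, Rmax_right in Hc by lra.
    rewrite !clamp_id in Heq by lra.
    assert (F0 : F 0 = 0) by (unfold F, E; rewrite A0, p0, q0; ring).
    assert (dFc : dF c <= 0).
    { unfold dF. specialize (HdE c ltac:(lra)). generalize (exp_pos (- (6 * K) * c)). nra. }
    assert (Ft : F t <= 0) by nra.
    unfold F in Ft. generalize (exp_pos (- (6 * K) * t)). intros.
    assert (0 <= E t) by (unfold E; nra). nra. }
unfold E in HE. repeat split; nra.
Qed.

(** * Observation of the twist *)


Definition tnorm (v : twist) : R := Cmod (fst v) + Rabs (snd v).

Lemma tnorm_pos (v : twist) : 0 <= tnorm v.
Proof. unfold tnorm. generalize (Cmod_ge_0 (fst v)) (Rabs_pos (snd v)). lra. Qed.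

Lemma tnorm_tadd (u v : twist) : tnorm (tadd u v) <= tnorm u + tnorm v.
Proof.
unfold tnorm, tadd. simpl.
generalize (Cmod_triangle (fst u) (fst v)) (Rabs_triang (snd u) (snd v)). lra.
Qed.

Lemma tnorm_tscal (k : R) (v : twist) : tnorm (tscal k v) = Rabs k * tnorm v.
Proof. unfold tnorm, tscal. simpl. rewrite Cmod_mult, Cmod_R, Rabs_mult. ring. Qed.

Lemma tnorm_tzero : tnorm tzero = 0.
Proof. unfold tnorm, tzero. simpl. rewrite Cmod_0, Rabs_R0. ring. Qed.

Definition coordinates : list (twist -> R) :=
  (fun v => Re (fst v)) :: (fun v => Im (fst v)) :: (fun v => snd v) :: nil.

Lemma coordinates_linear (W : twist -> Prop) (c : twist -> R) :
  In c coordinates -> linear_on W c.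
Proof.
intros [<-|[<-|[<-|[]]]]; split; intros; unfold tadd, tscal; simpl; unfold Re, Im; ring.
Qed.

Lemma coordinates_bound (c : twist -> R) (v : twist) :
  In c coordinates -> Rabs (c v) <= tnorm v.
Proof.
unfold tnorm. generalize (re_le_Cmod (fst v)) (im_le_Cmod (fst v)) (Rabs_pos (snd v)) (Cmod_ge_0 (fst v)).
intros ? ? ? ? [<-|[<-|[<-|[]]]]; simpl; lra.
Qed.

Lemma coordinates_separate (v : twist) : (forall c, In c coordinates -> c v = 0) -> v = tzero.
Proof.
intros H. apply twist_eq.
- apply (H (fun v => Re (fst v))). now left.
- apply (H (fun v => Im (fst v))). right; now left.
- apply (H (fun v => snd v)). right; right; now left.
Qed.

Section Observation.

Variables (S0 : C -> Prop) (f : C -> C).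
Hypothesis hS0 : is_shape S0 f.
Hypothesis hline : ~ on_line S0.
Hypothesis hcircle : ~ on_circle S0.

(** The domain on which twists and potentials correspond linearly and injectively: a potential must
    exist, and the spin of a disk, which no potential reveals, is excluded. *)
Definition admissible (v : twist) : Prop :=
  (is_disk S0 -> snd v = 0) /\ exists X, body_potential S0 (fst v) (snd v) X.

Definition potential_of (v : twist) : C -> C :=
  epsilon (inhabits (fun _ => RtoC 0)) (fun X => body_potential S0 (fst v) (snd v) X).

Lemma potential_of_spec (v : twist) :
  admissible v -> body_potential S0 (fst v) (snd v) (potential_of v).
Proof. intros [_ H]. exact (epsilon_spec _ _ H). Qed.

Lemma potential_of_unique (v : twist) (X : C -> C) (y : C) :
  body_potential S0 (fst v) (snd v) X -> (is_disk S0 -> snd v = 0) -> ~ S0 y ->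
  potential_of v y = X y.
Proof.
intros HX Hd Hy. apply (body_potential_unique S0 f (fst v) (snd v)); auto.
apply potential_of_spec. split; [exact Hd|now exists X].
Qed.

Lemma admissible_subspace : subspace admissible.
Proof.
split; [|split].
- split; [reflexivity|]. exists (fun _ => RtoC 0). split; [|split].
  + intros y _. apply cdiff_const.
  + intros eps Heps. exists 0. intros z _. now rewrite Cmod_0.
  + exists 0. intros q _ eps Heps. exists 1. split; [lra|]. intros y _ _.
    unfold stream, tzero. simpl.
    match goal with |- Rabs ?x < _ => replace x with 0 by field end. now rewrite Rabs_R0.
- intros u v [Hu [X HX]] [Hv [Y HY]]. split.
  + intros h. simpl. rewrite (Hu h), (Hv h). ring.
  + exists (fun y => (X y + Y y)%C). now apply body_potential_plus.
- intros k u [Hu [X HX]]. split.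
  + intros h. simpl. rewrite (Hu h). ring.
  + exists (fun y => (RtoC k * X y)%C). now apply body_potential_scal.
Qed.

Lemma potential_of_tadd (u v : twist) (y : C) : admissible u -> admissible v -> ~ S0 y ->
  potential_of (tadd u v) y = (potential_of u y + potential_of v y)%C.
Proof.
intros Hu Hv Hy.
apply (potential_of_unique (tadd u v) (fun y => (potential_of u y + potential_of v y)%C)).
- apply body_potential_plus; now apply potential_of_spec.
- now apply admissible_subspace.
- exact Hy.
Qed.

Lemma potential_of_tscal (k : R) (u : twist) (y : C) : admissible u -> ~ S0 y ->
  potential_of (tscal k u) y = (RtoC k * potential_of u y)%C.
Proof.
intros Hu Hy.
apply (potential_of_unique (tscal k u) (fun y => (RtoC k * potential_of u y)%C)).
- apply body_potential_scal; now apply potential_of_spec.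
- now apply admissible_subspace.
- exact Hy.
Qed.

Lemma potential_of_tzero (y : C) : ~ S0 y -> potential_of tzero y = RtoC 0.
Proof.
intros Hy. replace tzero with (tscal 0 tzero) by tring.
rewrite potential_of_tscal; [ring|apply admissible_subspace|exact Hy].
Qed.

(** [L] and [d] do not depend on the twist: a dual basis for the coordinates writes every admissible
    [v] through finitely many fixed twists, with coefficients bounded by [tnorm v]. *)
Lemma potential_of_Lipschitz (y0 : C) : ~ S0 y0 -> exists L d, 0 <= L /\ 0 < d /\
  forall v y, admissible v -> Cmod (y - y0) < d ->
    Cmod (potential_of v y - potential_of v y0) <= L * tnorm v * Cmod (y - y0).
Proof.
intros Hy0. destruct (shape_open S0 f hS0 y0 Hy0) as [d0 [Hd0 Hball]].
destruct (dual_basis (fun c => In c coordinates) coordinates admissible) as [us [Hus Hv]].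
- apply admissible_subspace.
- intros c. apply coordinates_linear.
- intros c. apply coordinates_linear.
- intros v _. apply coordinates_separate.
- intros v _. apply coordinates_separate.
- assert (H : exists L d, 0 <= L /\ 0 < d /\ forall v y, Cmod (y - y0) < d ->
    Cmod (potential_of (combination us v) y - potential_of (combination us v) y0)
      <= L * tnorm v * Cmod (y - y0)).
  (* Reconstruction holds for the complete list only, so the induction estimates partial
     combinations and the identity [v = combination us v] is used afterwards. *)
  { clear Hv. induction us as [|p us IH].
    - exists 0, d0. split; [lra|]. split; [exact Hd0|]. intros v y Hy. simpl.
      rewrite !potential_of_tzero by auto. replace (0 - 0)%C with (RtoC 0) by ring.
      rewrite Cmod_0. lra.
    - destruct IH as [L [d [HL [Hd IH]]]]; [intros q Hq; apply Hus; now right|].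
      destruct (Hus p (or_introl eq_refl)) as [Hc Hp].
      destruct (cdiff_lip (potential_of (snd p)) y0) as [L' [d' [HL' [Hd' H']]]].
      { apply (potential_of_spec (snd p) Hp). exact Hy0. }
      exists (L + L'), (Rmin d0 (Rmin d d')). split; [lra|].
      split; [repeat apply Rmin_glb_lt; assumption|]. intros v y Hy.
      apply Rmin_Rgt in Hy. destruct Hy as [Y1 Y2].
      apply Rmin_Rgt in Y2. destruct Y2 as [Y2 Y3].
      simpl. assert (Ac : admissible (combination us v)).
      { apply combination_in; [apply admissible_subspace|].
        intros q Hq. apply Hus. now right. }
      assert (As : admissible (tscal (fst p v) (snd p))) by now apply admissible_subspace.
      assert (Hy : ~ S0 y) by now apply Hball.
      rewrite !potential_of_tadd, !potential_of_tscal by assumption.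
      set (k := fst p v).
      replace (RtoC k * potential_of (snd p) y + potential_of (combination us v) y -
        (RtoC k * potential_of (snd p) y0 + potential_of (combination us v) y0))%C with
        ((potential_of (combination us v) y - potential_of (combination us v) y0) +
         RtoC k * (potential_of (snd p) y - potential_of (snd p) y0))%C by ring.
      eapply Rle_trans; [apply Cmod_triangle|]. rewrite Cmod_mult, Cmod_R.
      specialize (IH v y Y2). specialize (H' y Y3).
      assert (Hk : Rabs k <= tnorm v) by now apply coordinates_bound.
      assert (Rabs k * Cmod (potential_of (snd p) y - potential_of (snd p) y0) <=
        tnorm v * (L' * Cmod (y - y0))).
      { apply Rmult_le_compat; [apply Rabs_pos|apply Cmod_ge_0|exact Hk|exact H']. }
      lra. }
  destruct H as [L [d [HL [Hd H]]]]. exists L, d. split; [exact HL|]. split; [exact Hd|].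
  intros v y Av Hy. specialize (H v y Hy). now rewrite <- (Hv v Av) in H.
Qed.

(** Finitely many values [Re (lam * X y)] with [rho0 < Cmod y] reconstruct a twist. On [v1 - v2]
    each of them is the change of the potential of [v2] between [y] and [y'], controlled by its
    Lipschitz bound. The factor [1 + Cmod y] allows for rotations, which displace far points
    more. *)
Lemma displaced_potential_estimate (rho0 : R) : (forall y, S0 y -> Cmod y <= rho0) ->
  exists K d, 0 <= K /\ 0 < d /\ forall v1 v2 eta, admissible v1 -> admissible v2 ->
    0 <= eta <= d ->
    (forall y, rho0 < Cmod y -> exists y', Cmod (y' - y) <= eta * (1 + Cmod y) /\
       potential_of v1 y = potential_of v2 y') ->
    tnorm (tadd v1 (tscal (-1) v2)) <= K * eta * tnorm v2.
Proof.
intros Hrho.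
assert (Hout : forall y, rho0 < Cmod y -> ~ S0 y).
{ intros y Hy Sy. specialize (Hrho y Sy). lra. }
set (L := fun l : twist -> R => exists y lam, rho0 < Cmod y /\ Cmod lam = 1 /\
  forall v, l v = Re (lam * potential_of v y)%C).
destruct (dual_basis L coordinates admissible) as [us [Hus Hv]].
- apply admissible_subspace.
- intros c. apply coordinates_linear.
- intros l [y [lam [Hy [_ E]]]]. split.
  + intros u v Hu Hw. rewrite !E, potential_of_tadd by auto.
    destruct lam, (potential_of u y), (potential_of v y). simpl. ring.
  + intros k u Hu. rewrite !E, potential_of_tscal by auto.
    destruct lam, (potential_of u y). simpl. ring.
- intros v _. apply coordinates_separate.
- intros v Av Hl.
  assert (Z : forall y, ~ S0 y -> potential_of v y = RtoC 0).
  { apply (exterior_zero S0 f _ rho0 hS0); [apply (potential_of_spec v Av)|].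
    intros y Hy. destruct (Cmod_as_Re (potential_of v y)) as [lam [Hlam E]].
    apply Cmod_eq_0. rewrite <- E. apply (Hl (fun v => Re (lam * potential_of v y)%C)).
    now exists y, lam. }
  destruct (body_potential_separates S0 f hS0 hline hcircle (fst v) (snd v) (potential_of v))
    as [E1 E2].
  + apply Av.
  + now apply potential_of_spec.
  + exact Z.
  + apply twist_eq; rewrite ?E1, ?E2; reflexivity.
- assert (H : exists K d, 0 <= K /\ 0 < d /\ forall v1 v2 eta,
    admissible v1 -> admissible v2 -> 0 <= eta <= d ->
    (forall y, rho0 < Cmod y -> exists y', Cmod (y' - y) <= eta * (1 + Cmod y) /\
       potential_of v1 y = potential_of v2 y') ->
    tnorm (combination us (tadd v1 (tscal (-1) v2))) <= K * eta * tnorm v2).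
  { clear Hv. induction us as [|p us IH].
    - exists 0, 1. split; [lra|]. split; [lra|]. intros. simpl. rewrite tnorm_tzero. lra.
    - destruct IH as [K [d [HK [Hd IH]]]]; [intros q Hq; apply Hus; now right|].
      destruct (Hus p (or_introl eq_refl)) as [[y [lam [Hy [Hlam E]]]] Hp].
      destruct (potential_of_Lipschitz y (Hout y Hy)) as [L' [d' [HL' [Hd' H']]]].
      assert (Hy1 : 0 < 1 + Cmod y) by (generalize (Cmod_ge_0 y); lra).
      (* The second witness keeps [y'] strictly within distance [d'] of [y], where the Lipschitz
         bound is valid. *)
      exists (K + L' * (1 + Cmod y) * tnorm (snd p)), (Rmin d (d' / (1 + Cmod y) / 2)).
      assert (Hd'' : 0 < d' / (1 + Cmod y)) by now apply Rdiv_lt_0_compat.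
      split. { assert (T := tnorm_pos (snd p)). assert (0 <= L' * (1 + Cmod y)) by nra. nra. }
      split; [apply Rmin_glb_lt; lra|]. intros v1 v2 eta A1 A2 Heta Hdis.
      assert (m1 := Rmin_l d (d' / (1 + Cmod y) / 2)).
      assert (m2 := Rmin_r d (d' / (1 + Cmod y) / 2)).
      simpl. eapply Rle_trans; [apply tnorm_tadd|]. rewrite tnorm_tscal.
      specialize (IH v1 v2 eta A1 A2 ltac:(lra) Hdis).
      destruct (Hdis y Hy) as [y' [Hy' Ey']].
      assert (Hsmall : Cmod (y' - y) < d').
      { eapply Rle_lt_trans; [exact Hy'|].
        apply Rmult_lt_reg_r with (/ (1 + Cmod y)); [now apply Rinv_0_lt_compat|].
        replace (eta * (1 + Cmod y) * / (1 + Cmod y)) with eta by (field; lra).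
        unfold Rdiv in *. lra. }
      specialize (H' v2 y' A2 Hsmall).
      assert (Hl : Rabs (fst p (tadd v1 (tscal (-1) v2))) <=
        L' * tnorm v2 * (eta * (1 + Cmod y))).
      { rewrite E. eapply Rle_trans; [apply re_le_Cmod|]. rewrite Cmod_mult, Hlam, Rmult_1_l.
        rewrite potential_of_tadd, potential_of_tscal; auto;
          [|now apply admissible_subspace].
        rewrite Ey'.
        replace (potential_of v2 y' + RtoC (-1) * potential_of v2 y)%C with
          (potential_of v2 y' - potential_of v2 y)%C by ring.
        eapply Rle_trans; [exact H'|].
        apply Rmult_le_compat_l; [|exact Hy'].
        generalize (tnorm_pos v2). nra. }
      assert (T := tnorm_pos (snd p)).
      assert (Rabs (fst p (tadd v1 (tscal (-1) v2))) * tnorm (snd p) <=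
        L' * tnorm v2 * (eta * (1 + Cmod y)) * tnorm (snd p)) by nra.
      lra. }
  destruct H as [K [d [HK [Hd H]]]]. exists K, d. split; [exact HK|]. split; [exact Hd|].
  intros v1 v2 eta A1 A2 Heta Hdis. specialize (H v1 v2 eta A1 A2 Heta Hdis).
  rewrite <- Hv in H; [exact H|].
  apply admissible_subspace; [exact A1|now apply admissible_subspace].
Qed.

End Observation.

Lemma derivative_bound_Lipschitz (g dg : R -> R) (a b : R) :
  (forall x, is_derive g x (dg x)) -> (forall x, Rabs (dg x) <= 1) ->
  Rabs (g a - g b) <= Rabs (a - b).
Proof.
intros Hd Hb. destruct (MVT_gen g b a dg) as [c [_ E]].
- intros x _. apply Hd.
- intros x _. apply derivable_continuous_pt. exists (dg x). apply is_derive_Reals, Hd.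
- rewrite E, Rabs_mult. generalize (Hb c) (Rabs_pos (a - b)). nra.
Qed.

Lemma expi_Lipschitz (a b : R) : Cmod (expi a - expi b) <= 2 * Rabs (a - b).
Proof.
eapply Rle_trans; [apply Cmod_le_abs|]. unfold expi. simpl.
assert (Rabs (cos a - cos b) <= Rabs (a - b)).
{ apply (derivative_bound_Lipschitz cos (fun x => - sin x)).
  - intros x. auto_derive; [exact I|ring].
  - intros x. rewrite Rabs_Ropp. apply Rabs_le. generalize (SIN_bound x). lra. }
assert (Rabs (sin a - sin b) <= Rabs (a - b)).
{ apply (derivative_bound_Lipschitz sin cos).
  - intros x. auto_derive; [exact I|ring].
  - intros x. apply Rabs_le. generalize (COS_bound x). lra. }
unfold Rminus in *. lra.
Qed.

(** * Uniqueness of the motion *)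


Lemma expi_cancel (a : R) (z : C) : (expi a * (expi (- a) * z))%C = z.
Proof.
replace (expi a * (expi (- a) * z))%C with (expi (- a) * expi a * z)%C by ring.
rewrite expi_opp. ring.
Qed.

Section Core.

Variables (S0 : C -> Prop) (f : C -> C).
Hypothesis hS0 : is_shape S0 f.
Hypothesis hline : ~ on_line S0.
Hypothesis hcircle : ~ on_circle S0.
Variables (T : R) (a1 a2 da1 da2 : R -> R) (r1 r2 dr1 dr2 : R -> C) (X1 X2 : R -> C -> C).
Hypothesis hT : 0 <= T.
Hypothesis ha1 : C1_real T a1 da1.
Hypothesis ha2 : C1_real T a2 da2.
Hypothesis hp1 : C1_real T (fun t => Re (r1 t)) (fun t => Re (dr1 t)).
Hypothesis hp2 : C1_real T (fun t => Re (r2 t)) (fun t => Re (dr2 t)).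
Hypothesis hq1 : C1_real T (fun t => Im (r1 t)) (fun t => Im (dr1 t)).
Hypothesis hq2 : C1_real T (fun t => Im (r2 t)) (fun t => Im (dr2 t)).
Hypothesis hdisk : forall t, 0 <= t <= T -> is_disk S0 -> da1 t = 0 /\ da2 t = 0.
Hypothesis hX1 : forall t, 0 <= t <= T ->
  body_potential S0 (expi (- a1 t) * dr1 t)%C (da1 t) (X1 t).
Hypothesis hX2 : forall t, 0 <= t <= T ->
  body_potential S0 (expi (- a2 t) * dr2 t)%C (da2 t) (X2 t).
Hypothesis ha0 : a1 0 = a2 0.
Hypothesis hr0 : r1 0 = r2 0.
(** The argument of [X2] is the label, in the second body frame, of the place that has label [y] in
    the first: both potentials are the same function in the fixed frame. *)
Hypothesis hmeas : forall t, 0 <= t <= T -> exists M, forall y, M < Cmod y ->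
  X1 t y = X2 t (expi (a1 t - a2 t) * y + expi (- a2 t) * (r1 t - r2 t))%C.

Let twist1 (t : R) : twist := ((expi (- a1 t) * dr1 t)%C, da1 t).
Let twist2 (t : R) : twist := ((expi (- a2 t) * dr2 t)%C, da2 t).
Let gap (t : R) : R :=
  Rabs (a1 t - a2 t) + Rabs (Re (r1 t) - Re (r2 t)) + Rabs (Im (r1 t) - Im (r2 t)).

Lemma bounded_C (r dr : R -> C) :
  C1_real T (fun t => Re (r t)) (fun t => Re (dr t)) ->
  C1_real T (fun t => Im (r t)) (fun t => Im (dr t)) ->
  exists B, forall t, 0 <= t <= T -> Cmod (r t) <= B /\ Cmod (dr t) <= B.
Proof.
intros Hp Hq.
destruct (C1_real_bounded T _ _ hT Hp) as [B1 H1]. destruct (C1_real_bounded T _ _ hT Hq) as [B2 H2].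
destruct Hp as [_ [_ [B3 H3]]]. destruct Hq as [_ [_ [B4 H4]]].
exists (Rmax (B1 + B2) (B3 + B4)). intros t Ht.
specialize (H1 t Ht). specialize (H2 t Ht). specialize (H3 t Ht). specialize (H4 t Ht).
simpl in *. split; eapply Rle_trans; [|apply Rmax_l| |apply Rmax_r];
  (eapply Rle_trans; [apply Cmod_le_abs|lra]).
Qed.

Lemma twist_admissible (t : R) : 0 <= t <= T ->
  admissible S0 (twist1 t) /\ admissible S0 (twist2 t).
Proof.
intros Ht. split; split; try (intros h; now apply hdisk).
- exists (X1 t). now apply hX1.
- exists (X2 t). now apply hX2.
Qed.

Lemma Cmod_r_gap (t : R) : Cmod (r1 t - r2 t) <= gap t.
Proof.
eapply Rle_trans; [apply Cmod_le_abs|]. unfold gap. simpl.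
generalize (Rabs_pos (a1 t - a2 t)). unfold Rminus, Re, Im. lra.
Qed.

(** The Lipschitz dependence of the twist on the position that Gronwall's lemma requires. [K] is
    uniform in time since the measuring points depend on the shape and on [rho0] alone. *)
Lemma twist_gap_estimate : exists K, 0 <= K /\ forall t, 0 <= t <= T ->
  tnorm (tadd (twist1 t) (tscal (-1) (twist2 t))) <= K * gap t /\ Cmod (fst (twist2 t)) <= K.
Proof.
destruct (bounded_C r1 dr1 hp1 hq1) as [R1 HR1].
destruct (bounded_C r2 dr2 hp2 hq2) as [R2 HR2].
destruct (shape_bounded S0 f hS0) as [B [HB0 HB]].
assert (HR1p : 0 <= R1).
{ eapply Rle_trans; [apply Cmod_ge_0|apply (HR1 0); lra]. }
assert (HR2p : 0 <= R2).
{ eapply Rle_trans; [apply Cmod_ge_0|apply (HR2 0); lra]. }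
(* Large enough that a point beyond [rho0] is outside the solid in the first body frame and still so
   after passage to the second, a rotation followed by a shift of at most [R1 + R2]. *)
set (rho0 := B + (R1 + R2)).
destruct (displaced_potential_estimate S0 f hS0 hline hcircle rho0) as [K [d [HK [Hd H]]]].
{ intros y Hy. specialize (HB y Hy). unfold rho0. lra. }
destruct ha1 as [_ [_ [D1 HD1]]]. destruct ha2 as [_ [_ [D2 HD2]]].
assert (HD1p : 0 <= D1).
{ eapply Rle_trans; [apply Rabs_pos|apply (HD1 0); lra]. }
assert (HD2p : 0 <= D2).
{ eapply Rle_trans; [apply Rabs_pos|apply (HD2 0); lra]. }
assert (N1 : forall t, 0 <= t <= T -> tnorm (twist1 t) <= R1 + D1).
{ intros t Ht. unfold tnorm, twist1. simpl. rewrite Cmod_mult, Cmod_expi.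
  destruct (HR1 t Ht). specialize (HD1 t Ht). lra. }
assert (N2 : forall t, 0 <= t <= T -> tnorm (twist2 t) <= R2 + D2).
{ intros t Ht. unfold tnorm, twist2. simpl. rewrite Cmod_mult, Cmod_expi.
  destruct (HR2 t Ht). specialize (HD2 t Ht). lra. }
set (Bv := R1 + D1 + (R2 + D2)).
assert (HBv : 0 <= Bv) by (unfold Bv; lra).
assert (Hgap : forall t, 0 <= gap t).
{ intros t. unfold gap. generalize (Rabs_pos (a1 t - a2 t))
    (Rabs_pos (Re (r1 t) - Re (r2 t))) (Rabs_pos (Im (r1 t) - Im (r2 t))). lra. }
assert (Hdd : 0 <= 2 * Bv / d) by (apply Rmult_le_pos; [lra|left; now apply Rinv_0_lt_compat]).
exists (2 * K * Bv + 2 * Bv / d + Bv). split; [nra|]. intros t Ht. split.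
2:{ assert (Cmod (fst (twist2 t)) <= tnorm (twist2 t)).
    { unfold tnorm. generalize (Rabs_pos (snd (twist2 t))). lra. }
    specialize (N2 t Ht). assert (0 <= 2 * K * Bv) by nra. unfold Bv in *. lra. }
destruct (twist_admissible t Ht) as [A1 A2].
specialize (N1 t Ht). specialize (N2 t Ht). specialize (Hgap t).
(* For a small gap the displacement estimate applies, with factor 2 from [expi_Lipschitz]. For a
   large gap the bound [Bv] on the twists is itself at most [2 * Bv / d * gap t]. *)
destruct (Rle_or_lt (2 * gap t) d) as [Hs|Hl].
- assert (E : tnorm (tadd (twist1 t) (tscal (-1) (twist2 t))) <=
    K * (2 * gap t) * tnorm (twist2 t)).
  { apply H; [exact A1|exact A2|lra|]. intros y Hy.
    set (sig := fun y => (expi (a1 t - a2 t) * y + expi (- a2 t) * (r1 t - r2 t))%C).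
    assert (Hsig : forall y, rho0 < Cmod y -> ~ S0 (sig y)).
    { intros z Hz Sz. specialize (HB _ Sz).
      generalize (Cmod_triangle_inv (expi (a1 t - a2 t) * z)
        (- (expi (- a2 t) * (r1 t - r2 t)))).
      replace (expi (a1 t - a2 t) * z - - (expi (- a2 t) * (r1 t - r2 t)))%C
        with (sig z) by (unfold sig; ring).
      rewrite Cmod_opp, !Cmod_mult, !Cmod_expi.
      generalize (Cmod_sub_le (r1 t) (r2 t)). destruct (HR1 t Ht), (HR2 t Ht).
      unfold rho0 in Hz. lra. }
    exists (sig y). split.
    - replace (sig y - y)%C with
        ((expi (a1 t - a2 t) - expi 0) * y + expi (- a2 t) * (r1 t - r2 t))%C
        by (rewrite expi_0; unfold sig; ring).
      eapply Rle_trans; [apply Cmod_triangle|]. rewrite !Cmod_mult, Cmod_expi.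
      generalize (expi_Lipschitz (a1 t - a2 t) 0) (Cmod_r_gap t) (Cmod_ge_0 y).
      rewrite Rminus_0_r. intros h1 h2 h3.
      assert (Rabs (a1 t - a2 t) <= gap t).
      { unfold gap. generalize (Rabs_pos (Re (r1 t) - Re (r2 t)))
          (Rabs_pos (Im (r1 t) - Im (r2 t))). lra. }
      nra.
    - assert (Hout : forall z, rho0 < Cmod z -> ~ S0 z).
      { intros z Hz Sz. specialize (HB z Sz). unfold rho0 in Hz. lra. }
      rewrite (potential_of_unique S0 f hS0 (twist1 t) (X1 t) y (hX1 t Ht) (proj1 A1) (Hout y Hy)).
      rewrite (potential_of_unique S0 f hS0 (twist2 t) (X2 t) _ (hX2 t Ht) (proj1 A2) (Hsig y Hy)).
      destruct (hmeas t Ht) as [M HM].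
      (* The measurement gives equality only beyond a radius [M] depending on [t]; the identity
         theorem extends it to all points beyond [rho0]. *)
      assert (Z : (X1 t y - X2 t (sig y))%C = RtoC 0).
      { apply (exterior_identity (fun y => (X1 t y - X2 t (sig y))%C) rho0 M).
        - intros z Hz. apply cdiff_minus; [apply (hX1 t Ht), Hout, Hz|].
          apply (cdiff_comp (X2 t) sig); [apply (hX2 t Ht), Hsig, Hz|apply cdiff_affine].
        - intros z Hz. rewrite (HM z Hz). fold (sig z). ring.
        - exact Hy.
        - unfold rho0 in Hy. lra. }
      replace (X1 t y) with ((X1 t y - X2 t (sig y)) + X2 t (sig y))%C by ring.
      rewrite Z. ring. }
  eapply Rle_trans; [exact E|]. apply Rle_trans with (K * (2 * gap t) * Bv).
  + apply Rmult_le_compat_l; [nra|unfold Bv; lra].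
  + assert (0 <= (2 * Bv / d + Bv) * gap t) by (apply Rmult_le_pos; lra). lra.
- apply Rle_trans with Bv.
  + eapply Rle_trans; [apply tnorm_tadd|]. rewrite tnorm_tscal, Rabs_left by lra.
    unfold Bv. lra.
  + assert (Bv <= 2 * Bv / d * gap t).
    { replace (2 * Bv / d * gap t) with (Bv * (2 * gap t / d)) by (field; lra).
      assert (1 <= 2 * gap t / d) by (apply Rle_div_r; lra). nra. }
    assert (0 <= (2 * K * Bv + Bv) * gap t) by (apply Rmult_le_pos; nra). lra.
Qed.

Lemma dr_difference (t : R) : 
  Cmod (dr1 t - dr2 t) <= tnorm (tadd (twist1 t) (tscal (-1) (twist2 t))) +
    2 * Rabs (a1 t - a2 t) * Cmod (fst (twist2 t)).
Proof.
replace (dr1 t - dr2 t)%C with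
  (expi (a1 t) * (fst (twist1 t) - fst (twist2 t)) +
   (expi (a1 t) - expi (a2 t)) * fst (twist2 t))%C.
2:{ unfold twist1, twist2. simpl.
    transitivity (expi (a1 t) * (expi (- a1 t) * dr1 t) -
      expi (a2 t) * (expi (- a2 t) * dr2 t))%C; [ring|now rewrite !expi_cancel]. }
eapply Rle_trans; [apply Cmod_triangle|]. rewrite !Cmod_mult, Cmod_expi.
apply Rplus_le_compat.
- unfold tnorm, tadd, tscal. cbn [fst snd].
  replace (fst (twist1 t) + RtoC (-1) * fst (twist2 t))%C
    with (fst (twist1 t) - fst (twist2 t))%C by ring.
  generalize (Rabs_pos (snd (twist1 t) + -1 * snd (twist2 t))). lra.
- apply Rmult_le_compat_r; [apply Cmod_ge_0|apply expi_Lipschitz].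
Qed.

Lemma motion_unique (t : R) : 0 <= t <= T ->
  a1 t = a2 t /\ r1 t = r2 t /\ da1 t = da2 t /\ dr1 t = dr2 t.
Proof.
destruct twist_gap_estimate as [K [HK H]].
(* One [K * gap s] comes from the twists, and two more from turning the body-frame velocity by
   different angles. *)
assert (Hda : forall s, 0 <= s <= T -> Rabs (da1 s - da2 s) <= 3 * K * gap s /\
  Cmod (dr1 s - dr2 s) <= 3 * K * gap s).
{ intros s Hs. destruct (H s Hs) as [H1 H2].
  assert (Hg : 0 <= gap s) by (eapply Rle_trans; [apply Cmod_ge_0|apply Cmod_r_gap]).
  assert (Hag : 0 <= Rabs (a1 s - a2 s) <= gap s).
  { unfold gap. generalize (Rabs_pos (a1 s - a2 s)) (Rabs_pos (Re (r1 s) - Re (r2 s)))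
      (Rabs_pos (Im (r1 s) - Im (r2 s))). lra. }
  assert (HKg : 0 <= K * gap s) by nra. split.
  - assert (Rabs (da1 s - da2 s) <= tnorm (tadd (twist1 s) (tscal (-1) (twist2 s)))).
    { unfold tnorm, tadd, tscal. simpl.
      replace (da1 s + -1 * da2 s) with (da1 s - da2 s) by ring.
      match goal with |- _ <= Cmod ?z + _ => generalize (Cmod_ge_0 z) end. lra. }
    lra.
  - eapply Rle_trans; [apply dr_difference|].
    assert (Rabs (a1 s - a2 s) * Cmod (fst (twist2 s)) <= gap s * K).
    { apply Rmult_le_compat; [lra|apply Cmod_ge_0|lra|exact H2]. }
    lra. }
intros Ht.
destruct (gronwall_zero T (3 * K) (fun t => a1 t - a2 t) (fun t => Re (r1 t) - Re (r2 t))
  (fun t => Im (r1 t) - Im (r2 t)) (fun t => da1 t - da2 t) (fun t => Re (dr1 t) - Re (dr2 t))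
  (fun t => Im (dr1 t) - Im (dr2 t))) with (t := t) as [E1 [E2 E3]]; try assumption.
- lra.
- now apply C1_real_minus.
- now apply C1_real_minus.
- now apply C1_real_minus.
- rewrite ha0. ring.
- rewrite hr0. ring.
- rewrite hr0. ring.
- intros s Hs. destruct (Hda s Hs) as [h1 h2]. fold (gap s). split; [exact h1|].
  split; (eapply Rle_trans; [|exact h2]).
  + exact (re_le_Cmod (dr1 s - dr2 s)).
  + exact (im_le_Cmod (dr1 s - dr2 s)).
- assert (Hg : gap t = 0).
  { unfold gap. simpl in E1, E2, E3. rewrite E1, E2, E3, Rabs_R0. ring. }
  destruct (Hda t Ht) as [h1 h2]. rewrite Hg, Rmult_0_r in h1, h2. simpl in E1, E2, E3.
  split; [lra|]. split; [apply C_eq; lra|]. split.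
  + generalize (Rabs_pos (da1 t - da2 t)). intros.
    destruct (Req_dec (da1 t - da2 t) 0) as [h|h]; [lra|]. apply Rabs_pos_lt in h. lra.
  + assert (Z : (dr1 t - dr2 t)%C = RtoC 0).
    { apply Cmod_eq_0. generalize (Cmod_ge_0 (dr1 t - dr2 t)). lra. }
    replace (dr1 t) with ((dr1 t - dr2 t) + dr2 t)%C by ring. rewrite Z. ring.
Qed.

End Core.

Lemma disk_center_unique (c1 c2 : C) (rho : R) : 0 <= rho ->
  (forall x, Cmod (x - c1) <= rho <-> Cmod (x - c2) <= rho) -> c1 = c2.
Proof.
intros Hr H. apply NNPP. intros Hne.
assert (Hm : 0 < Cmod (c1 - c2)).
{ apply Cmod_gt_0. intros E. apply Hne. replace c1 with ((c1 - c2) + c2)%C by ring.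
  rewrite E. ring. }
(* The point [c1 + k (c1 - c2)] of the first disk is the farthest from [c2], at distance
   [rho + m]. *)
set (m := Cmod (c1 - c2)) in *. set (k := rho / m).
assert (Hk : 0 <= k) by (apply Rmult_le_pos; [exact Hr|left; now apply Rinv_0_lt_compat]).
assert (Ek : k * m = rho) by (unfold k; field; lra).
assert (H1 : Cmod (c1 + RtoC k * (c1 - c2) - c1) <= rho).
{ replace (c1 + RtoC k * (c1 - c2) - c1)%C with (RtoC k * (c1 - c2))%C by ring.
  rewrite Cmod_mult, Cmod_R, Rabs_pos_eq by exact Hk. fold m. lra. }
apply H in H1.
replace (c1 + RtoC k * (c1 - c2) - c2)%C with (RtoC (1 + k) * (c1 - c2))%C in H1
  by (rewrite RtoC_plus; ring).
rewrite Cmod_mult, Cmod_R, Rabs_pos_eq in H1 by lra. fold m in H1. lra.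
Qed.

Lemma rigid_C1 (T : R) (s k : C) (r dr : R -> C) (a da : R -> R) : 0 <= T ->
  C1_on (V := C_R_NormedModule) T r dr -> C1_on (V := R_NormedModule) T a da ->
  C1_real T (fun t => Re (r t + expi (a t) * s + k)%C)
    (fun t => Re (dr t + Ci * RtoC (da t) * (expi (a t) * s))%C) /\
  C1_real T (fun t => Im (r t + expi (a t) * s + k)%C)
    (fun t => Im (dr t + Ci * RtoC (da t) * (expi (a t) * s))%C).
Proof.
intros HT Hr Ha. apply C1_on_R in Ha; [|exact HT].
assert (P := C1_real_shift T (Re k) _ _
  (C1_real_rotate T (Re s) (- Im s) _ _ _ _ (C1_on_Re T r dr HT Hr) Ha)).
assert (Q := C1_real_shift T (Im k) _ _
  (C1_real_rotate T (Im s) (Re s) _ _ _ _ (C1_on_Im T r dr HT Hr) Ha)).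
assert (ext : forall u u' du du', C1_real T u du -> (forall t, u t = u' t) ->
  (forall t, du t = du' t) -> C1_real T u' du').
{ intros u u' du du' [H1 [H2 [B H3]]] E1 E2. split; [|split].
  - intros t Ht. rewrite <- E2. apply is_derive_ext with u; [exact E1|auto].
  - intros t. apply continuity_pt_ext with (fun s => u (clamp T s)); [intros; apply E1|auto].
  - exists B. intros t Ht. rewrite <- E2. auto. }
split.
- apply (ext _ _ _ _ P); intros t; destruct (r t), (dr t), s, k; simpl; ring.
- apply (ext _ _ _ _ Q); intros t; destruct (r t), (dr t), s, k; simpl; ring.
Qed.

(* A disk may be considered as moving without rotation, its reference point being
   [r + expi a * p - p]. *)
Lemma disk_body_potential (S0 : C -> Prop) (f : C -> C) (p r w : C) (rho a om : R)
    (xi : C -> C) :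
  is_shape S0 f -> (forall z, S0 z <-> Cmod (z - p) <= rho) ->
  is_complex_potential S0 f a r w om xi ->
  body_potential S0 (w + Ci * RtoC om * (expi a * p))%C 0
    (fun y => xi (expi a * (expi (- a) * y + (p - expi (- a) * p)) + r)%C).
Proof.
intros Hs Hd Hxi.
assert (H := body_potential_intro S0 f a r w om xi Hs Hxi).
(* This symmetry is the rotation by [- a] about the centre [p]; it undoes the rotation of the body
   axes. *)
apply body_potential_rigid with (b := - a) (s := (p - expi (- a) * p)%C) in H.
- apply (body_potential_disk _ p _ rho) in H; [|exact Hd].
  rewrite Ropp_involutive in H.
  match type of H with body_potential _ ?u _ _ =>
    replace (w + Ci * RtoC om * (expi a * p))%C with u; [exact H|] end.
  transitivity ((expi a * (expi (- a) * w)) + Ci * RtoC om * (expi a * p)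
    - Ci * RtoC om * (expi a * (expi (- a) * p)) + Ci * RtoC om * p)%C; [ring|].
  rewrite !expi_cancel. ring.
- intros y. rewrite !Hd.
  replace (expi (- a) * y + (p - expi (- a) * p) - p)%C with (expi (- a) * (y - p))%C by ring.
  now rewrite Cmod_mult, Cmod_expi, Rmult_1_l.
Qed.

Theorem mainTheorem5 (S0 : C -> Prop) (f : C -> C) (T : R)
  (r1 r2 dr1 dr2 : R -> C) (a1 a2 da1 da2 : R -> R) (xi1 xi2 : R -> C -> C)
  (hS0 : is_shape S0 f)
  (hline : ~ on_line S0) (hcircle : ~ on_circle S0)
  (hT : 0 < T)
  (hr1 : C1_on (V := C_R_NormedModule) T r1 dr1)
  (hr2 : C1_on (V := C_R_NormedModule) T r2 dr2)
  (ha1 : C1_on (V := R_NormedModule) T a1 da1)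
  (ha2 : C1_on (V := R_NormedModule) T a2 da2)
  (hxi1 : forall t, 0 <= t <= T ->
     is_complex_potential S0 f (a1 t) (r1 t) (dr1 t) (da1 t) (xi1 t))
  (hxi2 : forall t, 0 <= t <= T ->
     is_complex_potential S0 f (a2 t) (r2 t) (dr2 t) (da2 t) (xi2 t))
  (hinit : forall x, position S0 (a1 0) (r1 0) x <-> position S0 (a2 0) (r2 0) x)
  (hmeas : forall t, 0 <= t <= T ->
     exists M : R, forall z, M < Cmod z -> xi1 t z = xi2 t z) :
  forall t, 0 <= t <= T ->
    (forall x, position S0 (a1 t) (r1 t) x <-> position S0 (a2 t) (r2 t) x) /\
    (~ is_disk S0 ->
     forall z, velocity (r1 t) (dr1 t) (da1 t) z = velocity (r2 t) (dr2 t) (da2 t) z).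
Proof.
assert (hT' : 0 <= T) by lra.
destruct (classic (is_disk S0)) as [Hdisk|Hnd].
- assert (Hdisk' := Hdisk). destruct Hdisk' as [p [rho Hd]].
  assert (Hrho : 0 <= rho).
  { destruct hS0 as [[[[q Hq] _] _] _]. apply Hd in Hq.
    eapply Rle_trans; [apply Cmod_ge_0|exact Hq]. }
  assert (Hpos : forall a r x, position S0 a r x <-> Cmod (x - (r + expi a * p)) <= rho).
  { intros a r x.
    replace x with (expi a * (expi (- a) * (x - r)) + r)%C at 1
      by (rewrite expi_cancel; ring).
    rewrite position_expi, Hd.
    replace (x - (r + expi a * p))%C with (expi a * (expi (- a) * (x - r)) - expi a * p)%C
      by (rewrite expi_cancel; ring).
    replace (expi a * (expi (- a) * (x - r)) - expi a * p)%C with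
      (expi a * (expi (- a) * (x - r) - p))%C by ring.
    now rewrite (Cmod_mult (expi a)), Cmod_expi, Rmult_1_l. }
  (* The displacement of the disk from its reference place. In this description the angle is
     constantly 0 and the body-frame potential is [xi] read at [y + s]. *)
  set (s := fun (r : R -> C) (a : R -> R) t => (r t + expi (a t) * p + - p)%C).
  set (ds := fun (dr : R -> C) (a da : R -> R) t =>
    (dr t + Ci * RtoC (da t) * (expi (a t) * p))%C).
  set (X := fun (xi : R -> C -> C) (r : R -> C) (a : R -> R) t y =>
    xi t (expi (a t) * (expi (- a t) * y + (p - expi (- a t) * p)) + r t)%C).
  assert (HX : forall xi r a t y, X xi r a t y = xi t (y + s r a t)%C).
  { intros xi r a t y. unfold X, s. f_equal.
    transitivity (expi (a t) * (expi (- a t) * y) + expi (a t) * p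
      - expi (a t) * (expi (- a t) * p) + r t)%C; [ring|]. rewrite !expi_cancel. ring. }
  destruct (rigid_C1 T p (- p)%C r1 dr1 a1 da1 hT' hr1 ha1) as [P1 Q1].
  destruct (rigid_C1 T p (- p)%C r2 dr2 a2 da2 hT' hr2 ha2) as [P2 Q2].
  intros t Ht.
  destruct (motion_unique S0 f hS0 hline hcircle T (fun _ => 0) (fun _ => 0)
    (fun _ => 0) (fun _ => 0) (s r1 a1) (s r2 a2) (ds dr1 a1 da1) (ds dr2 a2 da2)
    (X xi1 r1 a1) (X xi2 r2 a2)) with (t := t) as [_ [E _]]; try assumption.
  + apply C1_real_zero.
  + apply C1_real_zero.
  + intros u Hu _. now split.
  + intros u Hu. replace (expi (- 0) * ds dr1 a1 da1 u)%C with (ds dr1 a1 da1 u)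
      by (rewrite Ropp_0, expi_0; ring).
    exact (disk_body_potential S0 f p _ _ rho _ _ _ hS0 Hd (hxi1 u Hu)).
  + intros u Hu. replace (expi (- 0) * ds dr2 a2 da2 u)%C with (ds dr2 a2 da2 u)
      by (rewrite Ropp_0, expi_0; ring).
    exact (disk_body_potential S0 f p _ _ rho _ _ _ hS0 Hd (hxi2 u Hu)).
  + reflexivity.
  + unfold s. f_equal. apply (disk_center_unique _ _ rho Hrho). intros x.
    rewrite <- !Hpos. apply hinit.
  + intros u Hu. destruct (hmeas u Hu) as [M HM]. exists (M + Cmod (s r1 a1 u)).
    intros y Hy. rewrite !HX, Rminus_0_r, Ropp_0, expi_0.
    replace (1 * y + 1 * (s r1 a1 u - s r2 a2 u) + s r2 a2 u)%C with (y + s r1 a1 u)%C by ring.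
    apply HM. generalize (Cmod_triangle_inv y (- s r1 a1 u)).
    replace (y - - s r1 a1 u)%C with (y + s r1 a1 u)%C by ring. rewrite Cmod_opp. lra.
  + split; [|now intros h].
    intros x. rewrite !Hpos. unfold s in E.
    replace (r1 t + expi (a1 t) * p)%C with (r1 t + expi (a1 t) * p + - p + p)%C by ring.
    rewrite E. now replace (r2 t + expi (a2 t) * p + - p + p)%C
      with (r2 t + expi (a2 t) * p)%C by ring.
(* The rigid motion carrying labels of the first body frame to those of the second at time 0. As the
   initial positions coincide as sets, it is a symmetry of [S0]. *)
- set (b := a1 0 - a2 0). set (s := (expi (- a2 0) * (r1 0 - r2 0))%C).
  assert (Hsym : forall y, S0 (expi b * y + s)%C <-> S0 y).
  { intros y. rewrite <- (position_expi S0 (a1 0) (r1 0) y), hinit,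
      <- (position_expi S0 (a2 0) (r2 0)).
    replace (expi (a2 0) * (expi b * y + s) + r2 0)%C with (expi (a1 0) * y + r1 0)%C;
      [reflexivity|].
    unfold s. transitivity (expi (a2 0) * expi b * y +
      expi (a2 0) * (expi (- a2 0) * (r1 0 - r2 0)) + r2 0)%C; [|ring].
    rewrite expi_cancel, <- expi_plus.
    replace (a2 0 + b) with (a1 0) by (unfold b; ring). ring. }
  (* The second motion described from the reference point [s] with angle [a2 + b]: it occupies the
     same sets and has the same velocity field, and its parameters now agree with those of the first
     motion at time 0. *)
  set (r2' := fun t => (r2 t + expi (a2 t) * s + 0)%C).
  set (dr2' := fun t => (dr2 t + Ci * RtoC (da2 t) * (expi (a2 t) * s))%C).
  destruct (rigid_C1 T s 0 r2 dr2 a2 da2 hT' hr2 ha2) as [P2 Q2].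
  intros t Ht.
  destruct (motion_unique S0 f hS0 hline hcircle T a1 (fun t => a2 t + b)
    da1 da2 r1 r2' dr1 dr2' (fun t y => xi1 t (expi (a1 t) * y + r1 t)%C)
    (fun t y => xi2 t (expi (a2 t) * (expi b * y + s) + r2 t)%C))
    with (t := t) as [E1 [E2 [E3 E4]]]; try assumption.
  + now apply C1_on_R.
  + apply C1_real_shift. now apply C1_on_R.
  + now apply C1_on_Re.
  + now apply C1_on_Im.
  + intros u Hu h. contradiction.
  + intros u Hu. now apply (body_potential_intro S0 f), hxi1.
  + intros u Hu.
    assert (H := body_potential_rigid S0 _ s _ b _ Hsym
      (body_potential_intro S0 f _ _ _ _ _ hS0 (hxi2 u Hu))).
    match type of H with body_potential _ ?v _ _ =>
      replace (expi (- (a2 u + b)) * dr2' u)%C with v; [exact H|] end.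
    replace (- (a2 u + b)) with (- b + - a2 u) by ring. rewrite expi_plus. unfold dr2'.
    transitivity (expi (- b) * (expi (- a2 u) * dr2 u + Ci * RtoC (da2 u) *
      (expi (a2 u) * (expi (- a2 u) * s))))%C; [now rewrite expi_cancel|ring].
  + unfold b. ring.
  + unfold r2', s. rewrite expi_cancel. ring.
  + intros u Hu. destruct (hmeas u Hu) as [M HM]. exists (M + Cmod (r1 u)).
    intros y Hy.
    assert (E : (expi (a2 u) * (expi b * (expi (a1 u - (a2 u + b)) * y +
      expi (- (a2 u + b)) * (r1 u - r2' u)) + s) + r2 u)%C = (expi (a1 u) * y + r1 u)%C).
    { replace (expi (a1 u)) with (expi (a2 u + b + (a1 u - (a2 u + b)))) by (f_equal; ring).
      rewrite (expi_plus (a2 u + b)).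
      transitivity (expi (a2 u + b) * expi (a1 u - (a2 u + b)) * y +
        expi (a2 u + b) * (expi (- (a2 u + b)) * (r1 u - r2' u)) + expi (a2 u) * s + r2 u)%C.
      - rewrite (expi_plus (a2 u) b). ring.
      - rewrite expi_cancel. unfold r2'. ring. }
    rewrite E. apply HM. generalize (Cmod_triangle_inv (expi (a1 u) * y) (- r1 u)).
    replace (expi (a1 u) * y - - r1 u)%C with (expi (a1 u) * y + r1 u)%C by ring.
    rewrite Cmod_opp, Cmod_mult, Cmod_expi. lra.
  + split.
    * intros x. replace x with (expi (a1 t) * (expi (- a1 t) * (x - r1 t)) + r1 t)%C
        by (rewrite expi_cancel; ring).
      set (y := (expi (- a1 t) * (x - r1 t))%C).
      rewrite position_expi, <- Hsym, <- (position_expi S0 (a2 t) (r2 t)).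
      replace (expi (a2 t) * (expi b * y + s) + r2 t)%C with (expi (a1 t) * y + r1 t)%C;
        [reflexivity|].
      rewrite E1, E2, expi_plus. unfold r2'. ring.
    * intros _ z. unfold velocity. rewrite E2, E3, E4. unfold r2', dr2'. ring.
Qed.
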